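(* Let $N=A^r/M$ be a graded left module over a filtered-commutative graded algebra $A$ over a field $k$, where $M$ is a left submodule of $A^r$. (Here $A$ is connected graded with homogeneous filtration, $\mathrm{gr}(A)$ is finitely generated, $A^r$ is a direct sum of $r$ shifts of $A$, and $M$ is generated by finitely many homogeneous elements $x_1,\dots,x_l$.) There is an algorithm that constructs the first $s+1$ terms $F_0,\dots,F_s$ of a free $A$-resolution $$\cdots\to F_s\xrightarrow{d_s}\cdots\xrightarrow{d_3}F_2\xrightarrow{d_2}F_1\xrightarrow{d_1}F_0=A^r\xrightarrow{\epsilon}N$$ for any $s$. The algorithm is the procedure RESOLUTION described in the context (whose first step replaces the presentation of $N$ by one with minimal $r$).
   Context: **Algebra.** A filtered-commutative algebra over $k$ is a $k$-algebra $A$ with a filtration by ideals $A=F_0A\supset F_1A\supset F_2A\supset\cdots$ such that $F_pA\cdot F_qA\subset F_{p+q}A$, $F_{p_{\mathrm{nul}}}A=0$ for some $p_{\mathrm{nul}}>0$, and $\mathrm{gr}(A)=\bigoplus_pF_pA/F_{p+1}A$ is commutative. Moreover $A=\bigoplus_{i\ge0}A_i$ is graded with $A_0=k$ (connected); $\deg$ is the degree of this grading and $A_+=\bigoplus_{i>0}A_i$. For $0\ne a\in A$, $\mathrm{pr}(a)$ is the class of $a$ in $F_pA/F_{p+1}A$, with $p$ maximal such that $a\in F_pA$; one says $a$ projects to $\mathrm{pr}(a)$. **Monomials.** Write $\mathrm{gr}(A)=P/I$, $P=k[x_1,\dots,x_n]$ (here the $x_i$ are variables), with the variables and $I$ homogeneous;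 $|\cdot|$ is the degree induced by the filtration. $P$ carries a degree-reversed admissible monomial ordering: a total order on monomials with (i) $M\le N\iff ML\le NL$, (ii) $|L|=0\Rightarrow M\le ML$, (iii) $|M|>|N|\Rightarrow M<N$. $\mathrm{LM}(f)$ is the largest monomial of $f$. $G$ is a Gröbner basis of $I$: a finite generating set of $I$ with $(\mathrm{LM}(f):f\in I)=(\mathrm{LM}(g):g\in G)$. $\mathcal B$ is the set of monomials not divisible by any $\mathrm{LM}(g)$, $g\in G$; modulo $I$ it is a $k$-basis of $\mathrm{gr}(A)$. Fix $X_i\in A$ projecting to $x_i$; for $m=x_1^{r_1}\cdots x_n^{r_n}\in\mathcal B$ put $\tilde m=X_1^{r_1}\cdots X_n^{r_n}$. These form a $k$-basis of $A$. For $f$ with $f=\sum c_im_i$ modulo $I$, $c_i\in k$, $m_i\in\mathcal B$, put $\tilde f=\sum c_i\tilde m_i\in A$. **Modules.** For a free module $A^r$ with $A$-basis $\tilde e_1,\dots,\tilde e_r$, consider the symbols $me_i$ ($m$ a monomial of $P$), viewed as monomials of $k[x_1,\dots,x_n,e_1,\dots,e_r]$, with a chosen ordering satisfying $m_1e_i<m_2e_i\iff m_1<m_2$ for all $i$ (for example: $m_1e_i<m_2e_j$ iff $i>j$, or $i=j$ and $m_1<m_2$). The elements $\tilde m\tilde e_i$ ($m\in\mathcal B$) form a $k$-basis of $A^r$, ordered accordingly. For $0\ne x\in A^r$, $\mathrm{LM}_{\mathbb B}(x)=me_i$ if $\tilde m\tilde e_i$ is the largest basis element occurring in $x$. Put $\mathbb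 A=A\oplus A^r$ with product $(a_1,x_1)(a_2,x_2)=(a_1a_2,a_1x_2+a_2x_1)$ and filtration $F_p\mathbb A=F_pA\oplus(F_pA)^r$, so $\mathrm{gr}(\mathbb A)=\mathrm{gr}(A)\oplus\mathrm{gr}(A)^r$ and $\mathrm{pr}(\tilde e_i)=e_i$. For $0\ne x\in A^r$, $\mathrm{pr}(x)$ is its class in $F_p\mathbb A/F_{p+1}\mathbb A$ with $p$ maximal such that $x\in F_p\mathbb A$; for $0\neq f\in\mathrm{gr}(A)^r$, written as a combination of the $me_i$ with $m\in\mathcal B$, $\mathrm{LT}_{\mathrm{gr}(\mathbb A)}(f)$ is the largest $me_i$ occurring in $f$ together with its coefficient. **Reduction.** Let $H\subset A^r$ be a finite ordered set, $0\notin H$. If some summand $c\,\tilde m\tilde e_i$ of $x\in A^r$ has $me_i$ divisible by $\mathrm{LM}_{\mathbb B}(h)$ for some $h\in H$, take the largest such summand and the first such $h$, let $c'$ be the coefficient in $h$ of its leading basis element, and replace $x$ by $x-\frac{c}{c'}\widetilde{(me_i/\mathrm{LM}_{\mathbb B}(h))}\,h$. Iterate until no longer possible; the outcome is $\mathrm{red}(x,H)$. **GB$(H)$.** For $H$ finite, ordered, $0\notin H$: (1) For $a\in H$, $g\in G$, let $L=\mathrm{lcm}(\mathrm{LM}_{\mathbb B}(a),\mathrm{LM}(g))$, $q=L/\mathrm{LM}_{\mathbb B}(a)$; if $\mathrm{red}(\tilde qa,H)$ is nonzero, append it to $H$. (2) For $a,b\in H$ such that $\mathrm{LM}_{\mathbb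 B}(a)$, $\mathrm{LM}_{\mathbb B}(b)$ contain the same factor $e_i$, let $L=\mathrm{lcm}(\mathrm{LM}_{\mathbb B}(a),\mathrm{LM}_{\mathbb B}(b))$, $t_1=L/\mathrm{LT}_{\mathrm{gr}(\mathbb A)}(\mathrm{pr}(a))$, $t_2=L/\mathrm{LT}_{\mathrm{gr}(\mathbb A)}(\mathrm{pr}(b))$; if $\mathrm{red}(\tilde t_1a-\tilde t_2b,H)$ is nonzero, append it to $H$. (3) Repeat (1), (2) until no more elements can be added. **SYZ$(X)$** computes generators of $\mathrm{Syz}(X)=\{(a_1,\dots,a_t)\in A^t:\sum a_ih_i=0\}$ for a tuple $X=(h_1,\dots,h_t)$ of elements of $A^r$. Apply GB to $X$ to get $H=(h_1,\dots,h_s)$, $s\ge t$, and a matrix $Q=\begin{pmatrix}I_t\\Q'\end{pmatrix}\in M_{s\times t}(A)$ with $H^T=QX^T$. For $1\le i\le s$, $g\in G$, let $q=\mathrm{lcm}(\mathrm{LM}_{\mathbb B}(h_i),\mathrm{LM}(g))/\mathrm{LM}_{\mathbb B}(h_i)$; $\mathrm{red}(\tilde qh_i,H)=0$ expands to $\tilde qh_i=\sum_la_lh_l$, and $\sigma_{i,g}$ is the syzygy of $H$ with $i$-th entry $\tilde q-a_i$ and other entries $-a_l$. For $i<j$ with $\mathrm{LM}_{\mathbb B}(h_i),\mathrm{LM}_{\mathbb B}(h_j)$ containing the same $e$-factor, let $L=\mathrm{lcm}(\mathrm{LM}_{\mathbb B}(h_i),\mathrm{LM}_{\mathbb B}(h_j))$,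 $t_i=L/\mathrm{LT}_{\mathrm{gr}(\mathbb A)}(\mathrm{pr}(h_i))$, $t_j=L/\mathrm{LT}_{\mathrm{gr}(\mathbb A)}(\mathrm{pr}(h_j))$; $\mathrm{red}(\tilde t_ih_i-\tilde t_jh_j,H)=0$ expands to $\tilde t_ih_i-\tilde t_jh_j=\sum_la_lh_l$, and $\sigma_{i,j}$ is the syzygy with $i$-th entry $\tilde t_i-a_i$, $j$-th entry $-\tilde t_j-a_j$ and other entries $-a_l$. Let $S$ be the matrix whose rows are all $\sigma_{i,g}$ and $\sigma_{i,j}$; the output is the rows of $SQ$. **MIN$(x_1,\dots,x_l)$** finds a subset that is a minimal generating set of the graded submodule generated by $x_1,\dots,x_l\in A^r$. Order so that $\deg x_1\le\dots\le\deg x_l$. Let $H_0=\emptyset$ and compute the Gröbner basis $H_i$ of the submodule generated by $x_1,\dots,x_i$ by applying GB to $H_{i-1}\cup\{\mathrm{red}(x_i,H_{i-1})\}$; if $\mathrm{red}(x_i,H_{i-1})=0$, mark $x_i$ as redundant (and $H_i=H_{i-1}$). Output the non-redundant $x_i$. **PRES** minimizes $r$. Given $N=A\{\tilde v_1,\dots,\tilde v_r\}/(Ax_1+\dots+Ax_l)$, let $y_i$ be obtained from $x_i$ by removing all terms in $A_+\{\tilde v_1,\dots,\tilde v_r\}$, so $N/A_+N\cong k\{\tilde v_1,\dots,\tilde v_r\}/(ky_1+\dots+ky_l)$. With $r'=\dim_k(N/A_+N)$, row reduce the $y_i$ to find, after renumbering, $\tilde v_1,\dots,\tilde v_{r'}$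 generating $N/A_+N$. The same row reductions on the $x_i$ express, in $N$, each $\tilde v_j$, $j>r'$, as a $k$-linear combination of $\tilde v_1,\dots,\tilde v_{r'}$ plus terms in $A_+\{\tilde v_1,\dots,\tilde v_r\}$; iterating, as an $A$-linear combination of $\tilde v_1,\dots,\tilde v_{r'}$. Thus replace $x_i$ by $x_i'\in A\tilde v_1+\dots+A\tilde v_{r'}$ with $N\cong A\{\tilde v_1,\dots,\tilde v_{r'}\}/(Ax_1'+\dots+Ax_l')$, and $r$ by $r'$. **RESOLUTION.** (1) Apply PRES. (2) Let $d_0=\epsilon:F_0=A^r\to N$ be the quotient map; apply MIN to $M=\ker d_0$ to get a minimal generating set $\{x_{11},\dots,x_{1l_1}\}$. (3) For $i=1,\dots,s$: given a minimal generating set $\{x_{i1},\dots,x_{il_i}\}$ of $\ker d_{i-1}$, let $F_i=A\{v_{i1},\dots,v_{il_i}\}$ be free with $\deg v_{ij}=\deg x_{ij}$ and $d_i(v_{ij})=x_{ij}$; use SYZ (and MIN) to compute a minimal generating set of $\ker d_i\cong\mathrm{Syz}(x_{i1},\dots,x_{il_i})$.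
   Formalization: The ordering of the symbols me_i is required to be compatible with multiplication by monomials (else red may not terminate), the lifts X_i are taken homogeneous, and where LT(pr(a)) and LM(a) have different e-factors, so that L/LT(pr(a)) is undefined, the leading term of a is used. *)

(* Defs.v *)
(* Elements of the free left module A^r are row
   vectors 'rV[A]_r with the left action a *: x, and left A-linear maps
   A^l -> A^r are right multiplications x |-> x *m D by D : 'M[A]_(l, r). *)
From HB Require Import structures.
From mathcomp Require Import all_boot all_order all_algebra.
From mathcomp Require Import mpoly.

Set Implicit Arguments.
Unset Strict Implicit.
Unset Printing Implicit Defensive.

Import GRing.Theory.
Local Open Scope ring_scope.

(* Data only; the conditions are the predicates below.
   - gr with cls is the associated graded algebra, commutative by its type:
     cls p a is the class of a \in F_p in F_p / F_{p+1}, as an element of gr.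
   - phi is the quotient map P = k[x_1, .., x_n] -> P/I = gr, so I is its kernel.
   - xlift i is X_i.
   - xwgt is the degree |.| induced by the filtration, xdeg the internal degree.
   - grc and coord return the coordinates of elements of gr and of A in the
     bases {m mod I} and {m~}, m \in B, encoded as polynomials supported on B.
     They are the means by which the procedures read elements of gr and A. *)
Record setting (k : fieldType) (A : algType k) := Setting {
  nvars : nat;
  gradA : nat -> {pred A};
  filt : nat -> {pred A};
  pnul : nat;
  gr : comAlgType k;
  cls : nat -> A -> gr;
  phi : {lrmorphism {mpoly k[nvars]} -> gr};
  xlift : 'I_nvars -> A;
  xwgt : 'I_nvars -> nat;
  xdeg : 'I_nvars -> nat;
  mle : rel 'X_{1..nvars};
  vle : forall r : nat, rel ('X_{1..nvars} * 'I_r);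
  gbasis : seq {mpoly k[nvars]};
  grc : gr -> {mpoly k[nvars]};
  coord : A -> {mpoly k[nvars]}
}.

Arguments xlift {k A} s _.
Arguments xwgt {k A} s _.
Arguments xdeg {k A} s _.
Arguments mle {k A} s _ _.
Arguments vle {k A} s {r} _ _.
Arguments cls {k A} s _ _.
Arguments phi {k A} s.
Arguments grc {k A} s _.
Arguments coord {k A} s _.

Definition maxelt (T : Type) (le : rel T) (s : seq T) : option T :=
  ohead (sort (fun x y => le y x) s).

Definition wdeg (n : nat) (w : 'I_n -> nat) (m : 'X_{1..n}) : nat :=
  (\sum_(i < n) m i * w i)%N.

Definition wpart (k : fieldType) (n : nat) (w : 'I_n -> nat) (d : nat)
    (f : {mpoly k[n]}) : {mpoly k[n]} :=
  \sum_(m <- msupp f | wdeg w m == d) f@_m *: 'X_[m].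

Definition in_ideal (k : fieldType) (n : nat) (gs : seq {mpoly k[n]})
    (f : {mpoly k[n]}) : Prop :=
  exists c : 'I_(size gs) -> {mpoly k[n]}, f = \sum_(i < size gs) c i * gs`_i.

Definition rowsmx (A : nzRingType) (r l : nat) (X : seq 'rV[A]_r) : 'M[A]_(l, r) :=
  \matrix_(i < l) nth 0 X i.

Definition rowspan (A : nzRingType) (r : nat) (X : seq 'rV[A]_r)
    (v : 'rV[A]_r) : Prop :=
  exists a : 'rV[A]_(size X), v = a *m rowsmx (size X) X.

(* resolution A s r is the type of chains
     A^(r_{s+1}) -> A^(r_s) -> .. -> A^(r_1) -> A^(r_0),  r_0 = r,
   where each map sends the standard basis of its source to the given list of
   elements of its target.  The last list consists of generators for the kernel
   of the map out of A^(r_s); its source is not part of F_0, .., F_s. *)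
Inductive resolution (A : nzRingType) : nat -> nat -> Type :=
| Last r (X : seq 'rV[A]_r) : resolution A 0 r
| Cons s r (X : seq 'rV[A]_r) (C : resolution A s (size X)) : resolution A s.+1 r.

(* F_0 has rank rank0, and its j-th basis vector is the basis vector number
   basis0 j of the given A^r. *)
Record output (A : nzRingType) (r s : nat) := Output {
  rank0 : nat;
  basis0 : 'I_rank0 -> 'I_r;
  chain : resolution A s rank0
}.

Arguments basis0 {A r s} o _.

Definition basis0_mx (A : nzRingType) (r s : nat) (o : output A r s) :
    'M[A]_(rank0 o, r) := \matrix_(j < rank0 o) delta_mx 0 (basis0 o j).

Fixpoint mapo (S T : Type) (f : S -> option T) (s : seq S) : option (seq T) :=
  if s is x :: s' then
    obind (fun y => omap (cons y) (mapo f s')) (f x)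
  else Some [::].

Section Algebra.
Variables (k : fieldType) (A : algType k) (D : setting A).
Local Notation n := (nvars D).
Local Notation P := {mpoly k[n]}.
Local Notation F := (filt D).

Definition connected_graded : Prop :=
  [/\ forall i, submod_closed (gradA D i),
      forall i j a b, a \in gradA D i -> b \in gradA D j -> a * b \in gradA D (i + j),
      forall a, a \in gradA D 0 <-> exists c : k, a = c%:A,
      forall a, exists N (u : nat -> A),
        (forall i, u i \in gradA D i) /\ a = \sum_(i < N) u i
    & forall N (u : nat -> A), (forall i, u i \in gradA D i) ->
        \sum_(i < N) u i = 0 -> forall i, (i < N)%N -> u i = 0].

Definition filtered : Prop :=
  [/\ forall a, a \in F 0,
      forall p a, a \in F p.+1 -> a \in F p,
      forall p, submod_closed (F p) /\
        (forall a b, b \in F p -> a * b \in F p /\ b * a \in F p),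
      forall p q a b, a \in F p -> b \in F q -> a * b \in F (p + q)
    & (0 < pnul D)%N /\ forall a, a \in F (pnul D) -> a = 0].

Definition homogeneous_filtration : Prop :=
  forall p N (u : nat -> A), (forall i, u i \in gradA D i) ->
    \sum_(i < N) u i \in F p -> forall i, (i < N)%N -> u i \in F p.

(* (gr, cls) is the direct sum of the quotients F_p / F_{p+1} with the induced
   product; this determines it up to a unique isomorphism. *)
Definition associated_graded : Prop :=
  [/\ forall p (c : k) a b, a \in F p -> b \in F p ->
        cls D p (c *: a + b) = c *: cls D p a + cls D p b,
      forall p a, a \in F p -> (cls D p a = 0 <-> a \in F p.+1),
      cls D 0 1 = 1 /\ (forall p q a b, a \in F p -> b \in F q ->
        cls D (p + q) (a * b) = cls D p a * cls D q b),
      forall u, exists N (a : nat -> A),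
        (forall p, a p \in F p) /\ u = \sum_(p < N) cls D p (a p)
    & forall N (a : nat -> A), (forall p, a p \in F p) ->
        \sum_(p < N) cls D p (a p) = 0 ->
        forall p, (p < N)%N -> cls D p (a p) = 0].

(* gr(A) = P/I with x_i and I homogeneous for both degrees, and X_i is a
   homogeneous element of A projecting to x_i. *)
Definition presents_gr : Prop :=
  [/\ forall u, exists f, phi D f = u,
      forall i, xlift D i \in F (xwgt D i) /\ xlift D i \notin F (xwgt D i).+1,
      forall i, phi D 'X_i = cls D (xwgt D i) (xlift D i),
      forall i, xlift D i \in gradA D (xdeg D i)
    & forall f d, phi D f = 0 ->
        phi D (wpart (xwgt D) d f) = 0 /\ phi D (wpart (xdeg D) d f) = 0].

Definition degree_reversed_order : Prop :=
  [/\ [/\ total (mle D), transitive (mle D) & antisymmetric (mle D)],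
      forall m1 m2 l, mle D m1 m2 = mle D (m1 + l)%MM (m2 + l)%MM,
      forall m l, wdeg (xwgt D) l = 0%N -> mle D m (m + l)%MM
    & forall m1 m2, (wdeg (xwgt D) m2 < wdeg (xwgt D) m1)%N ->
        mle D m1 m2 /\ m1 <> m2].

(* The symbols m e_i are monomials of k[x, e], and their ordering is a monomial
   ordering: it is compatible with multiplication by monomials in x.  Without
   this the reductions below need not terminate. *)
Definition module_order (r : nat) : Prop :=
  [/\ total (@vle k A D r), transitive (@vle k A D r),
      antisymmetric (@vle k A D r),
      forall (i : 'I_r) m1 m2, vle D (m1, i) (m2, i) = mle D m1 m2
    & forall (i j : 'I_r) m1 m2 l,
        vle D (m1, i) (m2, j) = vle D ((m1 + l)%MM, i) ((m2 + l)%MM, j)].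

Definition LM (f : P) : 'X_{1..n} := odflt 0%MM (maxelt (mle D) (msupp f)).

Definition groebner_basis : Prop :=
  [/\ forall g, g \in gbasis D -> g != 0 /\ phi D g = 0,
      forall f, phi D f = 0 -> in_ideal (gbasis D) f
    & forall f : P, f != 0 -> phi D f = 0 ->
        in_ideal [seq 'X_[k, LM g] | g <- gbasis D] 'X_[LM f]].

Definition standard (m : 'X_{1..n}) : bool :=
  ~~ has (fun g => (LM g <= m)%MM) (gbasis D).

(* The product is ordered: X_1^{m_1} X_2^{m_2} ... X_n^{m_n}. *)
Definition monA (m : 'X_{1..n}) : A := \prod_(i < n) xlift D i ^+ m i.

Definition evalA (f : P) : A := \sum_(m <- msupp f) f@_m *: monA m.

Definition coordinates : Prop :=
  (forall u, all standard (msupp (grc D u)) /\ phi D (grc D u) = u) /\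
  (forall a, all standard (msupp (coord D a)) /\ evalA (coord D a) = a).

Definition tilde (f : P) : A := evalA (grc D (phi D f)).

Section Modules.
Variable r : nat.
Local Notation mon := ('X_{1..n} * 'I_r)%type.

Definition sorted_supp (c : 'I_r -> P) : seq mon :=
  sort (fun u v => vle D v u) [seq (m, i) | i <- enum 'I_r, m <- msupp (c i)].

Definition coords (x : 'rV[A]_r) (i : 'I_r) : P := coord D (x 0 i).

Definition LMB (x : 'rV[A]_r) : option mon := ohead (sorted_supp (coords x)).

Definition coef (x : 'rV[A]_r) (u : mon) : k := (coords x u.2)@_u.1.

Definition ordp (x : 'rV[A]_r) : nat :=
  \max_(p < pnul D | [forall i, x 0 i \in F p]) p.

Definition pr (x : 'rV[A]_r) : 'rV[gr D]_r := \row_i cls D (ordp x) (x 0 i).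

Definition LTgr (f : 'rV[gr D]_r) : option (k * mon) :=
  let c i := grc D (f 0 i) in
  omap (fun u : mon => ((c u.2)@_u.1, u)) (ohead (sorted_supp c)).

Definition LTB (x : 'rV[A]_r) : option (k * mon) :=
  omap (fun u => (coef x u, u)) (LMB x).

(* For orderings of the symbols m e_i that are not degree-reversed across
   different e_i (such as position over term), LT_gr(pr(a)) and LM_B(a) may
   involve different e_i, and then L / LT_gr(pr(a)) makes no sense; the leading
   term of a itself is used in this case. *)
Definition LTdiv (a : 'rV[A]_r) : option (k * mon) :=
  match LTgr (pr a), LTB a with
  | Some t, Some t' => Some (if t.2.2 == t'.2.2 then t else t')
  | _, t' => t'
  end.

Definition quotLT (L : 'X_{1..n}) (a : 'rV[A]_r) : A :=
  if LTdiv a is Some (c, (m, _)) then tilde (c^-1 *: 'X_[L - m]) else 0.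

Definition gmult (a : 'rV[A]_r) (g : P) : A :=
  if LMB a is Some (m, _) then tilde 'X_[mlcm m (LM g) - m] else 0.

Definition smults (a b : 'rV[A]_r) : option (A * A) :=
  match LMB a, LMB b with
  | Some (ma, i), Some (mb, j) =>
      if i == j then
        let L := mlcm ma mb in Some (quotLT L a, quotLT L b)
      else None
  | _, _ => None
  end.

Definition LMB_divides (h : 'rV[A]_r) (u : mon) : bool :=
  if LMB h is Some (m, i) then (i == u.2) && (m <= u.1)%MM else false.

(* The largest reducible summand of x and the first element of H reducing it. *)
Definition redex (H : seq 'rV[A]_r) (x : 'rV[A]_r) : option (mon * 'I_(size H)) :=
  ohead (pmap (fun u =>
      omap (pair u) (ohead [seq l : 'I_(size H) <- enum 'I_(size H) | LMB_divides (nth 0 H l) u]))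
    (sorted_supp (coords x))).

(* c / c' times the lift of m e_i / LM_B(h), where u = m e_i *)
Definition redmult (x h : 'rV[A]_r) (u : mon) : A :=
  if LTB h is Some (c', (m, _)) then (coef x u / c') *: tilde 'X_[u.1 - m] else 0.

(* All loops carry a bound on their number of iterations, and return None when
   it is exceeded.  If red b H x = Some (y, a) then x = a_1 h_1 + .. + y. *)
Fixpoint red (b : nat) (H : seq 'rV[A]_r) (x : 'rV[A]_r) :
    option ('rV[A]_r * 'rV[A]_(size H)) :=
  if redex H x is Some (u, l) then
    if b is b'.+1 then
      let h := nth 0 H l in
      let t := redmult x h u in
      omap (fun ya => (ya.1, ya.2 + t *: delta_mx 0 l)) (red b' H (x - t *: h))
    else None
  else Some (x, 0).

(* In a pair (h, q), h is a member of H and q its row of the matrix Q. *)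
Section GB.
Variable t : nat.
Local Notation tracked := ('rV[A]_r * 'rV[A]_t)%type.

Definition candidates (K : seq tracked) : seq tracked :=
  [seq (gmult h.1 g *: h.1, gmult h.1 g *: h.2) | h <- K, g <- gbasis D] ++
  pmap (fun ab : tracked * tracked =>
      let: (a, b) := ab in
      omap (fun q : A * A => (q.1 *: a.1 - q.2 *: b.1, q.1 *: a.2 - q.2 *: b.2))
        (smults a.1 b.1))
    [seq (a, b) | a <- K, b <- K].

(* Some None: every candidate reduces to 0. *)
Fixpoint first_new (b : nat) (K cs : seq tracked) : option (option tracked) :=
  if cs is c :: cs' then
    let H := unzip1 K in
    obind (fun ya => if ya.1 == 0 then first_new b K cs'
                     else Some (Some (ya.1, c.2 - ya.2 *m rowsmx (size H) (unzip2 K))))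
      (red b H c.1)
  else Some None.

Fixpoint GB_loop (b b' : nat) (K : seq tracked) : option (seq tracked) :=
  match first_new b K (candidates K) with
  | Some (Some h) => if b' is b''.+1 then GB_loop b b'' (rcons K h) else None
  | Some None => Some K
  | None => None
  end.

End GB.

Definition GBQ (b : nat) (X : seq 'rV[A]_r) :
    option (seq ('rV[A]_r * 'rV[A]_(size X))) :=
  GB_loop b b [seq (nth 0 X i, delta_mx 0 i) | i : 'I_(size X) <- enum 'I_(size X)].

Definition GB (b : nat) (X : seq 'rV[A]_r) : option (seq 'rV[A]_r) :=
  omap unzip1 (GBQ b X).

Definition syz_row (b : nat) (H : seq 'rV[A]_r)
    (e : 'rV[A]_(size H)) :
    option 'rV[A]_(size H) :=
  omap (fun ya => e - ya.2) (red b H (e *m rowsmx (size H) H)).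

Definition syz_pairs (H : seq 'rV[A]_r) : seq 'rV[A]_(size H) :=
  [seq gmult (nth 0 H i) g *: delta_mx 0 i
     | i : 'I_(size H) <- enum 'I_(size H), g : P <- gbasis D] ++
  pmap (fun ij : 'I_(size H) * 'I_(size H) =>
      let: (i, j) := ij in
      omap (fun q : A * A => q.1 *: delta_mx 0 i - q.2 *: delta_mx 0 j)
        (smults (nth 0 H i) (nth 0 H j)))
    [seq ij : 'I_(size H) * 'I_(size H) <- [seq (i, j) | i <- enum 'I_(size H), j <- enum 'I_(size H)]
       | (ij.1 < ij.2)%N].

Definition SYZ (b : nat) (X : seq 'rV[A]_r) : option (seq 'rV[A]_(size X)) :=
  obind (fun K : seq ('rV[A]_r * 'rV[A]_(size X)) =>
      let H := unzip1 K in
      let Q := rowsmx (size H) (unzip2 K) in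
      omap (map (fun sigma => sigma *m Q)) (mapo (@syz_row b H) (syz_pairs H)))
    (GBQ b X).

(* The free module is the direct sum of the shifts of A with the i-th basis
   vector in degree delta i. *)
Variable delta : 'I_r -> int.

Definition homogeneous (d : int) (x : 'rV[A]_r) : Prop :=
  forall i, match d - delta i return Prop with
            | Posz j => x 0 i \in gradA D j
            | Negz _ => x 0 i = 0
            end.

(* The degree of x, for x nonzero homogeneous. *)
Definition vdeg (x : 'rV[A]_r) : int :=
  if LMB x is Some (m, i) then delta i + (wdeg (xdeg D) m)%:Z else 0.

Fixpoint MIN_loop (b : nat) (H X : seq 'rV[A]_r) : option (seq 'rV[A]_r) :=
  if X is x :: X' then
    obind (fun ya : _ * _ =>
        if ya.1 == 0 then MIN_loop b H X'
        else obind (fun H' => omap (cons x) (MIN_loop b H' X')) (GB b (rcons H ya.1)))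
      (red b H x)
  else Some [::].

Definition MIN (b : nat) (X : seq 'rV[A]_r) : option (seq 'rV[A]_r) :=
  MIN_loop b [::] (sort (fun x y => vdeg x <= vdeg y) X).

(* cst a is the component of a in A_0 = k, obtained by removing all terms in A_+;
   the vectors y_i are the x_i with cst applied to all entries. *)
Definition cst (a : A) : k := (coord D a)@_0%MM.

Definition clear (j : 'I_r) (p x : 'rV[A]_r) : 'rV[A]_r :=
  x - (cst (x 0 j))%:A *: p.

(* Row reduction of the y_i, performed on the x_i.  The result lists the pivot
   columns j with their rows; in N, such a row expresses v_j through the basis
   vectors that are not pivots, up to terms in A_+. *)
Fixpoint row_reduce (js : seq 'I_r) (piv : seq ('I_r * 'rV[A]_r))
    (todo : seq 'rV[A]_r) : seq ('I_r * 'rV[A]_r) :=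
  if js is j :: js' then
    let l := find (fun x : 'rV[A]_r => cst (x 0 j) != 0) todo in
    if (l < size todo)%N then
      let x := nth 0 todo l in
      let p := ((cst (x 0 j))^-1)%:A *: x in
      row_reduce js' ((j, p) :: [seq (q.1, clear j p q.2) | q <- piv])
        [seq clear j p z | z <- take l todo ++ drop l.+1 todo]
    else row_reduce js' piv todo
  else piv.

(* Replace every pivot v_j by v_j - (row of j), until no pivot occurs. *)
Fixpoint substitute (b : nat) (piv : seq ('I_r * 'rV[A]_r)) (x : 'rV[A]_r) :
    option 'rV[A]_r :=
  if all (fun q : 'I_r * 'rV[A]_r => x 0 q.1 == 0) piv then Some x
  else if b is b'.+1 then
    substitute b' piv (x - \sum_(q <- piv) x 0 q.1 *: q.2)
  else None.

(* The basis vectors that are kept, and the relations between them. *)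
Definition PRES (b : nat) (X : seq 'rV[A]_r) :
    option {B : seq 'I_r & seq 'rV[A]_(size B)} :=
  let piv := row_reduce (enum 'I_r) [::] X in
  let B : seq 'I_r := [seq j <- enum 'I_r | j \notin unzip1 piv] in
  omap (fun Y : seq 'rV[A]_r =>
      existT (fun B : seq 'I_r => seq 'rV[A]_(size B)) B
        [seq \row_(j < size B) y 0 (tnth (in_tuple B) j) | y : 'rV[A]_r <- Y])
    (mapo (substitute b piv) X).

End Modules.

(* X is a minimal generating set of ker d_{i-1} in F_{i-1} = A^r. *)
Fixpoint RES_loop (b s r : nat) (delta : 'I_r -> int) (X : seq 'rV[A]_r) :
    option (resolution A s r) :=
  if s is s'.+1 then
    let delta' (j : 'I_(size X)) := vdeg delta (nth 0 X j) in
    obind (fun Y => obind (fun Z => omap (@Cons A s' r X) (RES_loop b s' delta' Z))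
                      (MIN delta' b Y))
      (SYZ b X)
  else Some (Last X).

Definition RESOLUTION (s r : nat) (delta : 'I_r -> int) (X : seq 'rV[A]_r)
    (b : nat) : option (output A r s) :=
  obind (fun BY : {B : seq 'I_r & seq 'rV[A]_(size B)} =>
      let sel := tnth (in_tuple (projT1 BY)) in
      let delta0 j := delta (sel j) in
      obind (fun Z => omap (@Output A r s _ sel) (RES_loop b s delta0 Z))
        (MIN delta0 b (projT2 BY)))
    (PRES b X).

Definition minimal_generators (r : nat) (K : 'rV[A]_r -> Prop)
    (X : seq 'rV[A]_r) : Prop :=
  (forall v, K v <-> rowspan X v) /\
  (forall i, (i < size X)%N ->
     exists v, K v /\ ~ rowspan (take i X ++ drop i.+1 X) v).

(* The list X at the head of the chain consists of homogeneous elements and is a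
   minimal generating set of the kernel K of the map out of A^r, so that the
   next map d is homogeneous with image K; and so on with ker d. *)
Fixpoint resolves (s r : nat) (C : resolution A s r) :
    ('I_r -> int) -> ('rV[A]_r -> Prop) -> Prop :=
  match C in resolution _ _ r
        return ('I_r -> int) -> ('rV[A]_r -> Prop) -> Prop with
  | Last r X => fun delta K =>
      (forall x, x \in X -> homogeneous delta (vdeg delta x) x) /\
      minimal_generators K X
  | Cons s r X C' => fun delta K =>
      [/\ forall x, x \in X -> homogeneous delta (vdeg delta x) x,
          minimal_generators K X
        & resolves C' (fun j => vdeg delta (nth 0 X j))
            (fun a => a *m rowsmx (size X) X = 0)]
  end.

End Algebra.

(* Main.v *)
(* Multiplying an element of A^r by the lift of a monomial q multiplies its leading
   symbol by q up to smaller symbols: the product of the lifts of q and m differs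
   from the lift of qm by an element of higher filtration degree, and the monomial
   order is degree-reversed.  Although the order is not a well-order, it is one on
   the standard monomials, because their filtration degree is bounded; so
   reductions terminate, and Dickson's lemma stops the completion procedure.

   Order the symbols m e_l of A^s by m LM(h_l) (Schreyer's order).  It is again a
   monomial order, and each sigma_{i,g} and sigma_{i,j} has a known leading symbol.
   Rewriting a coefficient vector a by these syzygies until none applies, either
   nothing is left or the leading symbol of a_1 h_1 + ... + a_s h_s comes from a
   single term and cannot cancel.  Hence combinations of the h_l reduce to 0, and
   every syzygy is a combination of the sigma's.

   Minimality comes from the grading: a homogeneous relation that expresses a
   generator through the others has scalar coefficients in top degree.  For the
   presentation, the augmentation A -> A_0 = k is a ring morphism under which all
   remaining relations vanish, so the number of generators kept is the dimension
   of N / A_+ N. *)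
Require Import Defs.
From HB Require Import structures.
From mathcomp Require Import all_boot all_order all_algebra.
From mathcomp Require Import mpoly.
From mathcomp Require Import zify.
From Stdlib Require Import Classical IndefiniteDescription.

Set Implicit Arguments.
Unset Strict Implicit.
Unset Printing Implicit Defensive.

Import GRing.Theory.
Local Open Scope ring_scope.

(** * Termination *)

(** Leading terms are stated for arbitrary symbols, standard or not: a nonstandard symbol always
    rewrites to smaller ones, and this drop is what the syzygies sigma_{i,g} record. One division
    theorem, [schreyer], is proved for an abstract submodule [Sigma] of coefficient vectors and used
    twice. With all syzygies of H as [Sigma] it shows that elements of the span reduce to 0; with
    those syzygies that the matrix Q sends into the span of the computed rows it shows that these
    rows generate. What links it to the algorithm is a bound on the quotients of a reduction: their
    terms never exceed the symbols of the element being reduced. Since every loop carries a bound,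
    results are asserted for all large bounds, so that bounds of nested loops can be merged.
    Reduction and completion do not read the internal degree, so homogeneity of their results is a
    separate invariant, carried along with the rows of Q. *)

Lemma nondecreasing_subsequence (f : nat -> nat) :
  exists g : nat -> nat,
    (forall i, (g i < g i.+1)%N) /\ (forall i, (f (g i) <= f (g i.+1))%N).
Proof.
(* Every tail contains a position whose value is minimal from there on; choosing such positions one
   after the other gives [g]. *)
have minP i : exists j, (i <= j)%N /\ forall l, (j <= l)%N -> (f j <= f l)%N.
  have [N] := ubnP (f i); elim: N i => // N IHN i fiN.
  case: (classic (exists2 l, (i <= l)%N & (f l < f i)%N)) => [[l il fl]|nol].
    have [j [lj jP]] := IHN l (leq_trans fl fiN).
    by exists j; split=> //; apply: leq_trans lj.
  exists i; split=> // l il; rewrite leqNgt; apply/negP => fl.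
  by apply: nol; exists l.
have [h hP] := functional_choice _ minP.
exists (fun n => iter n (fun m => h m.+1) (h 0%N)); split=> i /=.
  by have [] := hP (iter i (fun m => h m.+1) (h 0%N)).+1.
have gP : forall l, (iter i (fun m => h m.+1) (h 0) <= l)%N ->
    (f (iter i (fun m => h m.+1) (h 0)) <= f l)%N.
  by case: i => [|i] /=; [have [] := hP 0%N | have [] := hP (iter i (fun m => h m.+1) (h 0)).+1].
by apply: gP; apply: ltnW; have [] := hP (iter i (fun m => h m.+1) (h 0%N)).+1.
Qed.

(** One coordinate after another is made monotone by thinning out the sequence, which is why the
    induction keeps a whole subsequence. Indexing by any finite type lets weights and components
    join the exponents as further coordinates. *)
Lemma dickson (J : finType) (f : J -> nat -> nat) :
  exists i j, (i < j)%N /\ forall c, (f c i <= f c j)%N.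
Proof.
suff [g [gI gP]] : exists g : nat -> nat, (forall i, (g i < g i.+1)%N) /\
    (forall c, c \in enum J -> forall i, (f c (g i) <= f c (g i.+1))%N).
  by exists (g 0%N), (g 1%N); split=> // c; apply: gP; rewrite mem_enum.
elim: (enum J) => [|c s [g [gI gP]]]; first by exists id; split.
have [h [hI hP]] := nondecreasing_subsequence (f c \o g).
have gmono (F : nat -> nat) : (forall i, (F i <= F i.+1)%N) ->
    forall i j, (i <= j)%N -> (F i <= F j)%N.
  by move=> FS; apply: (homo_leq (r := leq)) => //; apply: leq_trans.
exists (g \o h); split=> [i|c']; first exact: (homo_ltn ltn_trans gI (hI i)).
rewrite inE => /predU1P [->|/gP c'P] i; first exact: hP.
by apply: (gmono (f c' \o g)) => //; apply: ltnW; apply: hI.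
Qed.

(** Turns Dickson's lemma, a statement about infinite sequences, into an induction principle. *)
Lemma wf_no_descending_chain (T : Type) (R : T -> T -> Prop) :
  (forall f : nat -> T, ~ forall n, R (f n.+1) (f n)) -> well_founded R.
Proof.
move=> noR x; apply: NNPP => nAx.
have stepP (y : {y | ~ Acc R y}) : exists z : {z | ~ Acc R z}, R (sval z) (sval y).
  case: y => y /= nAy; apply: NNPP => noz; apply: nAy; constructor=> z Rzy.
  by apply: NNPP => nAz; apply: noz; exists (exist _ z nAz).
have [h hP] := functional_choice _ stepP.
by apply: (noR (fun n => sval (iter n h (exist _ x nAx)))) => n /=; apply: hP.
Qed.

Section Maximum.
Variables (T : eqType) (le : rel T).
Hypotheses (le_total : total le) (le_trans : transitive le).

Lemma ohead_sortP (s : seq T) :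
  match ohead (sort (fun x y => le y x) s) with
  | Some u => u \in s /\ forall v, v \in s -> le v u
  | None => s = [::]
  end.
Proof.
have ge_total : total (fun x y => le y x) by move=> x y; apply: le_total.
have ge_trans : transitive (fun x y => le y x).
  by move=> y x z yx zy; apply: le_trans zy yx.
have := sort_sorted ge_total s; have := mem_sort (fun x y => le y x) s.
case: (sort _ s) => [|u s'] us.
  by case: s us => // x s /(_ x); rewrite inE eqxx.
rewrite /= path_sortedE // => /andP [/allP us' _]; split.
  by rewrite -us inE eqxx.
move=> v; rewrite -us inE => /predU1P [->|/us' //].
by case/orP: (le_total u u).
Qed.

(** Describes [redex], which sorts first and filters afterwards: its choice is maximal among
    reducible summands only. *)
Lemma ohead_pmap_sortP (U : Type) (f : T -> option U) (s : seq T) :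
  match ohead (pmap f (sort (fun x y => le y x) s)) with
  | Some y => exists u, [/\ u \in s, f u = Some y
                          & forall v, v \in s -> f v -> le v u]
  | None => forall v, v \in s -> f v = None
  end.
Proof.
have ge_total : total (fun x y => le y x) by move=> x y; apply: le_total.
have ge_trans : transitive (fun x y => le y x).
  by move=> y x z yx zy; apply: le_trans zy yx.
have ss := sort_sorted ge_total s; have ms := mem_sort (fun x y => le y x) s.
have headP s' : sorted (fun x y => le y x) s' ->
  match ohead (pmap f s') with
  | Some y => exists u, [/\ u \in s', f u = Some y
                          & forall v, v \in s' -> f v -> le v u]
  | None => forall v, v \in s' -> f v = None
  end.
  elim: s' => //= x s' IHs; rewrite path_sortedE // => /andP [/allP xs' /IHs {IHs}].
  case fx: (f x) => [y|] /=.
    move=> _; exists x; split; rewrite ?inE ?eqxx // => v.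
    rewrite inE => /predU1P [->|/xs' //] _.
    by case/orP: (le_total x x).
  case: (ohead _) => [y [u [us fu uP]]|nof] => [|v].
    exists u; split; rewrite ?inE ?us ?orbT // => v.
    by rewrite inE => /predU1P [->|]; [rewrite fx | apply: uP].
  by rewrite inE => /predU1P [->|/nof].
move: (headP _ ss); case: (ohead _) => [y [u [us fu uP]]|nof].
  by exists u; rewrite -ms; split=> // v; rewrite -ms; apply: uP.
by move=> v; rewrite -ms; apply: nof.
Qed.

End Maximum.

(** Asking for all large bounds, rather than some bound, makes the value unique and lets composed
    procedures share a common bound. *)
Definition eventually (T : Type) (f : nat -> option T) (v : T) : Prop :=
  exists B, forall b, (B <= b)%N -> f b = Some v.

Section Eventually.
Variables (T U : Type).

Lemma eventually_obind (f : nat -> option T) (g : nat -> T -> option U) v w :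
  eventually f v -> eventually (g^~ v) w -> eventually (fun b => obind (g b) (f b)) w.
Proof.
move=> [B fB] [C gC]; exists (maxn B C) => b; rewrite geq_max => /andP [Bb Cb].
by rewrite fB //= gC.
Qed.

Lemma eventually_omap (f : nat -> option T) (g : T -> U) v :
  eventually f v -> eventually (fun b => omap g (f b)) (g v).
Proof. by move=> [B fB]; exists B => b Bb; rewrite fB. Qed.

Lemma eventually_unique (f : nat -> option T) v w :
  eventually f v -> eventually f w -> v = w.
Proof.
move=> [B fB] [C fC]; apply: Some_inj.
by rewrite -(fB (maxn B C)) ?leq_maxl // fC // leq_maxr.
Qed.

End Eventually.

Lemma eventually_mapo (S : eqType) (T : Type) (f : nat -> S -> option T)
    (Q : S -> T -> Prop) (s : seq S) :
  (forall x, x \in s -> exists2 y, eventually (f^~ x) y & Q x y) ->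
  exists t, [/\ eventually (fun b => mapo (f b) s) t, size t = size s &
    forall x0 y0 i, (i < size s)%N -> Q (nth x0 s i) (nth y0 t i)].
Proof.
elim: s => [|x s IHs] sP; first by exists [::]; split=> //; exists 0%N.
have [y fy Qy] := sP x (mem_head x s).
have [t [ft szt Qt]] := IHs (fun z zs => sP z (mem_behead (s := x :: s) zs)).
exists (y :: t); split=> [||x0 y0 [|i] //=]; [|by rewrite /= szt|exact: Qt].
by apply: eventually_obind fy _; apply: eventually_omap.
Qed.

(** * Normal forms in gr(A) and bases of A *)

Section Algebra.
Variables (k : fieldType) (A : algType k) (D : setting A).
Hypotheses (A_graded : connected_graded D) (A_filtered : filtered D).
Hypotheses (gr_A : associated_graded D) (gr_presented : presents_gr D).
Hypotheses (mle_order : degree_reversed_order D) (G_groebner : groebner_basis D).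
Hypothesis grc_coord : coordinates D.
Hypothesis vle_order : forall r : nat, module_order D r.
Local Notation n := (nvars D).
Local Notation P := {mpoly k[n]}.
Local Notation F := (filt D).
Local Notation wt := (wdeg (xwgt D)).
Local Notation dg := (wdeg (xdeg D)).
Local Notation std := (@standard k A D).
Implicit Types (m : 'X_{1..n}) (f : P).

Definition mlt (m1 m2 : 'X_{1..n}) : bool := mle D m1 m2 && (m1 != m2).

Lemma wdegD (w : 'I_n -> nat) m1 m2 : wdeg w (m1 + m2)%MM = (wdeg w m1 + wdeg w m2)%N.
Proof. by rewrite /wdeg -big_split; apply: eq_bigr => i _; rewrite mnmDE mulnDl. Qed.

Lemma wdeg0 (w : 'I_n -> nat) : wdeg w 0%MM = 0%N.
Proof. by rewrite /wdeg big1 // => i _; rewrite mnm0E. Qed.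

Lemma mcoeff_wpart (w : 'I_n -> nat) d (f : P) m :
  (wpart w d f)@_m = if wdeg w m == d then f@_m else 0.
Proof.
rewrite /wpart raddf_sum /=.
under eq_bigr do rewrite mcoeffZ mcoeffX.
case: ifP => md; last first.
  rewrite big1 // => m' /eqP m'd; case: eqP => [mm'|]; last by rewrite mulr0.
  by rewrite -mm' m'd eqxx in md.
case: (boolP (m \in msupp f)) => mf; last first.
  rewrite (memN_msupp_eq0 mf) big_seq_cond big1 // => m' /andP [m'f _].
  by case: eqP => [mm'|]; [rewrite -mm' m'f in mf | rewrite mulr0].
rewrite big_mkcond (bigD1_seq m) ?msupp_uniq //= md eqxx mulr1 big1 ?addr0 //.
by move=> m' /negPf m'm; rewrite m'm mulr0 if_same.
Qed.

Lemma mle_refl m : mle D m m.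
Proof. by have [[tot _ _] _ _ _] := mle_order; case/orP: (tot m m). Qed.

Lemma mle_anti : antisymmetric (mle D).
Proof. by have [[_ _ anti] _ _ _] := mle_order. Qed.

Lemma wt_mlt m1 m2 : (wt m2 < wt m1)%N -> mlt m1 m2.
Proof.
by have [_ _ _ H] := mle_order => /H [m12 /eqP ne]; rewrite /mlt m12.
Qed.

Lemma LM_max (f : P) : f != 0 ->
  LM f \in msupp f /\ forall m, m \in msupp f -> mle D m (LM f).
Proof.
have [[tot tr _] _ _ _] := mle_order => f0.
have := ohead_sortP tot tr (msupp f); rewrite /LM /maxelt.
by case: (ohead _) => [u //|/eqP]; rewrite msupp_eq0 (negPf f0).
Qed.

(** A monomial in a monomial ideal is divisible by one of the generators, since some summand must
    contribute to its coefficient. *)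
Lemma LM_ideal_nonstandard (f : P) : f != 0 -> phi D f = 0 -> ~~ std (LM f).
Proof.
have [_ _ H] := G_groebner => f0 /(H _ f0) [c /(congr1 (mcoeff (LM f)))].
rewrite mcoeffX eqxx raddf_sum /= => sum1; apply/negPn/hasP; apply: NNPP => nog.
case/eqP: (oner_neq0 k); apply: etrans sum1 _; rewrite big1 // => i _.
have ig : (i < size (gbasis D))%N by apply: leq_trans (ltn_ord i) _; rewrite size_map.
rewrite (nth_map 0) //; apply/eqP; rewrite mcoeff_eq0 (perm_mem (msuppMX _ _)).
apply/mapP => -[m _ e].
apply: nog; exists (gbasis D)`_i; first exact: mem_nth.
by rewrite /= e; apply: lem_addr.
Qed.

Lemma standard_inj (f : P) : all std (msupp f) -> phi D f = 0 -> f = 0.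
Proof.
move=> /allP fstd f0; apply: contraTeq isT => fn0.
by have [/fstd] := LM_max fn0; rewrite (negPf (LM_ideal_nonstandard fn0 f0)).
Qed.

Lemma all_standardB (f g : P) c : all std (msupp f) ->
  all std (msupp g) -> all std (msupp (f - c *: g)).
Proof.
move=> /allP fs /allP gs; apply/allP => m /msuppB_le; rewrite mem_cat.
by case/orP => [/fs //|/msuppZ_le /gs].
Qed.

(** [grc] is only known to return some standard representative; independence of the standard
    monomials modulo I makes it unique. *)
Lemma grc_phi (f : P) : all std (msupp f) -> grc D (phi D f) = f.
Proof.
have [H _] := grc_coord => fs; have [gs e] := H (phi D f).
apply/eqP; rewrite -subr_eq0 -[f in _ - f]scale1r; apply/eqP/standard_inj.
  exact: all_standardB.
by rewrite scale1r rmorphB /= e subrr.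
Qed.

Definition nf (f : P) : P := grc D (phi D f).

Lemma nf_standard f : all std (msupp (nf f)).
Proof. by have [H _] := grc_coord; have [] := H (phi D f). Qed.

Lemma phi_nf f : phi D (nf f) = phi D f.
Proof. by have [H _] := grc_coord; have [] := H (phi D f). Qed.

Lemma nfZ c f : nf (c *: f) = c *: nf f.
Proof.
have -> : nf (c *: f) = grc D (phi D (c *: nf f)) by rewrite /nf !linearZ /= phi_nf.
by apply: grc_phi; apply/allP => m /msuppZ_le; apply: (allP (nf_standard f)).
Qed.

Lemma mcoeffX_if m v : ('X_[m] : P)@_v = if m == v then 1 else 0.
Proof. by rewrite mcoeffX; case: eqP. Qed.

(** The difference of x^m and its normal form lies in I, so its leading monomial is nonstandard; the
    only candidate is m itself. *)
Lemma nf_le m v : v \in msupp (nf 'X_[m]) -> mle D v m.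
Proof.
have [[tot _ _] _ _ _] := mle_order.
set f := nf _ => vf; case/orP: (tot v m) => // mv.
case: (eqVneq m v) => [->|mv']; first exact: mle_refl.
have gE w : (f - 'X_[m])@_w = f@_w - (if m == w then 1 else 0).
  by rewrite mcoeffB mcoeffX_if.
have v_g : v \in msupp (f - 'X_[m]).
  by rewrite mcoeff_msupp gE (negPf mv') subr0 -mcoeff_msupp.
have g0 : f - 'X_[m] != 0 by apply: contraTneq v_g => ->; rewrite msupp0.
have [Lg Lmax] := LM_max g0.
have := LM_ideal_nonstandard g0; rewrite rmorphB /= phi_nf subrr => /(_ erefl) /negP [].
apply: (allP (nf_standard 'X_[m])); rewrite -/f mcoeff_msupp.
move: Lg; rewrite mcoeff_msupp gE; case: (m =P _) => [e _|_]; last by rewrite subr0.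
by move: (Lmax v v_g); rewrite -e => vm; case/eqP: mv'; apply: mle_anti; rewrite mv vm.
Qed.

Lemma wpart_standard w d (f : P) : all std (msupp f) ->
  all std (msupp (wpart w d f)).
Proof.
move=> /allP fs; apply/allP => m; rewrite mcoeff_msupp mcoeff_wpart.
by case: ifP; rewrite ?eqxx // -mcoeff_msupp => _ /fs.
Qed.

(** If v had another degree than m, the part of [nf 'X_[m] - 'X_[m]] in the degree of v would be a
    combination of standard monomials in I, hence 0. *)
Lemma nf_wdeg_homogeneous (w : 'I_n -> nat) m v :
  (forall f d, phi D f = 0 -> phi D (wpart w d f) = 0) ->
  v \in msupp (nf 'X_[m]) -> wdeg w v = wdeg w m.
Proof.
move=> H; apply: contraTeq => vm; rewrite -mcoeff_eq0; apply/eqP.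
have phi0 : phi D (nf 'X_[m] - 'X_[m]) = 0 by rewrite rmorphB /= phi_nf subrr.
have gE u : wdeg w u = wdeg w v -> (nf 'X_[m] - 'X_[m])@_u = (nf 'X_[m])@_u.
  rewrite mcoeffB mcoeffX_if; case: (m =P u) => [<- mv|_]; last by rewrite subr0.
  by rewrite mv eqxx in vm.
have := congr1 (mcoeff v) (standard_inj _ (H _ (wdeg w v) phi0)).
rewrite mcoeff_wpart eqxx gE // mcoeff0; apply.
apply/allP => u; rewrite mcoeff_msupp mcoeff_wpart.
case: (wdeg w u =P _) => [uv|]; last by rewrite eqxx.
by rewrite gE // -mcoeff_msupp; apply: (allP (nf_standard _)).
Qed.

Lemma nf_wdeg m v : v \in msupp (nf 'X_[m]) -> wt v = wt m /\ dg v = dg m.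
Proof.
have [_ _ _ _ H] := gr_presented => vm.
by split; apply: nf_wdeg_homogeneous vm => f d /(H _ d) [].
Qed.

(** * Evaluation in A and classes in gr(A) *)

Lemma evalA_mmap f : evalA f = mmap (in_alg A) (xlift D) f.
Proof. by apply: eq_bigr => m _; rewrite mulr_algl. Qed.

Lemma evalAX m : evalA 'X_[m] = monA m.
Proof. by rewrite evalA_mmap mmapX. Qed.

Lemma evalA_linear : linear (@evalA k A D).
Proof. by move=> c f g; rewrite !evalA_mmap mmapD mmapZ mulr_algl. Qed.
HB.instance Definition _ := GRing.isLinear.Build k P A _ (@evalA k A D) evalA_linear.

(** Unlike for [pr], the class [u] may be 0; this keeps the predicate stable under sums and
    products. *)
Definition homclass p (a : A) (u : gr D) : Prop := a \in F p /\ cls D p a = u.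

Lemma homclass_linear p c a b u v :
  homclass p a u -> homclass p b v -> homclass p (c *: a + b) (c *: u + v).
Proof.
have [_ _ H _ _] := A_filtered; have [L _ _ _ _] := gr_A.
have [[_ Fl] _] := H p => -[ap <-] [bp <-].
by split; [apply: Fl | apply: L].
Qed.

Lemma homclassM p q a b u v :
  homclass p a u -> homclass q b v -> homclass (p + q) (a * b) (u * v).
Proof.
have [_ _ _ H _] := A_filtered; have [_ _ [_ M] _ _] := gr_A.
by move=> [ap <-] [bq <-]; split; [apply: H | apply: M].
Qed.

Lemma homclass1 : homclass 0 1 1.
Proof. by have [H _ _ _ _] := A_filtered; have [_ _ [e _] _ _] := gr_A. Qed.

Lemma filt_decr p q a : (p <= q)%N -> a \in F q -> a \in F p.
Proof.
have [_ H _ _ _] := A_filtered => /subnK <-.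
by elim: (q - p)%N => // d IH /H.
Qed.

Lemma homclass0 p a : a \in F p.+1 -> homclass p a 0.
Proof.
have [_ H _ _ _] := A_filtered => /[dup] aS /H ap; split=> //.
by have [_ H' _ _ _] := gr_A; apply/H'.
Qed.

Lemma homclass_eq0 p a : homclass p a 0 -> a \in F p.+1.
Proof. by have [_ H _ _ _] := gr_A; case=> ap /H; apply. Qed.

Lemma homclass_monA m : homclass (wt m) (monA m) (phi D 'X_[m]).
Proof.
have [_ xF xphi _ _] := gr_presented.
rewrite mpolyXE_id rmorph_prod /= /monA /wdeg.
under [X in homclass _ _ X]eq_bigr do rewrite rmorphXn /=.
elim/big_rec3: _ => [|i a u p _ IH]; first exact: homclass1.
apply: homclassM => //; elim: (m i) => [|e IHe]; first exact: homclass1.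
rewrite mulSn !exprS; apply: homclassM => //.
by split; [have [] := xF i | rewrite xphi].
Qed.

Lemma homclass_evalA p f : (forall m, m \in msupp f -> (p <= wt m)%N) ->
  homclass p (evalA f) (phi D (wpart (xwgt D) p f)).
Proof.
move=> fp; rewrite /evalA /wpart rmorph_sum /= [X in homclass _ _ X]big_mkcond /=.
rewrite [X in homclass _ X _]big_seq [X in homclass _ _ X]big_seq.
elim/big_rec2: _ => [|m u a mf IH].
  by have [_ _ H _ _] := A_filtered; have [[F0 _] _] := H p.+1; apply: homclass0.
have mp := fp m mf; case: eqP => [e|ne].
  by rewrite linearZ /=; apply: homclass_linear => //; rewrite -e; apply: homclass_monA.
rewrite -[X in homclass _ _ (X + _)](scaler0 _ f@_m); apply: homclass_linear => //.
apply: homclass0; have [mF _] := homclass_monA m.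
by apply: filt_decr mF; rewrite ltn_neqAle mp andbT eq_sym; apply/eqP.
Qed.

(** Weights are peeled off from below: when all monomials have weight at least p, the vanishing
    class in degree p kills the part of weight p. Hence the weights exceed every bound. *)
Lemma evalA_standard_inj f : all std (msupp f) -> evalA f = 0 -> f = 0.
Proof.
have [_ _ HF _ _] := A_filtered.
move=> fs f0; have H p m : m \in msupp f -> (p <= wt m)%N.
  elim: p m => // p IHp m mf; rewrite ltn_neqAle IHp // andbT.
  have [_] := homclass_evalA IHp; rewrite f0.
  have [F0 _] := HF p.+1; have [_ ->] := homclass0 (F0.1).
  move=> /esym /(standard_inj (wpart_standard _ _ fs)) /(congr1 (mcoeff m)).
  rewrite mcoeff_wpart mcoeff0; case: (wt m =P p) => [_ e|/nesym/eqP //].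
  by rewrite mcoeff_msupp e eqxx in mf.
apply/eqP; rewrite -msupp_eq0; case e: (msupp f) => [//|m s].
by have := H (wt m).+1 m; rewrite e inE eqxx ltnn => /(_ isT).
Qed.

Lemma coord_standard a : all std (msupp (Defs.coord D a)).
Proof. by have [_ H] := grc_coord; have [] := H a. Qed.

Lemma evalA_coord a : evalA (Defs.coord D a) = a.
Proof. by have [_ H] := grc_coord; have [] := H a. Qed.

Lemma coord_evalA f : all std (msupp f) -> Defs.coord D (evalA f) = f.
Proof.
move=> fs; apply/eqP; rewrite -subr_eq0 -[f in _ - f]scale1r; apply/eqP/evalA_standard_inj.
  by apply: all_standardB => //; apply: coord_standard.
by rewrite scale1r linearB /= evalA_coord subrr.
Qed.

Lemma coord_linear : linear (Defs.coord D).
Proof.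
move=> c a b; rewrite -{1}(evalA_coord a) -{1}(evalA_coord b) -linearP coord_evalA //.
rewrite -[c]opprK scaleNr addrC; apply: all_standardB; exact: coord_standard.
Qed.

Lemma coord_filt p a m : a \in F p -> m \in msupp (Defs.coord D a) -> (p <= wt m)%N.
Proof.
elim: p m => // p IHp m aF ma; have [_ H _ _ _] := A_filtered.
have ap := H _ _ aF; rewrite ltn_neqAle IHp // andbT.
have [_] := homclass_evalA (fun m => IHp m ap); rewrite evalA_coord.
have [_ ->] := homclass0 aF.
move=> /esym /(standard_inj (wpart_standard _ _ (coord_standard a))) /(congr1 (mcoeff m)).
rewrite mcoeff_wpart mcoeff0; case: (wt m =P p) => [_ e|/nesym/eqP //].
by rewrite mcoeff_msupp e eqxx in ma.
Qed.

(** A heavier monomial evaluates into the vanishing piece of the filtration, whereas a standard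
    monomial has nonzero class. *)
Lemma standard_wt m : std m -> (wt m < pnul D)%N.
Proof.
have [_ _ HF _ [_ pn]] := A_filtered; rewrite ltnNge => ms; apply/negP => mp.
have [mF e] := homclass_monA m.
have m0 : monA m = 0 by apply: pn; apply: filt_decr mF.
have [_ e0] := homclass0 (HF (wt m).+1).1.1.
suff /(congr1 (mcoeff m)) : 'X_[m] = 0 :> P.
  by rewrite mcoeffX_if eqxx mcoeff0 => /eqP; rewrite oner_eq0.
by apply: standard_inj; [rewrite msuppX /= ms | rewrite -e m0 e0].
Qed.

(** For nonstandard m this lifts the normal form of x^m, and in general it is not the ordered
    product [monA m]. *)
Definition tmon m : A := tilde 'X_[m].

Lemma tildeZ c m : tilde (c *: 'X_[m]) = c *: tmon m.
Proof. by rewrite /tmon /tilde -/(nf _) nfZ linearZ. Qed.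

Lemma homclass_tmon m : homclass (wt m) (tmon m) (phi D 'X_[m]).
Proof.
have := @homclass_evalA (wt m) (nf 'X_[m]).
set f := nf _ => H; have : wpart (xwgt D) (wt m) f = f.
  apply/mpolyP => v; rewrite mcoeff_wpart; case: eqP => // vm.
  apply/esym/eqP; rewrite mcoeff_eq0; apply: contra_notN vm.
  by case/nf_wdeg.
move=> e; rewrite e phi_nf in H; apply: H => v /nf_wdeg [-> _] //.
Qed.

Definition acoef (a : A) m : k := (Defs.coord D a)@_m.

Lemma acoefP c a b m : acoef (c *: a + b) m = c * acoef a m + acoef b m.
Proof. by rewrite /acoef coord_linear mcoeffD mcoeffZ. Qed.

Lemma acoef0 m : acoef 0 m = 0.
Proof. by have := acoefP (-1) 0 0 m; rewrite scaler0 addr0 mulN1r addNr. Qed.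

Lemma acoefZ c a m : acoef (c *: a) m = c * acoef a m.
Proof. by rewrite -[_ *: _]addr0 acoefP acoef0 addr0. Qed.

Lemma acoef_standard a m : acoef a m != 0 -> std m.
Proof. by rewrite -mcoeff_msupp; apply: (allP (coord_standard a)). Qed.

Lemma acoef_tmon m v : acoef (tmon m) v = (nf 'X_[m])@_v.
Proof. by rewrite /acoef coord_evalA // nf_standard. Qed.

Lemma acoef_tmon_le m v : acoef (tmon m) v != 0 -> mle D v m.
Proof. by rewrite acoef_tmon -mcoeff_msupp => /nf_le. Qed.

Lemma nf_standardX m : std m -> nf 'X_[m] = 'X_[m].
Proof. by move=> ms; apply: grc_phi; rewrite msuppX /= ms. Qed.

Lemma acoef_tmon_standard m v : std m -> acoef (tmon m) v = if m == v then 1 else 0.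
Proof. by move=> ms; rewrite acoef_tmon nf_standardX // mcoeffX_if. Qed.

Lemma tmon_standard m : std m -> tmon m = monA m.
Proof. by move=> ms; rewrite /tmon /tilde -/(nf _) nf_standardX // evalAX. Qed.

Lemma acoef_tmon_nonstandard m v : ~~ std m -> acoef (tmon m) v != 0 -> mlt v m.
Proof.
move=> ms vm; rewrite /mlt acoef_tmon_le //; apply: contraNneq ms => <-.
exact: acoef_standard vm.
Qed.

Lemma tmon_expansion a : a = \sum_(m <- msupp (Defs.coord D a)) acoef a m *: tmon m.
Proof.
rewrite -{1}(evalA_coord a) /evalA [LHS]big_seq [RHS]big_seq.
by apply: eq_bigr => m /(allP (coord_standard a)) ms; rewrite tmon_standard.
Qed.

(* Both products have the same class in F_w / F_{w+1}, and elements of F_{w+1} only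
   involve monomials of larger weight, which are smaller. *)
Lemma tmonM_lt q m v : acoef (tmon q * tmon m - tmon (q + m)%MM) v != 0 -> mlt v (q + m)%MM.
Proof.
rewrite -mcoeff_msupp => H; apply: wt_mlt; apply: coord_filt H; apply: homclass_eq0.
have := homclassM (homclass_tmon q) (homclass_tmon m); rewrite -wdegD => H'.
have := homclass_linear (-1) (homclass_tmon (q + m)%MM) H'.
by rewrite !scaleN1r mpolyXD rmorphM /= addNr addrC.
Qed.

(** * Leading terms in free modules *)

(** Row vectors carry only the left action of [A], so scalars of k act through the central elements
    [c%:A]. *)
Lemma alg_scale (U : lmodType A) c (a : A) (x : U) : (c *: a) *: x = c%:A *: (a *: x).
Proof. by rewrite scalerA mulr_algl. Qed.

Lemma algC_scale (U : lmodType A) (c : k) (a : A) (x : U) :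
  a *: (c%:A *: x) = c%:A *: (a *: x).
Proof. by rewrite !scalerA mulr_algl mulr_algr. Qed.

Definition shift (r : nat) (q : 'X_{1..n}) (u : 'X_{1..n} * 'I_r) :=
  ((q + u.1)%MM, u.2).

Lemma shiftD r q p (u : 'X_{1..n} * 'I_r) : shift q (shift p u) = shift (q + p)%MM u.
Proof. by rewrite /shift /= addmA. Qed.

Definition basis_vec (r : nat) (u : 'X_{1..n} * 'I_r) : 'rV[A]_r :=
  tmon u.1 *: delta_mx 0 u.2.

Section Coefficients.
Variable r : nat.
Local Notation mon := ('X_{1..n} * 'I_r)%type.
Implicit Types (u v w : mon) (x y : 'rV[A]_r).

Lemma mcoefE x v : coef x v = acoef (x 0 v.2) v.1.
Proof. by []. Qed.

Lemma mcoefP c x y v : coef (c%:A *: x + y) v = c * coef x v + coef y v.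
Proof. by rewrite !mcoefE !mxE mulr_algl acoefP. Qed.

Lemma mcoef0 v : coef (0 : 'rV[A]_r) v = 0.
Proof.
by have := mcoefP (-1) 0 0 v; rewrite scaler0 addr0 mulN1r addNr.
Qed.

Lemma mcoefD x y v : coef (x + y) v = coef x v + coef y v.
Proof. by have := mcoefP 1 x y v; rewrite !scale1r mul1r. Qed.

Lemma mcoefZ c x v : coef (c%:A *: x) v = c * coef x v.
Proof. by have := mcoefP c x 0 v; rewrite mcoef0 !addr0. Qed.

Lemma mcoefB x y v : coef (x - y) v = coef x v - coef y v.
Proof. by have := mcoefZ (-1) y v; rewrite mcoefD !scaleN1r mulN1r => ->. Qed.

Lemma coef_standard x v : coef x v != 0 -> std v.1.
Proof. exact: acoef_standard. Qed.

Lemma coef_delta a i v : coef (a *: delta_mx 0 i) v = if v.2 == i then acoef a v.1 else 0.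
Proof.
rewrite mcoefE !mxE eqxx /=; case: eqP => _; first by rewrite mulr1.
by rewrite mulr0; have := mcoef0 v; rewrite mcoefE mxE.
Qed.

Lemma basis_vec_expansion x :
  x = \sum_i \sum_(m <- msupp (Defs.coord D (x 0 i)))
        (coef x (m, i))%:A *: basis_vec (m, i).
Proof.
rewrite {1}(row_sum_delta x); apply: eq_bigr => i _.
rewrite {1}(tmon_expansion (x 0 i)) scaler_suml.
by apply: eq_bigr => m _; rewrite alg_scale.
Qed.

Lemma coef_eq0 x : (forall v, coef x v = 0) -> x = 0.
Proof.
move=> x0; rewrite (basis_vec_expansion x) big1 // => i _; rewrite big1 // => m _.
by rewrite x0 scale0r scale0r.
Qed.

Definition supported (S : mon -> Prop) x : Prop := forall v, coef x v != 0 -> S v.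

Lemma supported0 S : supported S 0.
Proof. by move=> v; rewrite mcoef0 eqxx. Qed.

Lemma supportedP S c x y :
  supported S x -> supported S y -> supported S (c%:A *: x + y).
Proof.
move=> xS yS v; rewrite mcoefP; case: (eqVneq (coef x v) 0) => [->|/xS //].
by rewrite mulr0 add0r => /yS.
Qed.

Lemma supportedD S x y : supported S x -> supported S y -> supported S (x + y).
Proof. by move=> xS yS; have := supportedP (c := 1) xS yS; rewrite !scale1r. Qed.

Lemma supportedZ S c x : supported S x -> supported S (c%:A *: x).
Proof. by move=> xS; rewrite -[_ *: x]addr0; apply: supportedP => //; apply: supported0. Qed.

Lemma supported_sum S (I : Type) (s : seq I) (Q : pred I) (f : I -> 'rV[A]_r) :
  (forall i, Q i -> supported S (f i)) -> supported S (\sum_(i <- s | Q i) f i).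
Proof. by move=> H; elim/big_ind: _ => //; [apply: supported0 | apply: supportedD]. Qed.

Lemma supported_scale S a x :
  (forall v, coef x v != 0 -> supported S (a *: basis_vec v)) -> supported S (a *: x).
Proof.
move=> xS; rewrite {1}(basis_vec_expansion x) scaler_sumr; apply: supported_sum => i _.
rewrite big_seq scaler_sumr; apply: supported_sum => m mx.
rewrite algC_scale; apply: supportedZ; apply: xS.
by rewrite mcoefE -mcoeff_msupp.
Qed.

Definition supp x : seq mon :=
  [seq (m, i) | i <- enum 'I_r, m <- msupp (coords D x i)].

Lemma mem_supp x v : (v \in supp x) = (coef x v != 0).
Proof.
apply/allpairsPdep/idP => [[i [m [_ mx ->]]]|vx]; first by rewrite mcoefE -mcoeff_msupp.
by exists v.2, v.1; rewrite mem_enum mcoeff_msupp -surjective_pairing.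
Qed.

End Coefficients.

Lemma supported_mulmx r (S : 'X_{1..n} * 'I_r -> Prop) s (a : 'rV[A]_s) (H : 'M[A]_(s, r)) :
  (forall v : 'X_{1..n} * 'I_s, coef a v != 0 ->
     supported S ((coef a v)%:A *: (tmon v.1 *: row v.2 H))) ->
  supported S (a *m H).
Proof.
move=> aS; rewrite mulmx_sum_row; apply: supported_sum => i _.
rewrite (tmon_expansion (a 0 i)) scaler_suml big_seq; apply: supported_sum => m ma.
by rewrite alg_scale; apply: (aS (m, i)); rewrite mcoefE /= -mcoeff_msupp.
Qed.

(** The conditions of [module_order] for an arbitrary relation, so that the theory below serves both
    the given orders and Schreyer's order. *)
Definition monomial_order (r : nat) (ord : rel ('X_{1..n} * 'I_r)) : Prop :=
  [/\ total ord, transitive ord, antisymmetric ord,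
      forall (i : 'I_r) m1 m2, ord (m1, i) (m2, i) = mle D m1 m2
    & forall (i j : 'I_r) m1 m2 l,
        ord (m1, i) (m2, j) = ord ((m1 + l)%MM, i) ((m2 + l)%MM, j)].

Definition slt (r : nat) (ord : rel ('X_{1..n} * 'I_r)) u v := ord u v && (u != v).

Section LeadingTerms.
Variables (r : nat) (ord : rel ('X_{1..n} * 'I_r)).
Hypothesis ord_monomial : monomial_order ord.
Local Notation mon := ('X_{1..n} * 'I_r)%type.
Implicit Types (u v w : mon) (x y : 'rV[A]_r).
Local Notation "u <% v" := (slt ord u v) (at level 70).

Lemma ord_total : total ord. Proof. by case: ord_monomial. Qed.
Lemma ord_trans : transitive ord. Proof. by case: ord_monomial. Qed.
Lemma ord_anti : antisymmetric ord. Proof. by case: ord_monomial. Qed.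
Lemma ord_refl u : ord u u. Proof. by case/orP: (ord_total u u). Qed.

Lemma sltxx u : (u <% u) = false.
Proof. by rewrite /slt eqxx andbF. Qed.

Lemma sltW u v : u <% v -> ord u v.
Proof. by case/andP. Qed.

Lemma slt_le_trans v u w : u <% v -> ord v w -> u <% w.
Proof.
move=> /andP [uv ne] vw; rewrite /slt (ord_trans uv vw) /=.
by apply: contraNneq ne => e; apply/eqP/ord_anti; rewrite uv e vw.
Qed.

Lemma le_slt_trans v u w : ord u v -> v <% w -> u <% w.
Proof.
move=> uv /andP [vw ne]; rewrite /slt (ord_trans uv vw) /=.
by apply: contraNneq ne => e; apply/eqP/ord_anti; rewrite vw -e uv.
Qed.

Lemma slt_trans : transitive (slt ord).
Proof. by move=> v u w uv /sltW; apply: slt_le_trans. Qed.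

Lemma sltNle u v : (u <% v) = ~~ ord v u.
Proof.
apply/idP/idP => [/andP [uv]|vu].
  by apply: contra => vu; apply/eqP/ord_anti; rewrite uv vu.
case/orP: (ord_total u v) => [uv|]; last by rewrite (negPf vu).
by rewrite /slt uv /=; apply: contraNneq vu => ->; apply: ord_refl.
Qed.

Lemma ord_shift q u v : ord (shift q u) (shift q v) = ord u v.
Proof.
have [_ _ _ _ H] := ord_monomial.
by rewrite /shift ![(q + _)%MM]addmC -H; case: u; case: v.
Qed.

Lemma slt_shift q u v : (shift q u <% shift q v) = (u <% v).
Proof. by rewrite !sltNle ord_shift. Qed.

Lemma slt_component m1 m2 i : ((m1, i) <% (m2, i)) = mlt m1 m2.
Proof.
have [_ _ _ H _] := ord_monomial.
by rewrite /slt /mlt H; congr (_ && ~~ _); apply/eqP/eqP => [[]|->].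
Qed.

(* Standard monomials have weight less than [pnul].  Adding [pnul - weight] to the
   exponents, Dickson's lemma finds in every infinite sequence a later term
   that is a multiple of an earlier one by a monomial of weight 0, hence not
   smaller. *)
Lemma slt_wf : well_founded (fun u v => [&& std u.1, std v.1 & u <% v]).
Proof.
apply: wf_no_descending_chain => f fP.
pose g (c : 'I_n + 'I_3) i : nat := match c with
  | inl c => (f i).1 c
  | inr c => nth 0%N [:: (pnul D - wt (f i).1)%N; nat_of_ord (f i).2; (r - (f i).2)%N] c
  end.
have [i [j [ij gij]]] := dickson g.
have fstd l : std (f l).1 by have /and3P [] := fP l.
have chain : forall d, f (i + d.+1)%N <% f i.
  elim=> [|d IHd]; first by rewrite addn1; have /and3P [] := fP i.
  by rewrite addnS; apply: slt_trans IHd; have /and3P [] := fP (i + d.+1)%N.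
have := chain (j - i.+1)%N; rewrite addnS -addSn subnKC //.
have le1 : ((f i).1 <= (f j).1)%MM by apply/mnm_lepP => c; apply: (gij (inl c)).
have e2 : (f i).2 = (f j).2.
  apply/val_inj; have := gij (inr (@Ordinal 3 1 isT)).
  have := gij (inr (@Ordinal 3 2 isT)); rewrite /=.
  by have := ltn_ord (f i).2; have := ltn_ord (f j).2; lia.
have wt0 : wt ((f j).1 - (f i).1)%MM = 0%N.
  have := gij (inr (@Ordinal 3 0 isT)); rewrite /=.
  have := standard_wt (fstd i); have := standard_wt (fstd j).
  by have := congr1 wt (submK le1); rewrite wdegD; lia.
have [_ _ order0 _] := mle_order.
rewrite sltNle; case: (f i) (f j) le1 e2 wt0 => m1 c1 [m2 c2] /= le1 -> wt0.
have [_ _ _ H _] := ord_monomial; rewrite H.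
by rewrite -(submK le1) addmC order0.
Qed.

Definition below x u : Prop := supported (fun v => v <% u) x.
(** Neither [std u.1] nor [c != 0] is demanded. For standard u, [c] is the coefficient of [x] at u;
    for nonstandard u the condition collapses to [below x u]. This lets leading terms be shifted and
    subtracted before normal forms are taken. *)
Definition lead x u c : Prop := below (x - c%:A *: basis_vec u) u.

Lemma below_basis_vec u : ~~ std u.1 -> below (basis_vec u) u.
Proof.
case: u => m i /= us [v j]; rewrite coef_delta /=; case: (j =P _) => [->|]; rewrite ?eqxx //.
by move/(acoef_tmon_nonstandard us); rewrite slt_component.
Qed.

Lemma tmonM_below q u c :
  below (c%:A *: (tmon q *: basis_vec u - basis_vec (shift q u))) (shift q u).
Proof.
apply: supportedZ; rewrite /basis_vec /shift /= scalerA -scalerBl => -[v j].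
rewrite coef_delta /=; case: (j =P _) => [->|]; rewrite ?eqxx //.
by move/tmonM_lt; rewrite slt_component.
Qed.

Lemma basis_vec_le u : supported (fun v => ord v u) (basis_vec u).
Proof.
case: u => m i [v j]; rewrite coef_delta /=; case: (j =P _) => [->|]; rewrite ?eqxx //.
by move/acoef_tmon_le; have [_ _ _ H _] := ord_monomial; rewrite H.
Qed.

Lemma tmonM_basis_vec_le q u : supported (fun v => ord v (shift q u)) (tmon q *: basis_vec u).
Proof.
rewrite -[_ *: _](subrK (basis_vec (shift q u))) -[X in X + _]scale1r -[1]scale1r.
apply: supportedD; last exact: basis_vec_le.
by move=> v /tmonM_below /sltW.
Qed.

Lemma below_tmon q x u : below x u -> below (tmon q *: x) (shift q u).
Proof.
move=> xu; apply: supported_scale => v /xu vu w /tmonM_basis_vec_le wv.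
by apply: le_slt_trans wv _; rewrite slt_shift.
Qed.

Lemma lead_tmon q x u c : lead x u c -> lead (tmon q *: x) (shift q u) c.
Proof.
rewrite /lead => /(below_tmon (q := q)) H; have := supportedD H (tmonM_below (u := u) (q := q) (c := c)).
by rewrite !scalerBr algC_scale addrA subrK.
Qed.

Lemma leadZ d x u c : lead x u c -> lead (d%:A *: x) u (d * c).
Proof.
by move=> H; rewrite /lead -[(d * c)%:A]scalerA (alg_scale d c%:A) -scalerBr; apply: supportedZ.
Qed.

Lemma leadD x y u c d : lead x u c -> lead y u d -> lead (x + y) u (c + d).
Proof.
move=> xu yu; have := supportedD xu yu.
by rewrite /lead addrACA -opprD -scalerDl -scalerDl.
Qed.

Lemma leadB x y u c d : lead x u c -> lead y u d -> lead (x - y) u (c - d).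
Proof.
by move=> xu /(leadZ (d := -1)) /(leadD xu); rewrite !scaleN1r mulN1r.
Qed.

Lemma below_lead x u : below x u <-> lead x u 0.
Proof. by rewrite /lead scale0r scale0r subr0. Qed.

Lemma leadBr x y u c : lead x u c -> below y u -> lead (x - y) u c.
Proof. by move=> xu /below_lead yu; rewrite -[c]subr0; apply: leadB. Qed.

Lemma lead_coef_eq x u c : std u.1 -> lead x u c -> coef x u = c.
Proof.
move=> us H; apply/eqP; rewrite -subr_eq0; apply/negPn/negP => ne.
suff /H : coef (x - c%:A *: basis_vec u) u != 0 by rewrite sltxx.
rewrite mcoefB mcoefZ coef_delta eqxx acoef_tmon_standard // eqxx mulr1.
by [].
Qed.

Lemma lead_nonstandard x u c : ~~ std u.1 -> lead x u c -> below x u.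
Proof.
move=> us H; rewrite -[x](subrK (c%:A *: basis_vec u)).
by apply: supportedD H _; apply: supportedZ; apply: below_basis_vec.
Qed.

Lemma leadP x u : std u.1 -> (forall v, coef x v != 0 -> ord v u) -> lead x u (coef x u).
Proof.
move=> us xu v; rewrite mcoefB mcoefZ coef_delta; case: (eqVneq v u) => [->|vu].
  by rewrite eqxx acoef_tmon_standard // eqxx mulr1 subrr eqxx.
case: (eqVneq v.2 u.2) => [e|_]; last by rewrite mulr0 subr0 => /xu; rewrite /slt vu andbT.
rewrite acoef_tmon_standard //; case: (u.1 =P _) => [e'|_].
  by rewrite (surjective_pairing v) (surjective_pairing u) e e' eqxx in vu.
by rewrite mulr0 subr0 => /xu; rewrite /slt vu andbT.
Qed.

Lemma coef_max x : x != 0 ->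
  exists u, coef x u != 0 /\ forall v, coef x v != 0 -> ord v u.
Proof.
move=> x0; have := ohead_sortP ord_total ord_trans (supp x).
case: (ohead _) => [u|s0].
  by rewrite mem_supp => -[ux H]; exists u; split=> // v; rewrite -mem_supp; apply: H.
case/eqP: x0; apply: coef_eq0 => v; apply/eqP; rewrite -[_ == 0]negbK -mem_supp s0.
by [].
Qed.

End LeadingTerms.

(** * Homogeneous elements *)

(** Shifts by [delta] make degrees integers; extending the grading by 0 allows degrees to be
    subtracted freely. *)
Definition gradZ (z : int) (a : A) : Prop :=
  match z with Posz j => a \in gradA D j | Negz _ => a = 0 end.

Lemma homogeneousE r (delta : 'I_r -> int) d (x : 'rV[A]_r) :
  homogeneous D delta d x <-> forall i, gradZ (d - delta i) (x 0 i).
Proof. by []. Qed.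

Lemma gradZ_linear z c a b : gradZ z a -> gradZ z b -> gradZ z (c *: a + b).
Proof.
have [H _ _ _ _] := A_graded; case: z => j /=; first by have [_ L] := H j; apply: L.
by move=> -> ->; rewrite scaler0 addr0.
Qed.

Lemma gradZ0 z : gradZ z 0.
Proof. by have [H _ _ _ _] := A_graded; case: z => j //=; have [] := H j. Qed.

Lemma gradZZ z c a : gradZ z a -> gradZ z (c *: a).
Proof. by move=> za; rewrite -[_ *: _]addr0; apply: gradZ_linear => //; apply: gradZ0. Qed.

Lemma gradZD z a b : gradZ z a -> gradZ z b -> gradZ z (a + b).
Proof. by move=> za zb; rewrite -[a]scale1r; apply: gradZ_linear. Qed.

Lemma gradZB z a b : gradZ z a -> gradZ z b -> gradZ z (a - b).
Proof. by move=> za zb; rewrite addrC -scaleN1r; apply: gradZ_linear. Qed.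

Lemma gradZ_sum z (I : Type) (s : seq I) (Q : pred I) (f : I -> A) :
  (forall i, Q i -> gradZ z (f i)) -> gradZ z (\sum_(i <- s | Q i) f i).
Proof. by move=> H; elim/big_ind: _ => //; [apply: gradZ0 | apply: gradZD]. Qed.

Lemma gradZM z1 z2 z a b : z = z1 + z2 -> gradZ z1 a -> gradZ z2 b -> gradZ z (a * b).
Proof.
have [_ H _ _ _] := A_graded => ->; case: z1 => i /= ai; last by rewrite ai mul0r => _; apply: gradZ0.
by case: z2 => j /= bj; [apply: H | rewrite bj mulr0; apply: gradZ0].
Qed.

Lemma gradA1 : 1 \in gradA D 0.
Proof. by have [_ _ H _ _] := A_graded; apply/H; exists 1; rewrite scale1r. Qed.

Lemma monA_grad m : monA m \in gradA D (dg m).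
Proof.
have [_ H _ _ _] := A_graded; have [_ _ _ xg _] := gr_presented.
rewrite /monA /wdeg; elim/big_rec2: _ => [|i a d _ IH]; first exact: gradA1.
apply: (H) => //; elim: (m i) => [|e IHe]; first exact: gradA1.
by rewrite mulSn exprS; apply: H.
Qed.

Lemma evalA_grad f d : (forall m, m \in msupp f -> dg m = d) -> evalA f \in gradA D d.
Proof.
move=> fd; rewrite /evalA big_seq; apply: (@gradZ_sum (Posz d)) => m /fd <-.
by apply: (@gradZZ (Posz _)); apply: monA_grad.
Qed.

Lemma tmon_grad m : tmon m \in gradA D (dg m).
Proof. by apply: evalA_grad => v /nf_wdeg []. Qed.

(** The grading is given by predicates only. The projection is read off the coordinates, which is
    legitimate because monomials evaluate to homogeneous elements. *)
Definition gproj (z : int) (a : A) : A :=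
  if z is Posz d then evalA (wpart (xdeg D) d (Defs.coord D a)) else 0.

Lemma wpart_linear (w : 'I_n -> nat) d c f (g : P) :
  wpart w d (c *: f + g) = c *: wpart w d f + wpart w d g.
Proof.
apply/mpolyP => m; rewrite mcoeffD mcoeffZ !mcoeff_wpart mcoeffD mcoeffZ.
by case: ifP => //; rewrite mulr0 addr0.
Qed.

Lemma gproj_linear z c a b : gproj z (c *: a + b) = c *: gproj z a + gproj z b.
Proof.
case: z => d /=; last by rewrite scaler0 addr0.
by rewrite coord_linear wpart_linear linearP.
Qed.

Lemma gproj0 z : gproj z 0 = 0.
Proof. by have := gproj_linear z (-1) 0 0; rewrite scaleN1r oppr0 addr0 scaleN1r addNr. Qed.

Lemma gprojD z a b : gproj z (a + b) = gproj z a + gproj z b.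
Proof. by have := gproj_linear z 1 a b; rewrite !scale1r. Qed.

Lemma gproj_sum z (I : Type) (s : seq I) (Q : pred I) (f : I -> A) :
  gproj z (\sum_(i <- s | Q i) f i) = \sum_(i <- s | Q i) gproj z (f i).
Proof.
elim: s => [|i s IH]; first by rewrite !big_nil gproj0.
by rewrite !big_cons; case: (Q i); rewrite ?gprojD IH.
Qed.

Lemma gproj_grad z a : gradZ z (gproj z a).
Proof.
case: z => d //=; apply: evalA_grad => m; rewrite mcoeff_msupp mcoeff_wpart.
by case: (dg m =P d) => //; rewrite eqxx.
Qed.

Lemma gproj_decomposition a : exists N0, forall N, (N0 <= N)%N ->
  a = \sum_(d < N) gproj (Posz d) a.
Proof.
pose N0 := \max_(m <- msupp (Defs.coord D a)) (dg m).+1.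
exists N0 => N N0N; rewrite -{1}(evalA_coord a) /= -linear_sum /=; congr (evalA _).
apply/mpolyP => m; rewrite raddf_sum /=.
under eq_bigr do rewrite mcoeff_wpart.
case: (boolP (m \in msupp (Defs.coord D a))) => [mc|/memN_msupp_eq0 ->]; last first.
  by rewrite big1 // => i _; rewrite if_same.
have mN : (dg m < N)%N.
  apply: leq_trans N0N; rewrite /N0 (big_rem m mc) /=.
  exact: leq_maxl.
rewrite (bigD1 (Ordinal mN)) //= eqxx big1 ?addr0 // => i.
by rewrite -val_eqE /= eq_sym => /negPf ->.
Qed.

Lemma gproj_homogeneous z a z' : gradZ z a -> gproj z' a = if z' == z then a else 0.
Proof.
case: z' => d; last first.
  by case: eqP => // <- /= ->.
case: z => j; last by move=> a0; rewrite (a0 : a = 0) gproj0.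
move=> aj; have [N0 aN] := gproj_decomposition a.
have [_ _ _ _ uniq] := A_graded.
(* The difference of two homogeneous decompositions of [a]: the computed one and the one with [a]
   alone in degree j. *)
pose u (i : nat) := gproj (Posz i) a - (if i == j then a else 0).
have ug i : u i \in gradA D i.
  apply: (@gradZB (Posz i)); first exact: gproj_grad.
  by case: eqP => [->|_] //; apply: gradZ0.
pose N := maxn N0 (maxn j.+1 d.+1).
have /uniq : forall i, u i \in gradA D i by [].
move=> /(_ N); rewrite /u sumrB -aN ?leq_maxl // -big_mkcond /=.
have jN : (j < N)%N by rewrite /N !leq_max leqnn !orbT.
rewrite (big_pred1 (Ordinal jN)) => [|i]; last by [].
rewrite subrr => /(_ erefl d); rewrite /N !leq_max leqnn !orbT => /(_ isT) /eqP.
by rewrite subr_eq0 => /eqP.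
Qed.

Lemma acoef_grad j a m : a \in gradA D j -> acoef a m != 0 -> dg m = j.
Proof.
move=> aj; apply: contraTeq => mj; rewrite negbK; apply/eqP.
have := @gproj_homogeneous (Posz j) a (Posz (dg m)) aj; rewrite eqz_nat (negPf mj) /=.
move/(evalA_standard_inj (wpart_standard _ _ (coord_standard a)))/(congr1 (mcoeff m)).
by rewrite mcoeff_wpart eqxx mcoeff0.
Qed.

(** In a decomposition of [a], only the component of degree [z - e] can reach degree z after
    multiplication by b. *)
Lemma gprojM z e a b : gradZ e b -> gproj z (a * b) = gproj (z - e) a * b.
Proof.
move=> be; have [N0 aN] := gproj_decomposition a.
pose N := maxn N0 `|z - e|.+1.
rewrite {1}(aN N) ?leq_maxl // mulr_suml gproj_sum.
under eq_bigr => i _.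
  rewrite (gproj_homogeneous (z := Posz i + e)); last first.
    by apply: gradZM be => //; apply: gproj_grad.
  over.
case E : (z - e) => [d|d]; last first.
  rewrite [gproj _ _]/= mul0r big1 // => i _; case: eqP => // ze.
  by move: E; rewrite ze addrK.
have dN : (d < N)%N by rewrite /N E leq_max ltnSn orbT.
rewrite (bigD1 (Ordinal dN)) //= -E subrK eqxx big1 ?addr0 // => i.
case: (z =P _) => // ze; rewrite ze addrK in E.
by move: E => [E]; rewrite -val_eqE /= E eqxx.
Qed.

Lemma coef_homogeneous r (delta : 'I_r -> int) d (x : 'rV[A]_r) v :
  homogeneous D delta d x -> coef x v != 0 -> d = delta v.2 + (dg v.1)%:Z.
Proof.
move=> xd; rewrite mcoefE => xv; have := xd v.2; case E: (d - delta v.2) => [j|j].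
  by move/acoef_grad => /(_ _ xv) ->; rewrite -E addrC subrK.
move=> x0; case/eqP: xv; rewrite x0.
by have := mcoef0 v; rewrite mcoefE mxE.
Qed.

Lemma homogeneous_linear r (delta : 'I_r -> int) d c (x y : 'rV[A]_r) :
  homogeneous D delta d x -> homogeneous D delta d y ->
  homogeneous D delta d (c%:A *: x + y).
Proof.
move=> xd yd; apply/homogeneousE => i.
by rewrite !mxE mulr_algl; apply: gradZ_linear; [apply: xd | apply: yd].
Qed.

Lemma homogeneous0 r (delta : 'I_r -> int) d : homogeneous D delta d 0.
Proof. by apply/homogeneousE => i; rewrite mxE; apply: gradZ0. Qed.

Lemma homogeneousD r (delta : 'I_r -> int) d (x y : 'rV[A]_r) :
  homogeneous D delta d x -> homogeneous D delta d y -> homogeneous D delta d (x + y).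
Proof. by move=> xd yd; have := homogeneous_linear 1 xd yd; rewrite !scale1r. Qed.

Lemma homogeneousZ r (delta : 'I_r -> int) d e z a (x : 'rV[A]_r) :
  z = d + e -> gradZ d a -> homogeneous D delta e x -> homogeneous D delta z (a *: x).
Proof.
move=> -> ad xe; apply/homogeneousE => i; rewrite mxE.
by apply: (gradZM _ ad (xe i)); rewrite addrA.
Qed.

Lemma homogeneousB r (delta : 'I_r -> int) d (x y : 'rV[A]_r) :
  homogeneous D delta d x -> homogeneous D delta d y -> homogeneous D delta d (x - y).
Proof.
move=> xd yd; rewrite addrC; have := homogeneous_linear (-1) yd xd.
by rewrite !scaleN1r.
Qed.

Lemma homogeneous_mulmx s r (delta : 'I_r -> int) (eps : 'I_s -> int) d
    (a : 'rV[A]_s) (H : 'M[A]_(s, r)) :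
  homogeneous D eps d a -> (forall l, homogeneous D delta (eps l) (row l H)) ->
  homogeneous D delta d (a *m H).
Proof.
move=> ad He; rewrite mulmx_sum_row; elim/big_ind: _ => [||l _].
- exact: homogeneous0.
- exact: homogeneousD.
- by apply: homogeneousZ (ad l) (He l); rewrite subrK.
Qed.

Lemma homogeneous_delta r (delta : 'I_r -> int) d a i :
  gradZ (d - delta i) a -> homogeneous D delta d (a *: delta_mx 0 i).
Proof.
move=> ad; apply/homogeneousE => j; rewrite !mxE eqxx /=.
by case: (j =P i) => [->|_]; rewrite ?mulr1 // mulr0; apply: gradZ0.
Qed.

(** Otherwise every monomial would be nonstandard, so the unit of [A] would have no coordinates and
    vanish. *)
Lemma standard0 : std 0%MM.
Proof.
apply/negP => /hasP [g gG g0].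
case/eqP: (oner_neq0 A); rewrite -(evalA_coord 1) (_ : Defs.coord D 1 = 0).
  by rewrite /evalA msupp0 big_nil.
apply/eqP; rewrite -msupp_eq0; have := coord_standard 1.
case: (msupp _) => // m s /= /andP [/negP []]; apply/hasP; exists g => //.
by apply: lepm_trans g0 _; apply/mnm_lepP => i; rewrite mnm0E.
Qed.

Lemma cst_linear c a b : cst D (c *: a + b) = c * cst D a + cst D b.
Proof. exact: acoefP. Qed.

Lemma cst_algebra c : cst D c%:A = c.
Proof.
have e : c%:A = evalA (c *: 'X_[0%MM] : P) :> A.
  rewrite linearZ /= evalAX /monA big1 // => i _.
  by rewrite mnm0E expr0.
rewrite /cst e coord_evalA; first by rewrite mcoeffZ mcoeffX_if eqxx mulr1.
by apply/allP => m /msuppZ_le; rewrite msuppX inE => /eqP ->; apply: standard0.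
Qed.

Lemma grad0_cst a : a \in gradA D 0 -> a = (cst D a)%:A.
Proof. by have [_ _ H _ _] := A_graded => /H [c ->]; rewrite cst_algebra. Qed.

Lemma gproj0_cst a : gproj 0 a = (cst D a)%:A.
Proof.
rewrite [LHS]grad0_cst; last exact: (gproj_grad 0).
rewrite /= {1}/cst coord_evalA ?mcoeff_wpart ?wdeg0 //.
exact: wpart_standard (coord_standard a).
Qed.

(** The grading starts in degree 0, so the degree 0 part of a product comes from the degree 0 parts
    alone. *)
Lemma cstM a b : cst D (a * b) = cst D a * cst D b.
Proof.
have [N0 bN] := gproj_decomposition b.
have : gproj 0 (a * b) = gproj 0 a * gproj 0 b.
  rewrite {1}(bN N0.+1) ?leqW // mulr_sumr gproj_sum big_ord_recl big1 ?addr0 => [|i _].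
    by rewrite (gprojM _ _ (gproj_grad _ _)) subr0.
  by rewrite (gprojM _ _ (gproj_grad _ _)) sub0r /= mul0r.
rewrite !gproj0_cst => /(congr1 (cst D)).
by rewrite mulr_algl !cst_algebra scalerA cst_algebra.
Qed.

(** * Reduction and Schreyer's theorem *)

Local Notation vord := (@vle k A D _).

Lemma vle_monomial r : monomial_order (@vle k A D r).
Proof. exact: vle_order. Qed.

Section Reduction.
Variable r : nat.
Local Notation mon := ('X_{1..n} * 'I_r)%type.
Implicit Types (u v w : mon) (x y h : 'rV[A]_r) (H : seq 'rV[A]_r).
Let vtotal := ord_total (vle_monomial r).
Let vtrans := ord_trans (vle_monomial r).

Lemma LMBP x :
  match LMB D x with
  | Some u => [/\ x != 0, coef x u != 0, std u.1 & lead vord x u (coef x u)]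
  | None => x = 0
  end.
Proof.
have := ohead_sortP vtotal vtrans (supp x); rewrite /LMB /sorted_supp -/(supp x).
case: (ohead _) => [u|s0].
  rewrite mem_supp => -[ux H]; split=> //.
  - by apply: contraNneq ux => ->; rewrite mcoef0.
  - exact: coef_standard ux.
  - apply: leadP => [|v vx]; first exact: coef_standard ux.
    by apply: H; rewrite mem_supp.
by apply: coef_eq0 => v; apply/eqP/negPn; rewrite -mem_supp s0.
Qed.

Lemma LMB_neq0 x : x != 0 -> exists u, LMB D x = Some u.
Proof. by have := LMBP x; case: (LMB D x) => [u|->]; [exists u | rewrite eqxx]. Qed.

Lemma vdegE (delta : 'I_r -> int) d x :
  x != 0 -> homogeneous D delta d x -> vdeg D delta x = d.
Proof.
have := LMBP x; rewrite /vdeg; case: (LMB D x) => [[m i] [_ xu _ _] _ xd|->].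
  by rewrite (coef_homogeneous xd xu).
by rewrite eqxx.
Qed.

Lemma LMB_dividesP h v : LMB_divides h v ->
  exists u, LMB D h = Some u /\ v = shift (v.1 - u.1)%MM u.
Proof.
rewrite /LMB_divides; case: (LMB D h) => [[m i]|] // /andP [/eqP iv mv].
by exists (m, i); split=> //; rewrite /shift /= submK // iv -surjective_pairing.
Qed.

Lemma redexP H x :
  match redex D H x with
  | Some (u, l) => [/\ coef x u != 0, LMB_divides (nth 0 H l) u
      & forall v (l' : 'I_(size H)), coef x v != 0 -> LMB_divides (nth 0 H l') v -> vord v u]
  | None => forall v (l : 'I_(size H)), coef x v != 0 -> ~~ LMB_divides (nth 0 H l) v
  end.
Proof.
pose g u := omap (pair u)
  (ohead [seq l : 'I_(size H) <- enum 'I_(size H) | LMB_divides (nth 0 H l) u]).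
have gP u : match g u with
  | Some (u', l) => u' = u /\ LMB_divides (nth 0 H l) u
  | None => forall l : 'I_(size H), ~~ LMB_divides (nth 0 H l) u
  end.
  rewrite /g; case E: [seq l <- _ | _] => [|l s] /=; last first.
    by have : l \in l :: s := mem_head l s; rewrite -E mem_filter => /andP [].
  move=> l; apply/negP => lu.
  by have : l \in [::] by rewrite -E mem_filter lu mem_enum.
have := ohead_pmap_sortP vtotal vtrans g (supp x).
rewrite /redex /sorted_supp -/(supp x) -/g; case: (ohead _) => [[u l]|none].
  move=> [u' [u'x gu' max]]; have := gP u'; rewrite gu' => -[e lu].
  rewrite e -mem_supp; split=> // v l' vx l'v; apply: max; first by rewrite mem_supp.
  by have := gP v; case: (g v) => // /(_ l'); rewrite l'v.
move=> v l; rewrite -mem_supp => /none gv; by have := gP v; rewrite gv.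
Qed.

Lemma redmultP x h u v : LMB D h = Some v -> u = shift (u.1 - v.1)%MM v ->
  redmult x h u = (coef x u / coef h v) *: tmon (u.1 - v.1)%MM.
Proof. by rewrite /redmult /LTB => -> /= _; case: v. Qed.

Lemma lead_redmult x h u : LMB_divides h u -> lead vord (redmult x h u *: h) u (coef x u).
Proof.
move=> /LMB_dividesP [v [hv uv]]; rewrite (redmultP _ hv uv).
have := LMBP h; rewrite hv => -[_ v0 _ hl].
have := lead_tmon (vle_monomial r) (q := (u.1 - v.1)%MM) hl.
move=> /(leadZ (d := coef x u / coef h v)); rewrite divfK // -uv.
by rewrite (alg_scale _ (tmon _)).
Qed.

(* The term [m e_l] of a coefficient vector [a] contributes to [a *m H] with
   leading symbol [m + LM(h_l)]. *)
Definition represented (S : mon -> Prop) H (a : 'rV[A]_(size H)) : Prop :=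
  forall m l u, coef a (m, l) != 0 -> LMB D (nth 0 H l) = Some u -> S (shift m u).

(** The clause on [S] is the standard representation property: quantifying over all down-closed sets
    covers both bounds of the form at most u and strictly below u, whether or not u occurs in x. *)
Definition reduction H x y (a : 'rV[A]_(size H)) : Prop :=
  [/\ eventually (fun b => red D b H x) (y, a),
      x = a *m rowsmx (size H) H + y,
      forall v (l : 'I_(size H)), coef y v != 0 -> ~~ LMB_divides (nth 0 H l) v,
      forall S : mon -> Prop, (forall u v, S v -> vord u v -> S u) ->
        supported S x -> represented S a
    & forall delta d, (forall h, h \in H -> exists e, homogeneous D delta e h) ->
        homogeneous D delta d x ->
        homogeneous D (fun l => vdeg D delta (nth 0 H l)) d a].

(** The induction is on the symbol of the redex, not on the leading symbol, since irreducible
    leading terms stay. A step cancels u and otherwise creates only symbols below u, while old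
    redexes are at most u; so the next redex is strictly smaller. *)
Lemma red_spec H x : exists y (a : 'rV[A]_(size H)), reduction x y a.
Proof.
have base x' : redex D H x' = None -> exists y (a : 'rV[A]_(size H)), reduction x' y a.
  move=> none; exists x', 0; split.
  - by exists 0%N => -[|b] _ /=; rewrite none.
  - by rewrite mul0mx add0r.
  - by have := redexP H x'; rewrite none.
  - by move=> S _ _ m l u; rewrite mcoef0 eqxx.
  - by move=> *; apply: homogeneous0.
case E: (redex D H x) => [[u l]|]; last exact: base.
elim/(well_founded_ind (slt_wf (vle_monomial r))): u x l E => u IH x l E.
have := redexP H x; rewrite E => -[ux lu max].
set h := nth 0 H l in lu *; set t := redmult x h u.
have th : lead vord (t *: h) u (coef x u) by apply: lead_redmult.
have us : std u.1 := coef_standard ux.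
have x'P v : coef (x - t *: h) v != 0 -> coef x v != 0 \/ slt vord v u.
  case: (eqVneq (coef x v) 0) => [xv|]; last by left.
  rewrite mcoefB xv sub0r oppr_eq0 => tv; right; rewrite /slt.
  have vu : v != u by apply: contraNneq ux => <-; rewrite xv.
  rewrite vu andbT.
  case: (eqVneq (coef (t *: h - (coef x u)%:A *: basis_vec u) v) 0) => [|/th /sltW //].
  rewrite mcoefB => /eqP; rewrite subr_eq0 => /eqP e; move: tv; rewrite e.
  by rewrite mcoefZ mulf_eq0 negb_or => /andP [_] /(basis_vec_le (vle_monomial r)).
have [y [a [ev xE irr Sa hom]]] : exists y (a : 'rV[A]_(size H)), reduction (x - t *: h) y a.
  case E': (redex D H (x - t *: h)) => [[u' l']|]; last exact: base.
  apply: IH (E'); have := redexP H (x - t *: h); rewrite E' => -[u'x l'u' _].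
  rewrite (coef_standard u'x) us /=; case: (x'P _ u'x) => // xu'.
  rewrite /slt (max _ _ xu' l'u') /=; apply: contraNneq u'x => ->.
  by rewrite mcoefB (lead_coef_eq us th) subrr.
have hE : row l (rowsmx (size H) H) = h by apply/rowP => i; rewrite !mxE.
have [w [hw uw]] := LMB_dividesP lu.
have tE : t = _ := redmultP x hw uw.
exists y, (a + t *: delta_mx 0 l); split=> //.
- have [B evB] := ev; exists B.+1 => -[//|b] Bb /=; rewrite E -/h -/t evB //.
- by rewrite mulmxDl -scalemxAl -rowE hE addrAC -xE subrK.
- move=> S Sdown Sx m l' v; rewrite mcoefD => al' hv.
  case: (eqVneq (coef a (m, l')) 0) => [a0|al].
    move: al'; rewrite a0 add0r coef_delta /=; case: (l' =P l) => [e|]; rewrite ?eqxx //.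
    move: hv; rewrite e -/h hw => -[<-]; rewrite tE acoefZ mulf_eq0 negb_or => /andP [_].
    move=> /acoef_tmon_le mle_m; apply: Sdown (Sx u ux) _.
    rewrite uw /shift; have [_ _ _ -> _] := vle_monomial r.
    have [_ H' _ _] := mle_order; by rewrite -H'.
  apply: (Sa S Sdown _ _ _ _ al hv) => v' /x'P [/Sx //|v'u].
  by apply: Sdown (Sx u ux) (sltW v'u).
- move=> delta d Hd xd.
  have lH : h \in H by apply: mem_nth.
  have [e he] := Hd h lH.
  have h0 : h != 0 by have := LMBP h; rewrite hw => -[].
  have td : gradZ (d - e) t.
    rewrite tE; apply: gradZZ; have -> : d - e = (dg (u.1 - w.1)%MM)%:Z.
      have := LMBP h; rewrite hw => -[_ hw0 _ _].
      have dgu : dg u.1 = (dg (u.1 - w.1)%MM + dg w.1)%N by rewrite {1}uw wdegD.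
      have u2 : u.2 = w.2 by rewrite uw.
      by rewrite (coef_homogeneous xd ux) (coef_homogeneous he hw0) u2 dgu; lia.
    exact: tmon_grad.
  apply: homogeneousD.
    apply: hom => //; apply: homogeneousB xd _.
    by apply: homogeneousZ td he; rewrite subrK.
  by apply: homogeneous_delta; rewrite -/h (vdegE h0 he).
Qed.

End Reduction.

(* Schreyer's ordering: a symbol [m e_l] is compared through the leading symbol
   [m + LM(h_l)] of [m h_l], ties being broken in favour of the smaller index. *)
Section Schreyer.
Variables (r s : nat) (H : 'M[A]_(s, r)).
Variables (lm : 'I_s -> 'X_{1..n} * 'I_r) (lc : 'I_s -> k).
Hypothesis lc_neq0 : forall l, lc l != 0.
Hypothesis lead_H : forall l, lead vord (row l H) (lm l) (lc l).
Implicit Types (u v w : 'X_{1..n} * 'I_s).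

Definition symbol v := shift v.1 (lm v.2).

Definition schreyer_order : rel ('X_{1..n} * 'I_s) :=
  fun u v => if symbol u == symbol v then (v.2 <= u.2)%N else vord (symbol u) (symbol v).

Let vmon := vle_monomial r.

Lemma symbol_shift q v : symbol (shift q v) = shift q (symbol v).
Proof. by rewrite /symbol shiftD. Qed.

Lemma symbol_inj m1 m2 l : symbol (m1, l) = symbol (m2, l) -> m1 = m2.
Proof. by move=> /(congr1 (fun v : 'X_{1..n} * 'I_r => (v.1 - (lm l).1)%MM)); rewrite /= !addmK. Qed.

Lemma shift_inj (t : nat) q : injective (shift (r := t) q).
Proof.
move=> [m1 i] [m2 j] e; have /= -> := congr1 snd e.
by have := congr1 (fun v : 'X_{1..n} * 'I_t => (v.1 - q)%MM) e; rewrite /= ![(q + _)%MM]addmC !addmK => ->.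
Qed.

Lemma schreyer_monomial : monomial_order schreyer_order.
Proof.
have vtr := ord_trans vmon; have van := ord_anti vmon.
split=> [u v|v u w|u v|i m1 m2|i j m1 m2 q]; rewrite /schreyer_order.
- rewrite [symbol v == _]eq_sym; case: eqP => _; first exact: leq_total.
  exact: ord_total vmon _ _.
- case: eqP => [->|uv]; case: eqP => [vw|vw] //; first by move=> vu wv; apply: leq_trans wv vu.
    by rewrite -vw; case: eqP.
  move=> uv' vw'; case: eqP => [uw|_]; last exact: vtr uv' vw'.
  by case: uv; apply: van; rewrite uv' uw vw'.
- rewrite [symbol v == _]eq_sym; case: eqP => [e|ne] /andP [uv vu].
    have l : u.2 = v.2 by apply/val_inj/eqP; rewrite eqn_leq uv vu.
    rewrite [u]surjective_pairing [v]surjective_pairing l; congr (_, _).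
    by apply: (@symbol_inj _ _ v.2); rewrite -{1}l -!surjective_pairing.
  by case: ne; apply: van; rewrite uv vu.
- case: eqP => [/symbol_inj -> | _]; first by rewrite leqnn mle_refl.
  have [_ _ _ E _] := vmon; have [_ E' _ _] := mle_order.
  by rewrite /symbol /shift /= E -E'.
- have e m l : symbol ((m + q)%MM, l) = shift q (symbol (m, l)).
    by rewrite -symbol_shift /shift addmC.
  by rewrite !e (inj_eq (@shift_inj _ q)) (ord_shift vmon).
Qed.

Lemma symbol_le u v : schreyer_order u v -> vord (symbol u) (symbol v).
Proof. by rewrite /schreyer_order; case: eqP => // -> _; apply: ord_refl vmon _. Qed.

(** The two conditions on v push all other terms of [a] strictly below [symbol u]; standardness of
    that symbol allows its coefficient to be read off. *)
Lemma lead_mulmx a u : std (symbol u).1 -> coef a u != 0 ->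
  (forall v, coef a v != 0 -> schreyer_order v u) ->
  (forall v, coef a v != 0 -> symbol v = symbol u -> v = u) ->
  coef (a *m H) (symbol u) = coef a u * lc u.2.
Proof.
move=> us au max uniq; have us1 := coef_standard au.
have eH l : row l H = delta_mx 0 l *m H by rewrite -rowE.
pose a' := a - (coef a u)%:A *: basis_vec u.
have -> : a *m H = a' *m H + (coef a u)%:A *: (tmon u.1 *: row u.2 H).
  by rewrite eH !scalemxAl -mulmxDl subrK.
have a'v v : coef a' v != 0 -> slt schreyer_order v u /\ coef a v = coef a' v.
  move=> a'v; have vu := @leadP s schreyer_order a u us1 max v a'v; split=> //.
  rewrite /a' mcoefB mcoefZ (_ : coef (basis_vec u) v = 0) ?mulr0 ?subr0 //.
  rewrite coef_delta acoef_tmon_standard //; case: (v.2 =P _) => // e.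
  case: (u.1 =P _) => // e'; move: vu; rewrite /slt.
  by rewrite (surjective_pairing v) (surjective_pairing u) e e' eqxx andbF.
have below_a' : below vord (a' *m H) (symbol u).
  apply: supported_mulmx => v /[dup] /a'v [vu av] a'v0; apply: supportedZ.
  have vlt : slt vord (symbol v) (symbol u).
    rewrite /slt symbol_le ?(sltW vu) //=.
    apply/eqP => /uniq e; move: vu; rewrite e ?sltxx //.
    by rewrite av.
  rewrite -[tmon _ *: _](subrK ((lc v.2)%:A *: basis_vec (symbol v))).
  apply: supportedD.
    have := lead_tmon vmon (q := v.1) (lead_H (l := v.2)); rewrite -/(symbol v) => Hv w wv.
    exact: (slt_trans vmon) (Hv w wv) vlt.
  apply: supportedZ => w /(basis_vec_le vmon) wv.
  exact: (le_slt_trans vmon) wv vlt.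
have H1 := leadZ (d := coef a u) (lead_tmon vmon (q := u.1) (lead_H (l := u.2))).
rewrite -/(symbol u) in H1.
by have := leadD (proj1 (below_lead _ _ _) below_a') H1; rewrite add0r => /(lead_coef_eq us).
Qed.

Section Reduction.
(** [Sigma] is kept abstract and need not consist of syzygies. [Sigma_nonstandard] is what multiples
    of the sigma_{i,g} provide, [Sigma_pair] what multiples of the sigma_{i,j} provide. *)
Variable Sigma : 'rV[A]_s -> Prop.
Hypothesis Sigma0 : Sigma 0.
Hypothesis SigmaD : forall a x y, Sigma x -> Sigma y -> Sigma (x + a *: y).
Hypothesis Sigma_nonstandard : forall m l, std m -> ~~ std (m + (lm l).1)%MM ->
  exists sg, Sigma sg /\ lead schreyer_order sg (m, l) 1.
Hypothesis Sigma_pair : forall m m' (l l' : 'I_s), (l < l')%N ->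
  symbol (m, l) = symbol (m', l') ->
  exists (c : k) sg, [/\ c != 0, Sigma sg & lead schreyer_order sg (m, l) c].

Theorem schreyer (a : 'rV[A]_s) : exists sg, Sigma sg /\
  (a - sg = 0 \/ exists (p : 'X_{1..n} * 'I_r) l,
    [/\ coef ((a - sg) *m H) p != 0, (lm l).2 = p.2 & ((lm l).1 <= p.1)%MM]).
Proof.
case: (eqVneq a 0) => [->|a0]; first by exists 0; split=> //; left; rewrite subr0.
have [u [au max]] := coef_max schreyer_monomial a0.
elim/(well_founded_ind (slt_wf schreyer_monomial)): u a au max {a0} => u IH a au max.
have us := coef_standard au.
have step (c : k) sg : c != 0 -> Sigma sg -> lead schreyer_order sg u c ->
    exists sg, Sigma sg /\ (a - sg = 0 \/ exists (p : 'X_{1..n} * 'I_r) l,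
      [/\ coef ((a - sg) *m H) p != 0, (lm l).2 = p.2 & ((lm l).1 <= p.1)%MM]).
  move=> c0 sgS sgu; pose b : A := (coef a u / c)%:A.
  have blw : below schreyer_order (a - b *: sg) u.
    have := leadB (leadP us max) (leadZ (d := coef a u / c) sgu).
    rewrite divfK // subrr => H1; exact: (proj2 (below_lead _ _ _) H1).
  case: (eqVneq (a - b *: sg) 0) => [a'0|a'0].
    exists (b *: sg); split; last by left.
    by rewrite -[b *: sg]add0r; apply: SigmaD.
  have [v [a'v max']] := coef_max schreyer_monomial a'0.
  have vu : [&& std v.1, std u.1 & slt schreyer_order v u].
    by rewrite (coef_standard a'v) us; apply: blw.
  have [sg' [sg'S concl]] := IH v vu _ a'v max'.
  exists (sg' + b *: sg); split; first exact: SigmaD.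
  by rewrite opprD addrA addrAC.
case: (boolP (std (symbol u).1)) => [symstd|]; last first.
  case: u {IH max step} au us step => m l au us step /(Sigma_nonstandard us) [sg [sgS sgu]].
  by apply: (step 1 sg) => //; apply: oner_neq0.
case: (classic (exists v, [/\ coef a v != 0, symbol v = symbol u & v <> u])) => [[v [av e vu]]|nov].
  (* Among equal symbols the smaller index is the larger one in Schreyer's order, so the maximal
     term u plays the first role in [Sigma_pair]. *)
  have ltl : (u.2 < v.2)%N.
    have := max v av; rewrite /schreyer_order e eqxx leq_eqVlt => /predU1P [uv|//].
    case: vu; move: e; rewrite (surjective_pairing v) (surjective_pairing u).
    by rewrite (val_inj uv : u.2 = v.2) => /symbol_inj ->.
  move: e; rewrite (surjective_pairing v) {1}(surjective_pairing u) => /esym e.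
  have [c [sg [c0 sgS sgu]]] := Sigma_pair ltl e.
  by apply: (step c sg) => //; rewrite [u]surjective_pairing.
exists 0; split=> //; right; exists (symbol u), u.2; rewrite subr0; split=> //; last exact: lem_addl.
rewrite lead_mulmx ?mulf_neq0 // => v av e; apply: NNPP => vu.
by apply: nov; exists v.
Qed.

End Reduction.
End Schreyer.

(** * Buchberger's criterion: the computed syzygies suffice for division *)

Section GroebnerCriterion.
Variable r : nat.
Local Notation mon := ('X_{1..n} * 'I_r)%type.
Implicit Types (u v w : mon) (h : 'rV[A]_r) (H : seq 'rV[A]_r).
Let vmon := vle_monomial r.

Lemma LMB_max h u : LMB D h = Some u -> forall v, coef h v != 0 -> vord v u.
Proof.
move=> hu v; have := ohead_sortP (ord_total vmon) (ord_trans vmon) (supp h).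
move: hu; rewrite /LMB /sorted_supp -/(supp h) => -> [_ max].
by rewrite -mem_supp; apply: max.
Qed.

Lemma ordp_filt h i : h 0 i \in F (ordp D h).
Proof.
have [F0 _ _ _ _] := A_filtered; move: i; rewrite /ordp.
elim/big_ind: _ => [i|p q hp hq i|p /forallP //]; first exact: F0.
by rewrite /maxn; case: ifP.
Qed.

Lemma grc_pr h i : grc D (pr D h 0 i) = wpart (xwgt D) (ordp D h) (Defs.coord D (h 0 i)).
Proof.
have hF := ordp_filt h i; rewrite /pr mxE.
have [_] := @homclass_evalA (ordp D h) (Defs.coord D (h 0 i)) (fun m => coord_filt hF).
rewrite evalA_coord => ->; apply: grc_phi; apply: wpart_standard.
exact: coord_standard.
Qed.

(* The order being degree-reversed, [LT_gr(pr(h))] agrees with the leading term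
   of [h] as soon as both have the same component. *)
Lemma LTdivE h u : LMB D h = Some u -> LTdiv D h = Some (coef h u, u).
Proof.
move=> hu; rewrite /LTdiv /LTB hu /= /LTgr.
set c := fun i => grc D (pr D h 0 i).
have cE v : (c v.2)@_v.1 = if wt v.1 == ordp D h then coef h v else 0.
  by rewrite /c grc_pr mcoeff_wpart.
have := ohead_sortP (ord_total vmon) (ord_trans vmon)
  [seq (m, i) | i <- enum 'I_r, m <- msupp (c i)].
rewrite /sorted_supp; case: (ohead _) => [v|] //= [vc max].
case: eqP => // vu.
have memc w : (w \in [seq (m, i) | i <- enum 'I_r, m <- msupp (c i)]) = ((c w.2)@_w.1 != 0).
  apply/allpairsPdep/idP => [[i [m [_ mx ->]]]|wx]; first by rewrite -mcoeff_msupp.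
  by exists w.2, w.1; rewrite mem_enum mcoeff_msupp -surjective_pairing.
move: vc; rewrite memc cE; case: (wt v.1 =P _) => [wv hv|]; last by rewrite eqxx.
have hu0 : coef h u != 0 by have := LMBP h; rewrite hu => -[].
have vleu := LMB_max hu hv.
have wu : wt u.1 = ordp D h.
  apply/eqP; rewrite eqn_leq.
  have -> : (ordp D h <= wt u.1)%N.
    by apply: coord_filt (ordp_filt h u.2) _; rewrite mcoeff_msupp.
  rewrite andbT leqNgt -wv; apply/negP => /wt_mlt uv1.
  have : slt vord u v.
    by rewrite (surjective_pairing u) (surjective_pairing v) vu (slt_component vmon).
  by rewrite (sltNle vmon) vleu.
suff -> : v = u by have := cE u; rewrite wu eqxx => <-.
apply: (ord_anti vmon); rewrite vleu /=; apply: max.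
by rewrite memc cE wu eqxx.
Qed.

Definition closed_under (H : seq 'rV[A]_r) (S : 'rV[A]_(size H) -> Prop) : Prop :=
  forall e, e \in syz_pairs D H -> exists a,
    eventually (fun b => red D b H (e *m rowsmx (size H) H)) (0, a) /\ S (e - a).

Lemma row_rowsmx H l : row l (rowsmx (size H) H) = nth 0 H l.
Proof. by apply/rowP => i; rewrite !mxE. Qed.

Lemma lead_basis_vec s (ord : rel ('X_{1..n} * 'I_s)) (v : 'X_{1..n} * 'I_s) c :
  lead ord (c%:A *: basis_vec v) v c.
Proof. by rewrite /lead subrr; apply: supported0. Qed.

Lemma quotLTE h u L : LMB D h = Some u ->
  quotLT L h = (coef h u)^-1 *: tmon (L - u.1)%MM.
Proof. by move=> hu; rewrite /quotLT (LTdivE hu); case: u {hu} => m i; rewrite tildeZ. Qed.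

(** Finitely many critical combinations suffice because the syzygies required by [schreyer] are
    monomial multiples of those computed at the lcm. *)
Lemma closed_under_schreyer H (S : 'rV[A]_(size H) -> Prop) :
  (forall h, h \in H -> h != 0) -> S 0 ->
  (forall a x y, S x -> S y -> S (x + a *: y)) -> closed_under S ->
  forall a, exists sg, S sg /\ (a - sg = 0 \/
    exists u (l : 'I_(size H)), coef ((a - sg) *m rowsmx (size H) H) u != 0 /\
      LMB_divides (nth 0 H l) u).
Proof.
move=> Hn0 S0 SD Hcl a.
have /fin_all_exists [lm lmP] : forall l : 'I_(size H), exists u, LMB D (nth 0 H l) = Some u.
  by move=> l; apply: LMB_neq0; apply: Hn0; apply: mem_nth.
pose lc (l : 'I_(size H)) := coef (nth 0 H l) (lm l).
have hP l : lc l != 0 /\ lead vord (row l (rowsmx (size H) H)) (lm l) (lc l).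
  by rewrite row_rowsmx; have := LMBP (nth 0 H l); rewrite lmP => -[].
pose sord := schreyer_order lm.
have smon : monomial_order sord := schreyer_monomial lm.
(* By the standard representation property the quotients [a0] lie strictly below v, so [e - a0]
   keeps the leading term of [e]. *)
have below_quot e a0 (v : 'X_{1..n} * 'I_(size H)) :
    eventually (fun b => red D b H (e *m rowsmx (size H) H)) (0, a0) ->
    below vord (e *m rowsmx (size H) H) (symbol lm v) -> below sord a0 v.
  move=> ev ebelow; have [y [a' [ev' _ _ rep _]]] := red_spec H (e *m rowsmx (size H) H).
  have [_ ea] := eventually_unique ev' ev; rewrite -ea => -[m l] ml.
  have down u w : slt vord w (symbol lm v) -> vord u w -> slt vord u (symbol lm v).
    by move=> wv uw; apply: le_slt_trans wv.
  have lt := rep _ down ebelow m l _ ml (lmP l).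
  rewrite /slt /sord /schreyer_order.
  have ne : symbol lm (m, l) != symbol lm v by case/andP: lt.
  rewrite (negPf ne) (sltW lt) /=; apply: contraNneq ne => ->; exact: eqxx.
have [|||| sg [sgS concl]] := @schreyer r _ (rowsmx (size H) H) lm lc _ _ S S0 SD _ _ a.
- by move=> l; have [] := hP l.
- by move=> l; have [] := hP l.
- move=> m l ms; rewrite negbK => /hasP [g gG gm].
  (* The symbol of [(m, l)] is divisible by [LM g], hence by the lcm, so q divides m and the wanted
     element is [tmon (m - q)] times the syzygy computed for q. *)
  set q := (mlcm (lm l).1 (LM g) - (lm l).1)%MM.
  have qE : (q + (lm l).1)%MM = mlcm (lm l).1 (LM g) by rewrite /q submK // lem_mlcml.
  have qm : (q <= m)%MM.
    have : (mlcm (lm l).1 (LM g) <= m + (lm l).1)%MM.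
      by rewrite lem_mlcm gm lem_addl.
    by rewrite -qE => /mnm_lepP H'; apply/mnm_lepP => i; have := H' i; rewrite !mnmDE leq_add2r.
  pose e : 'rV[A]_(size H) := basis_vec (q, l).
  have eP : e \in syz_pairs D H.
    rewrite /syz_pairs mem_cat; apply/orP; left; apply/allpairsP; exists (l, g) => /=.
    by rewrite mem_enum gG; split=> //; rewrite /e /basis_vec /q /gmult lmP; case: (lm l).
  have [a0 [ev Sea]] := Hcl e eP.
  exists (tmon (m - q)%MM *: (e - a0)); split.
    by rewrite -[_ *: _]add0r; apply: SD.
  have -> : (m, l) = shift (m - q)%MM (q, l) by rewrite /shift /= submK.
  apply: lead_tmon => //; apply: (leadBr (ord := sord)).
    by have := @lead_basis_vec _ sord (q, l) 1; rewrite !scale1r.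
  (* The lcm is divisible by [LM g], hence nonstandard, and the lifted product has strictly smaller
     symbols only. *)
  apply: below_quot ev _; rewrite /e /basis_vec -scalemxAl -rowE.
  apply: (@lead_nonstandard _ _ vmon _ _ (lc l)).
    rewrite /symbol /shift /= qE negbK; apply/hasP; exists g => //.
    exact: lem_mlcmr.
  by apply: lead_tmon => //; have [] := hP l.
- move=> m m' l l' ll' sym_eq.
  have [sym1 sym2] : (m + (lm l).1 = m' + (lm l').1)%MM /\ (lm l).2 = (lm l').2.
    by split; [have := congr1 fst sym_eq | have := congr1 snd sym_eq].
  set L := mlcm (lm l).1 (lm l').1.
  have i_eq : (lm l).2 == (lm l').2 by rewrite sym2.
  have sLl : symbol lm ((L - (lm l).1)%MM, l) = (L, (lm l).2).
    by rewrite /symbol /shift /= submK // lem_mlcml.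
  have sLl' : symbol lm ((L - (lm l').1)%MM, l') = (L, (lm l).2).
    by rewrite /symbol /shift /= submK ?lem_mlcmr // sym2.
  have Lm : (L <= m + (lm l).1)%MM by rewrite lem_mlcm lem_addl sym1 lem_addl.
  have qm : (L - (lm l).1 <= m)%MM.
    move/mnm_lepP: Lm => Lm; apply/mnm_lepP => i; have := Lm i.
    by rewrite mnmDE mnmBE leq_subLR addnC.
  pose q h u := (coef h u)^-1 *: tmon (L - u.1)%MM.
  pose e : 'rV[A]_(size H) := q (nth 0 H l) (lm l) *: delta_mx 0 l
    - q (nth 0 H l') (lm l') *: delta_mx 0 l'.
  have eP : e \in syz_pairs D H.
    rewrite /syz_pairs mem_cat; apply/orP; right; rewrite mem_pmap; apply/mapP.
    exists (l, l').
      by rewrite mem_filter /= ll'; apply/allpairsP; exists (l, l'); rewrite !mem_enum.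
    rewrite /smults !lmP; move: (quotLTE L (lmP l)) (quotLTE L (lmP l')) i_eq.
    by rewrite /e /q => <- <-; rewrite /L; case: (lm l) (lm l') => m1 i1 [m2 i2] /= ->.
  have [a0 [ev Sea]] := Hcl e eP.
  have [l0 hl] := hP l; have [l'0 hl'] := hP l'.
  (* The multipliers divide by leading coefficients, which is why [Sigma_pair] allows any nonzero
     constant and not just 1. *)
  exists (lc l)^-1, (tmon (m - (L - (lm l).1))%MM *: (e - a0)); split.
  + by rewrite invr_eq0.
  + by rewrite -[_ *: _]add0r; apply: SD.
  have -> : (m, l) = shift (m - (L - (lm l).1))%MM ((L - (lm l).1)%MM, l).
    by rewrite /shift /= submK.
  apply: lead_tmon => //; apply: (leadBr (ord := sord)).
    rewrite /e /q !(alg_scale _ (tmon _)); apply: (leadBr (ord := sord)).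
      exact: (@lead_basis_vec _ sord (_, l)).
    (* The second summand of [e] has the same symbol but the larger index, so it is smaller in
       Schreyer's order. *)
    apply: supportedZ => w /(basis_vec_le smon (u := (_, l'))) wl'.
    apply: (le_slt_trans smon) wl' _.
    rewrite /slt /sord /schreyer_order sLl sLl' eqxx /= (ltnW ll') /=.
    by apply/eqP => -[_ ll]; rewrite ll ltnn in ll'.
  (* Both products have leading coefficient 1 at the common symbol L, so their difference lies
     strictly below it. *)
  apply: below_quot ev _; rewrite sLl /e /q !(alg_scale _ (tmon _)) mulmxBl -!scalemxAl -!rowE.
  have h1 := leadZ (d := (lc l)^-1) (lead_tmon vmon (q := (L - (lm l).1)%MM) hl).
  have h2 := leadZ (d := (lc l')^-1) (lead_tmon vmon (q := (L - (lm l').1)%MM) hl').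
  rewrite !mulVf // in h1 h2.
  move: h1 h2; rewrite -[shift _ (lm l)]/(symbol lm (_, l)) sLl.
  rewrite -[shift _ (lm l')]/(symbol lm (_, l')) sLl' => h1 h2.
  by have := leadB h1 h2; rewrite subrr => H0; apply: (proj2 (below_lead _ _ _) H0).
- exists sg; split=> //; case: concl => [->|[u [l [ul e1 e2]]]]; [by left|right].
  exists u, l; split=> //; rewrite /LMB_divides lmP; case: (lm l) e1 e2 => m i /= -> ->.
  by rewrite eqxx.
Qed.

End GroebnerCriterion.

(** * Groebner bases, syzygies and minimal generators *)

Section RowSpan.
Variables (r : nat).
Implicit Types (X : seq 'rV[A]_r).

Lemma rowspan0 X : rowspan X 0.
Proof. by exists 0; rewrite mul0mx. Qed.

Lemma rowspanD X (a : A) x y : rowspan X x -> rowspan X y -> rowspan X (x + a *: y).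
Proof.
by move=> [b ->] [c ->]; exists (b + a *: c); rewrite mulmxDl scalemxAl.
Qed.

Lemma rowspan_mem X x : x \in X -> rowspan X x.
Proof.
move=> xX; have iX : (index x X < size X)%N by rewrite index_mem.
exists (delta_mx 0 (Ordinal iX)); rewrite -rowE.
by apply/rowP => j; rewrite !mxE nth_index.
Qed.

Lemma rowspan_ind X (S : 'rV[A]_r -> Prop) : S 0 ->
  (forall (a : A) x y, S x -> S y -> S (x + a *: y)) ->
  (forall x, x \in X -> S x) -> forall v, rowspan X v -> S v.
Proof.
move=> S0 SD SX v [a ->]; rewrite mulmx_sum_row; elim/big_ind: _ => // [x y Sx Sy|i _].
  by rewrite -[y]scale1r; apply: SD.
rewrite -[_ *: _]add0r; apply: SD => //; apply: SX.
rewrite (_ : row i _ = nth 0 X i) ?mem_nth //.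
by apply/rowP => j; rewrite !mxE.
Qed.

Lemma rowspan_sub X Y : (forall x, x \in X -> rowspan Y x) ->
  forall v, rowspan X v -> rowspan Y v.
Proof. by apply: rowspan_ind; [apply: rowspan0 | apply: rowspanD]. Qed.

Lemma rowspan_subset X Y : {subset X <= Y} -> forall v, rowspan X v -> rowspan Y v.
Proof. by move=> XY; apply: rowspan_sub => x /XY; apply: rowspan_mem. Qed.

End RowSpan.

(** The termination measure of completion is the list of leading symbols found so far. An infinite
    run would contradict Dickson's lemma. *)
Lemma seq_extension_wf (r : nat) :
  well_founded (fun s' s : seq ('X_{1..n} * 'I_r) => exists u, s' = rcons s u /\
    forall v, v \in s -> ~~ ((v.2 == u.2) && (v.1 <= u.1)%MM)).
Proof.
apply: wf_no_descending_chain => f fP.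
have [u uP] := functional_choice _ fP.
have uf i j : (i < j)%N -> u i \in f j.
  elim: j => // j IHj; have [-> _] := uP j; rewrite ltnS leq_eqVlt mem_rcons inE.
  by case/predU1P => [->|/IHj ->]; rewrite ?eqxx ?orbT.
(* A component and its complement in r both serve as coordinates: monotonicity in each forces equal
   components. *)
pose g (c : 'I_n + 'I_2) i : nat := match c with
  | inl c => (u i).1 c
  | inr c => nth 0%N [:: nat_of_ord (u i).2; (r - (u i).2)%N] c
  end.
have [i [j [ij gij]]] := dickson g.
have [_ /(_ _ (uf _ _ ij)) /negP []] := uP j; apply/andP; split.
  apply/eqP/val_inj; have := gij (inr (@Ordinal 2 1 isT)).
  have := gij (inr (@Ordinal 2 0 isT)); rewrite /=.
  by have := ltn_ord (u i).2; have := ltn_ord (u j).2; lia.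
by apply/mnm_lepP => c; apply: (gij (inl c)).
Qed.

(** * Completion to a Groebner basis *)

Section Groebner.
Variable r : nat.
Implicit Types (h : 'rV[A]_r) (H X : seq 'rV[A]_r).

Lemma redP H x y a : eventually (fun b => red D b H x) (y, a) ->
  [/\ x = a *m rowsmx (size H) H + y,
      forall (v : 'X_{1..n} * 'I_r) (l : 'I_(size H)),
        coef y v != 0 -> ~~ LMB_divides (nth 0 H l) v
    & forall delta d, (forall h, h \in H -> exists e, homogeneous D delta e h) ->
        homogeneous D delta d x ->
        homogeneous D (fun l => vdeg D delta (nth 0 H l)) d a].
Proof.
move=> ev; have [y' [a' [ev' xE irr _ hom]]] := red_spec H x.
by have [<- <-] := eventually_unique ev' ev.
Qed.

(** Buchberger's criterion serves as the definition, being what the completion loop checks;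
    reduction of the whole span to 0 is then [groebner_red]. *)
Definition groebner H : Prop := (forall h, h \in H -> h != 0) /\
  forall e, e \in syz_pairs D H -> exists a,
    eventually (fun b => red D b H (e *m rowsmx (size H) H)) (0, a).

Lemma groebner_nil : groebner [::].
Proof.
split=> // e; rewrite /syz_pairs enum_ord0.
by rewrite /= in_nil.
Qed.

(** The remainder is itself a combination of H. Up to syzygies its coefficient vector either
    vanishes or produces a reducible symbol, and a remainder has none. *)
Lemma groebner_red H x : groebner H -> rowspan H x ->
  exists a, eventually (fun b => red D b H x) (0, a).
Proof.
move=> [Hn0 Hcl] [c xc]; have [y [a [ev xE irr _ _]]] := red_spec H x.
exists a; suff -> : 0 = y by [].
have yE : y = (c - a) *m rowsmx (size H) H by rewrite mulmxBl -xc xE addrC addKr.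
have [|||sg [sgS concl]] :=
  @closed_under_schreyer _ H (fun v => v *m rowsmx (size H) H = 0) Hn0 _ _ _ (c - a).
- exact: mul0mx.
- by move=> b u v uH vH; rewrite mulmxDl -scalemxAl uH vH scaler0 addr0.
- move=> e /Hcl [a' ev']; exists a'; split=> //.
  by have [e1 _ _] := redP ev'; rewrite mulmxBl {1}e1 addr0 subrr.
have yE' : y = (c - a - sg) *m rowsmx (size H) H by rewrite mulmxBl sgS subr0.
case: concl => [e|[u [l [ul lu]]]]; first by rewrite yE' e mul0mx.
by have := irr u l; rewrite yE' => /(_ ul); rewrite lu.
Qed.

(** Phrased as an induction principle for syzygies. The alternative of a surviving symbol is
    excluded because a syzygy multiplies H to 0. *)
Lemma groebner_syzygy H (S : 'rV[A]_(size H) -> Prop) : groebner H -> S 0 ->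
  (forall (a : A) x y, S x -> S y -> S (x + a *: y)) ->
  (forall e a, e \in syz_pairs D H ->
     eventually (fun b => red D b H (e *m rowsmx (size H) H)) (0, a) -> S (e - a)) ->
  forall a, a *m rowsmx (size H) H = 0 -> S a.
Proof.
move=> [Hn0 Hcl] S0 SD SH a aH.
have [||| sg [[Ssg sgH] concl]] :=
  @closed_under_schreyer _ H (fun v => S v /\ v *m rowsmx (size H) H = 0) Hn0 _ _ _ a.
- by split=> //; apply: mul0mx.
- move=> b u v [Su uH] [Sv vH]; split; first exact: SD.
  by rewrite mulmxDl -scalemxAl uH vH scaler0 addr0.
- move=> e eP; have [a' ev'] := Hcl e eP; exists a'; split=> //; split; first exact: SH.
  by have [e1 _ _] := redP ev'; rewrite mulmxBl {1}e1 addr0 subrr.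
case: concl => [/eqP|[u [l [ul _]]]]; first by rewrite subr_eq0 => /eqP ->.
by rewrite mulmxBl aH sgH subr0 mcoef0 eqxx in ul.
Qed.

Section Loop.
Variables (delta : 'I_r -> int) (X : seq 'rV[A]_r).
Local Notation t := (size X).
Local Notation tracked := ('rV[A]_r * 'rV[A]_t)%type.
Local Notation eps := (fun j : 'I_t => vdeg D delta (nth 0 X j)).
Implicit Types (c : tracked) (K cs : seq tracked).

(** The element and its row of Q share one degree, so that multiplication by Q later preserves
    degrees of syzygies. *)
Definition tracked_ok c : Prop := c.1 = c.2 *m rowsmx t X /\
  exists d, homogeneous D delta d c.1 /\ homogeneous D eps d c.2.

Lemma first_new_spec K cs : exists res, eventually (fun b => first_new D b K cs) res /\
  match res with
  | None => forall c, c \in cs -> exists a,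
      eventually (fun b => red D b (unzip1 K) c.1) (0, a)
  | Some yq => exists c a, [/\ c \in cs,
      eventually (fun b => red D b (unzip1 K) c.1) (yq.1, a), yq.1 != 0 &
      yq.2 = c.2 - a *m rowsmx (size (unzip1 K)) (unzip2 K)]
  end.
Proof.
elim: cs => [|c cs [res [ev resP]]]; first by exists None; split=> //; exists 0%N.
have [y [a [evc _ _ _ _]]] := red_spec (unzip1 K) c.1.
case: (eqVneq y 0) => [y0|y0].
  exists res; split.
    have [B1 H1] := evc; have [B2 H2] := ev; exists (maxn B1 B2) => b.
    by rewrite geq_max => /andP [b1 b2] /=; rewrite (H1 _ b1) /= y0 eqxx H2.
  case: res resP {ev} => [yq [c' [a' [c'cs evc' yn0 e]]]|resP c'].
    by exists c', a'; split; rewrite ?inE ?c'cs ?orbT.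
  by rewrite inE => /predU1P [->|/resP //]; exists a; rewrite -y0.
exists (Some (y, c.2 - a *m rowsmx (size (unzip1 K)) (unzip2 K))); split.
  by have [B1 H1] := evc; exists B1 => b b1 /=; rewrite (H1 _ b1) /= (negPf y0).
by exists c, a; split; rewrite ?inE ?eqxx.
Qed.

Lemma rowsmx_tracked K : (forall c, c \in K -> tracked_ok c) ->
  rowsmx (size (unzip1 K)) (unzip1 K) =
  rowsmx (size (unzip1 K)) (unzip2 K) *m rowsmx t X.
Proof.
move=> Kok; apply/row_matrixP => l; rewrite row_mul.
have lK : (l < size K)%N by apply: leq_trans (ltn_ord l) _; rewrite size_map.
have [e _] := Kok _ (mem_nth (0, 0) lK).
have -> : row l (rowsmx (size (unzip1 K)) (unzip1 K)) = (nth (0, 0) K l).1.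
  by apply/rowP => i; rewrite !mxE (nth_map (0, 0)).
rewrite e; congr (_ *m _).
by apply/rowP => i; rewrite !mxE (nth_map (0, 0)).
Qed.

Lemma gmultE h u g : LMB D h = Some u -> gmult h g = tmon (mlcm u.1 (LM g) - u.1)%MM.
Proof. by rewrite /gmult => ->; case: u. Qed.

Lemma smultsP h h' q : smults D h h' = Some q -> exists u u',
  [/\ LMB D h = Some u, LMB D h' = Some u', u.2 = u'.2 &
   q = ((coef h u)^-1 *: tmon (mlcm u.1 u'.1 - u.1)%MM,
        (coef h' u')^-1 *: tmon (mlcm u.1 u'.1 - u'.1)%MM)].
Proof.
rewrite /smults; case E: (LMB D h) => [u|] //; case E': (LMB D h') => [u'|]; last by case: u {E}.
case: u E => m i E; case: u' E' => m' i' E'; case: eqP => // ii' [<-].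
by exists (m, i), (m', i'); split=> //; rewrite (quotLTE _ E) (quotLTE _ E').
Qed.

Lemma candidates_ok K : (forall c, c \in K -> tracked_ok c) ->
  (forall c, c \in K -> c.1 != 0) ->
  forall c, c \in candidates D K -> tracked_ok c.
Proof.
move=> Kok Kn0 c; rewrite mem_cat => /orP [/allpairsP [[h g] [/= hK gG ->]]|].
  have [e [d [hd hd']]] := Kok h hK; have [u hu] := LMB_neq0 (Kn0 h hK).
  rewrite (gmultE g hu); set q := (_ - _)%MM.
  split; first by rewrite /= e scalemxAl.
  have gq : gradZ (dg q)%:Z (tmon q) := tmon_grad q.
  exists ((dg q)%:Z + d).
  by split; [exact: homogeneousZ erefl gq hd | exact: homogeneousZ erefl gq hd'].
rewrite mem_pmap => /mapP [[h h'] /allpairsP [[h0 h0'] [/= hK h'K [-> ->]]]].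
case E: (smults D _ _) => [q|] //= [->].
have [u [u' [hu hu' uu' ->]]] := smultsP E.
have [e [d [hd hd2]]] := Kok _ hK; have [e' [d' [hd' hd2']]] := Kok _ h'K.
split; first by rewrite /= mulmxBl -!scalemxAl -e -e'.
(* A homogeneous element has the degree of its leading symbol, so both multiples acquire the degree
   of the symbol with monomial L. *)
set L := mlcm _ _; exists (delta u.2 + (dg L)%:Z).
have Lu : dg L = (dg (L - u.1)%MM + dg u.1)%N by rewrite -wdegD submK // lem_mlcml.
have Lu' : dg L = (dg (L - u'.1)%MM + dg u'.1)%N by rewrite -wdegD submK // lem_mlcmr.
have ed : d = delta u.2 + (dg u.1)%:Z.
  by have := LMBP h0.1; rewrite hu => -[_ c0 _ _]; apply: coef_homogeneous hd c0.
have ed' : d' = delta u.2 + (dg u'.1)%:Z.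
  by have := LMBP h0'.1; rewrite hu' uu' => -[_ c0 _ _]; apply: coef_homogeneous hd' c0.
have D1 : delta u.2 + (dg L)%:Z = (dg (L - u.1)%MM)%:Z + d by lia.
have D2 : delta u.2 + (dg L)%:Z = (dg (L - u'.1)%MM)%:Z + d' by lia.
have g1 cf m : gradZ (dg m) (cf *: tmon m) by apply: gradZZ; apply: tmon_grad.
split; apply: homogeneousB.
- exact: homogeneousZ D1 (g1 _ _) hd.
- exact: homogeneousZ D2 (g1 _ _) hd'.
- exact: homogeneousZ D1 (g1 _ _) hd2.
- exact: homogeneousZ D2 (g1 _ _) hd2'.
Qed.

Lemma new_element_ok K c y a : (forall c, c \in K -> tracked_ok c) ->
  (forall c, c \in K -> c.1 != 0) -> tracked_ok c ->
  eventually (fun b => red D b (unzip1 K) c.1) (y, a) ->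
  tracked_ok (y, c.2 - a *m rowsmx (size (unzip1 K)) (unzip2 K)).
Proof.
move=> Kok Kn0 [ce [d [cd cd']]] /redP [cE _ hom].
have yE : y = c.1 - a *m rowsmx (size (unzip1 K)) (unzip1 K).
  by rewrite {1}cE addrC addKr.
split; first by rewrite /= yE mulmxBl -mulmxA -rowsmx_tracked // ce.
have Hh h : h \in unzip1 K -> exists e, homogeneous D delta e h.
  by case/mapP => c' c'K ->; have [_ [e [he _]]] := Kok c' c'K; exists e.
have ad := hom delta d Hh cd; exists d; split=> /=.
  rewrite yE; apply: homogeneousB => //; apply: homogeneous_mulmx ad _ => l.
  have lK : (l < size K)%N by apply: leq_trans (ltn_ord l) _; rewrite size_map.
  have cK := mem_nth (0, 0) lK; have [_ [e [he _]]] := Kok _ cK.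
  rewrite row_rowsmx (nth_map (0, 0)) // (vdegE _ he) //; exact: Kn0.
apply: homogeneousB => //; apply: homogeneous_mulmx ad _ => l.
have lK : (l < size K)%N by apply: leq_trans (ltn_ord l) _; rewrite size_map.
have cK := mem_nth (0, 0) lK; have [_ [e [he he']]] := Kok _ cK.
rewrite (nth_map (0, 0)) // (vdegE (Kn0 _ cK) he).
rewrite (_ : row l _ = (nth (0, 0) K l).2) //.
by apply/rowP => i; rewrite !mxE (nth_map (0, 0)).
Qed.

(** An appended remainder is irreducible, so its leading symbol is divisible by no earlier one and
    [seq_extension_wf] applies. The bounds are kept apart because only [b'] decreases along the
    loop. *)
Lemma GB_loop_spec K : (forall c, c \in K -> tracked_ok c) ->
  (forall c, c \in K -> c.1 != 0) ->
  exists K', [/\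
    exists B, forall b b', (B <= b)%N -> (B <= b')%N -> GB_loop D b b' K = Some K',
    exists E, K' = K ++ E, forall c, c \in K' -> tracked_ok c,
    forall c, c \in K' -> c.1 != 0 &
    forall c, c \in candidates D K' -> exists a,
      eventually (fun b => red D b (unzip1 K') c.1) (0, a)].
Proof.
have [s sE] : exists s, s = pmap (fun c => LMB D c.1) K by exists (pmap (fun c => LMB D c.1) K).
elim/(well_founded_ind (@seq_extension_wf r)): s K sE => s IH K sE Kok Kn0.
have [[yq|] [[B ev] resP]] := first_new_spec K (candidates D K); last first.
  exists K; split=> //; last by exists [::]; rewrite cats0.
  by exists B => b [|b'] Bb _ /=; rewrite ev.
have [c [a [cK evc y0 qE]]] := resP.
have cok := candidates_ok Kok Kn0 cK.
have Kok' : forall c, c \in rcons K yq -> tracked_ok c.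
  move=> c'; rewrite mem_rcons inE => /predU1P [->|/Kok //].
  by rewrite [yq]surjective_pairing qE; apply: new_element_ok evc.
have Kn0' : forall c, c \in rcons K yq -> c.1 != 0.
  by move=> c'; rewrite mem_rcons inE => /predU1P [->|/Kn0 //].
have [u yu] := LMB_neq0 y0.
have [||K' [[B' ev'] [E K'E] K'ok K'n0 K'red]] := IH (rcons s u) _ (rcons K yq) _ Kok' Kn0'.
- exists u; split=> // v; rewrite sE mem_pmap => /mapP [c' c'K c'v].
  have [_ irr _] := redP evc; have yu0 : coef yq.1 u != 0 by have := LMBP yq.1; rewrite yu => -[].
  have lK : (index c' K < size (unzip1 K))%N by rewrite size_map index_mem.
  have := irr u (Ordinal lK) yu0; rewrite /= (nth_map (0, 0)) ?index_mem // nth_index //.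
  by rewrite /LMB_divides -c'v; case: v {c'v}.
- by rewrite -!cats1 pmap_cat -sE /= yu.
exists K'; split=> //; last by exists (yq :: E); rewrite K'E cat_rcons.
exists (maxn B B').+1 => b [|b'] //; rewrite ltnS.
move=> /ltnW; rewrite !geq_max => /andP [Bb B'b] /andP [Bb' B'b'] /=.
by rewrite ev //= ev'.
Qed.

Lemma groebner_candidates K : (forall c, c \in K -> c.1 != 0) ->
  (forall c, c \in candidates D K -> exists a,
      eventually (fun b => red D b (unzip1 K) c.1) (0, a)) -> groebner (unzip1 K).
Proof.
move=> Kn0 Kred; split=> [h /mapP [c cK ->]|e]; first exact: Kn0.
have nthK (l : 'I_(size (unzip1 K))) :
    nth (0, 0) K l \in K /\ nth 0 (unzip1 K) l = (nth (0, 0) K l).1.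
  have lK : (l < size K)%N by apply: leq_trans (ltn_ord l) _; rewrite size_map.
  by rewrite mem_nth // (nth_map (0, 0)).
rewrite mem_cat => /orP [/allpairsP [[l g] [/= _ gG ->]]|].
  have [lK lE] := nthK l; rewrite -scalemxAl -rowE row_rowsmx lE.
  apply: (Kred (_, _)); rewrite mem_cat; apply/orP; left.
  by apply/allpairsP; exists (nth (0, 0) K l, g).
rewrite mem_pmap => /mapP [[l l'] _].
case E: (smults D _ _) => [q|] //= [->].
have [lK lE] := nthK l; have [lK' lE'] := nthK l'.
rewrite mulmxBl -!scalemxAl -!rowE !row_rowsmx lE lE'.
apply: (Kred (_, q.1 *: (nth (0, 0) K l).2 - q.2 *: (nth (0, 0) K l').2)).
rewrite mem_cat; apply/orP; right; rewrite mem_pmap; apply/mapP.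
exists (nth (0, 0) K l, nth (0, 0) K l').
  by apply/allpairsP; exists (nth (0, 0) K l, nth (0, 0) K l').
by rewrite -lE -lE' E.
Qed.

Lemma GBQ_spec : (forall x, x \in X -> x != 0) ->
  (forall x, x \in X -> homogeneous D delta (vdeg D delta x) x) ->
  exists K, [/\ eventually (fun b => GBQ D b X) K,
    groebner (unzip1 K), forall c, c \in K -> tracked_ok c &
    exists E, K = [seq (nth 0 X i, delta_mx 0 i) | i : 'I_t <- enum 'I_t] ++ E].
Proof.
move=> Xn0 Xh.
have [||K [[B ev] KE Kok Kn0 Kred]] :=
  @GB_loop_spec [seq (nth 0 X i, delta_mx 0 i) | i : 'I_t <- enum 'I_t].
- move=> c /mapP [i _ ->]; split; first by rewrite /= -rowE row_rowsmx.
  exists (eps i); split; first by apply: Xh; apply: mem_nth.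
  by rewrite -[delta_mx 0 i]scale1r; apply: homogeneous_delta; rewrite subrr; apply: gradA1.
- by move=> c /mapP [i _ ->]; apply: Xn0; apply: mem_nth.
exists K; split=> //; first by exists B => b Bb; apply: ev.
exact: groebner_candidates.
Qed.

End Loop.
End Groebner.

Section SyzygiesAndMinimization.
Variables (r : nat) (delta : 'I_r -> int).
Implicit Types (h : 'rV[A]_r) (H X Y Z : seq 'rV[A]_r).

Lemma vdeg_LMB h u : LMB D h = Some u -> vdeg D delta h = delta u.2 + (dg u.1)%:Z.
Proof. by rewrite /vdeg => ->; case: u. Qed.

Lemma syz_pairs_homogeneous H e : (forall h, h \in H -> h != 0) ->
  e \in syz_pairs D H ->
  exists d, homogeneous D (fun l : 'I_(size H) => vdeg D delta (nth 0 H l)) d e.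
Proof.
move=> Hn0; have gm cf m : gradZ (dg m) (cf *: tmon m) by apply: gradZZ; apply: tmon_grad.
rewrite mem_cat => /orP [/allpairsP [[l g] [/= _ gG ->]]|].
  have [u hu] := LMB_neq0 (Hn0 _ (mem_nth 0 (ltn_ord l))).
  exists ((dg (mlcm u.1 (LM g) - u.1)%MM)%:Z + vdeg D delta (nth 0 H l)).
  by apply: homogeneous_delta; rewrite (gmultE g hu) addrK; apply: tmon_grad.
rewrite mem_pmap => /mapP [[l l'] _]; case E: (smults D _ _) => [q|] //= [->].
have [u [u' [hu hu' uu' ->]]] := smultsP E; set L := mlcm _ _.
exists (delta u.2 + (dg L)%:Z).
have Lu : dg L = (dg (L - u.1)%MM + dg u.1)%N by rewrite -wdegD submK // lem_mlcml.
have Lu' : dg L = (dg (L - u'.1)%MM + dg u'.1)%N by rewrite -wdegD submK // lem_mlcmr.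
apply: homogeneousB; apply: homogeneous_delta.
  rewrite (vdeg_LMB hu).
  have -> : delta u.2 + (dg L)%:Z - (delta u.2 + (dg u.1)%:Z) = dg (L - u.1)%MM by lia.
  exact: gm.
rewrite (vdeg_LMB hu') -uu'.
have -> : delta u.2 + (dg L)%:Z - (delta u.2 + (dg u'.1)%:Z) = dg (L - u'.1)%MM by lia.
exact: gm.
Qed.

Lemma SYZ_spec X : (forall x, x \in X -> x != 0) ->
  (forall x, x \in X -> homogeneous D delta (vdeg D delta x) x) ->
  exists Y : seq 'rV[A]_(size X), [/\ eventually (fun b => SYZ D b X) Y,
    forall a : 'rV[A]_(size X), a *m rowsmx (size X) X = 0 <-> rowspan Y a &
    forall y, y \in Y ->
      exists d, homogeneous D (fun j : 'I_(size X) => vdeg D delta (nth 0 X j)) d y].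
Proof.
move=> Xn0 Xh; have [K [evK Hgr Kok [E KE]]] := GBQ_spec Xn0 Xh.
set H := unzip1 K in Hgr; pose Q := rowsmx (size H) (unzip2 K).
have HQ : rowsmx (size H) H = Q *m rowsmx (size X) X := rowsmx_tracked Kok.
have [Hn0 Hred] := Hgr.
have nthK (l : 'I_(size H)) : nth (0, 0) K l \in K /\
    (nth 0 H l = (nth (0, 0) K l).1 /\ row l Q = (nth (0, 0) K l).2).
  have lK : (l < size K)%N by apply: leq_trans (ltn_ord l) _; rewrite size_map.
  split; first exact: mem_nth.
  rewrite (nth_map (0, 0)) //; split=> //.
  by apply/rowP => i; rewrite !mxE (nth_map (0, 0)).
have Hh h : h \in H -> exists e, homogeneous D delta e h.
  by case/mapP => c /Kok [_ [e [he _]]] ->; exists e.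
have Hvdeg (l : 'I_(size H)) : homogeneous D delta (vdeg D delta (nth 0 H l)) (nth 0 H l).
  have hl := mem_nth 0 (ltn_ord l); have [e he] := Hh _ hl.
  by rewrite (vdegE (Hn0 _ hl) he).
have Qvdeg (l : 'I_(size H)) : homogeneous D
    (fun j : 'I_(size X) => vdeg D delta (nth 0 X j)) (vdeg D delta (nth 0 H l)) (row l Q).
  have [/Kok [_ [e [he he']]] [eh ->]] := nthK l.
  rewrite eh (vdegE _ he) // -eh; apply: Hn0; exact: mem_nth.
have [S [evS szS SP]] := eventually_mapo (f := fun b e => syz_row D b e)
  (Q := fun e sg => exists a, eventually (fun b => red D b H (e *m rowsmx (size H) H)) (0, a)
     /\ sg = e - a) (s := syz_pairs D H)
  (fun e eP => let: ex_intro a ev := Hred e eP in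
     ex_intro2 _ _ (e - a) (eventually_omap (fun ya => e - ya.2) ev)
       (ex_intro _ a (conj ev erefl))).
exists [seq sg *m Q | sg <- S]; split.
- by apply: eventually_obind evK _; apply: eventually_omap.
- move=> a; split=> [aX|].
    (* Completion only appends, so Q begins with an identity block and [J], the matrix (I 0),
       satisfies J Q = 1. A syzygy a of X thus becomes the syzygy a J of H, and Q brings it back. *)
    pose J : 'M[A]_(size X, size H) := \matrix_(i, l) (i == l :> nat)%:R.
    have JQ : J *m Q = 1%:M.
      apply/row_matrixP => i; rewrite row_mul row1.
      have iH : (i < size H)%N.
        rewrite /H size_map KE size_cat size_map size_enum_ord.
        by apply: leq_trans (ltn_ord i) (leq_addr _ _).
      have -> : row i J = delta_mx 0 (Ordinal iH).
        by apply/rowP => l; rewrite !mxE eqxx /= eq_sym.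
      rewrite -rowE; have [_ [_ ->]] := nthK (Ordinal iH).
      rewrite /= KE nth_cat size_map size_enum_ord ltn_ord /=.
      rewrite (nth_map i) ?size_enum_ord //=.
      by congr (delta_mx _ _); apply: val_inj; rewrite /= nth_enum_ord.
    rewrite -[a]mulmx1 -JQ mulmxA.
    apply: (groebner_syzygy (S := fun v => rowspan [seq sg *m Q | sg <- S] (v *m Q)) Hgr).
    + by rewrite mul0mx; apply: rowspan0.
    + by move=> b u v Su Sv; rewrite mulmxDl -scalemxAl; apply: rowspanD.
    + move=> e a0 eP ev0; apply: rowspan_mem.
      have eidx : (index e (syz_pairs D H) < size (syz_pairs D H))%N by rewrite index_mem.
      have [a1 [ev1 sgE]] := SP 0 0 _ eidx.
      rewrite nth_index // in ev1 sgE; have [a01] := eventually_unique ev0 ev1.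
      by rewrite a01 -sgE; apply: map_f; apply: mem_nth; rewrite szS.
    + by rewrite HQ mulmxA -[a *m J *m Q]mulmxA JQ mulmx1.
  apply: (rowspan_ind (S := fun a => a *m rowsmx (size X) X = 0))
    => [|b u v uX vX|y /mapP [sg sgS ->]].
  + by rewrite mul0mx.
  + by rewrite mulmxDl -scalemxAl uX vX scaler0 addr0.
  have iS : (index sg S < size (syz_pairs D H))%N by rewrite -szS index_mem.
  have [a1 [/redP [e1 _ _]]] := SP 0 0 _ iS; rewrite nth_index // => ->.
  by rewrite -mulmxA -HQ mulmxBl {1}e1 addr0 subrr.
- move=> y /mapP [sg sgS ->].
  have iS : (index sg S < size (syz_pairs D H))%N by rewrite -szS index_mem.
  have [a1 [/redP [_ _ hom]]] := SP 0 0 _ iS; rewrite nth_index // => ->.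
  have [d ed] := syz_pairs_homogeneous Hn0 (mem_nth 0 iS).
  exists d; apply: homogeneous_mulmx Qvdeg; apply: homogeneousB => //.
  by apply: hom => //; apply: homogeneous_mulmx ed _ => l; rewrite row_rowsmx.
Qed.

Lemma GB_spec X : (forall x, x \in X -> x != 0) ->
  (forall x, x \in X -> homogeneous D delta (vdeg D delta x) x) ->
  exists H, [/\ eventually (fun b => GB D b X) H, groebner H,
    forall h, h \in H -> exists d, homogeneous D delta d h &
    forall v, rowspan X v <-> rowspan H v].
Proof.
move=> Xn0 Xh; have [K [evK Hgr Kok [E KE]]] := GBQ_spec Xn0 Xh.
exists (unzip1 K); split=> //; first exact: eventually_omap.
  by move=> h /mapP [c /Kok [_ [d [cd _]]] ->]; exists d.
move=> v; split; apply: rowspan_sub => x.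
  move=> xX; apply: rowspan_mem; rewrite KE /unzip1 map_cat mem_cat -map_comp.
  have iX : (index x X < size X)%N by rewrite index_mem.
  by apply/orP; left; apply/mapP; exists (Ordinal iX); rewrite ?mem_enum //= nth_index.
by case/mapP => c /Kok [ce _] ->; exists c.2.
Qed.

(** Redundancy is tested only against earlier elements, and relative to H since H grows in the
    induction. Full minimality follows from the ordering by degree in [minimal_of_increasing]. *)
Lemma MIN_loop_spec H X : groebner H ->
  (forall h, h \in H -> exists d, homogeneous D delta d h) ->
  (forall x, x \in X -> exists d, homogeneous D delta d x) ->
  exists Y, [/\ eventually (fun b => MIN_loop D b H X) Y, subseq Y X,
    forall x, x \in X -> rowspan (H ++ Y) x &
    forall i, (i < size Y)%N -> ~ rowspan (H ++ take i Y) (nth 0 Y i)].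
Proof.
elim: X H => [|x X IH] H Hgr Hh Xh.
  by exists [::]; split=> //; exists 0%N.
have Xh' z : z \in X -> exists d, homogeneous D delta d z.
  by move=> zX; apply: Xh; rewrite inE zX orbT.
have [y [a [ev]]] := red_spec H x => xE _ _ hom.
case: (eqVneq y 0) => [y0|y0].
  have [Y [evY YX XY Ymin]] := IH H Hgr Hh Xh'; exists Y; split=> //.
  - by apply: eventually_obind ev _; rewrite /= y0 eqxx.
  - exact: subseq_trans YX (subseq_cons _ _).
  - move=> z; rewrite inE => /predU1P [->|/XY //].
    apply: (rowspan_subset (X := H)) => [h hH|]; first by rewrite mem_cat hH.
    by exists a; rewrite {1}xE y0 addr0.
have [d xd] := Xh x (mem_head _ _).
have yd : homogeneous D delta d y.
  have -> : y = x - a *m rowsmx (size H) H by rewrite {1}xE addrC addKr.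
  apply: homogeneousB => //; apply: homogeneous_mulmx (hom _ _ Hh xd) _ => l.
  rewrite row_rowsmx; have hl := mem_nth 0 (ltn_ord l); have [e he] := Hh _ hl.
  by rewrite (vdegE _ he) //; apply: Hgr.1.
have [||H' [evH' H'gr H'h H'span]] := @GB_spec (rcons H y).
- by move=> h; rewrite mem_rcons inE => /predU1P [->|/Hgr.1].
- move=> h; rewrite mem_rcons inE => /predU1P [->|hH]; first by rewrite (vdegE y0 yd).
  by have [e he] := Hh h hH; rewrite (vdegE _ he) //; apply: Hgr.1.
have [Y [evY YX XY Ymin]] := IH H' H'gr H'h Xh'.
have xH' : rowspan H' x.
  rewrite xE; apply/H'span; rewrite -[X in _ + X]scale1r; apply: rowspanD.
    apply: (rowspan_subset (X := H)) => [h hH|]; last by exists a.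
    by rewrite mem_rcons inE hH orbT.
  by apply: rowspan_mem; rewrite mem_rcons mem_head.
have H'H Y' z : rowspan (H' ++ Y') z -> rowspan (H ++ x :: Y') z.
  apply: rowspan_sub => h; rewrite mem_cat => /orP [hH'|hY']; last first.
    by apply: rowspan_mem; rewrite mem_cat inE hY' !orbT.
  have /H'span := rowspan_mem hH'; apply: rowspan_sub => w.
  rewrite mem_rcons inE => /predU1P [->|wH]; last by apply: rowspan_mem; rewrite mem_cat wH.
  have -> : y = x + (-1) *: (a *m rowsmx (size H) H) by rewrite scaleN1r {1}xE addrC addKr.
  apply: rowspanD; first by apply: rowspan_mem; rewrite mem_cat mem_head orbT.
  apply: (rowspan_subset (X := H)) => [h' h'H|]; last by exists a.
  by rewrite mem_cat h'H.
exists (x :: Y); split.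
- apply: eventually_obind ev _; rewrite /= (negPf y0).
  by apply: eventually_obind evH' _; apply: eventually_omap.
- by rewrite /= eqxx.
- move=> z; rewrite inE => /predU1P [->|/XY /H'H //].
  by apply: rowspan_mem; rewrite mem_cat mem_head orbT.
- case=> [_|i iY] /=.
    rewrite cats0 => /(groebner_red Hgr) [a' ev'].
    by have [y0' _] := eventually_unique ev ev'; rewrite y0' eqxx in y0.
  move=> H1; apply: (Ymin i iY); move: H1; apply: rowspan_sub => h.
  rewrite mem_cat inE => /or3P [hH|/eqP ->|hY].
  + apply: (rowspan_subset (X := H')) => [w wH|]; first by rewrite mem_cat wH.
    by apply/H'span; apply: rowspan_mem; rewrite mem_rcons inE hH orbT.
  + by apply: (rowspan_subset (X := H')) xH' => w wH; rewrite mem_cat wH.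
  + by apply: rowspan_mem; rewrite mem_cat hY orbT.
Qed.

Lemma rowspan_take Z l (a : 'rV[A]_(size Z)) :
  (forall j : 'I_(size Z), a 0 j != 0 -> (j < l)%N) ->
  rowspan (take l Z) (a *m rowsmx (size Z) Z).
Proof.
move=> al; rewrite mulmx_sum_row; elim/big_ind: _ => [|x y xl yl|j _].
- exact: rowspan0.
- by rewrite -[y]scale1r; apply: rowspanD.
case: (eqVneq (a 0 j) 0) => [->|/al jl]; first by rewrite scale0r; apply: rowspan0.
rewrite -[_ *: _]add0r; apply: rowspanD; [exact: rowspan0 | apply: rowspan_mem].
rewrite row_rowsmx -(nth_take 0 jl); apply: mem_nth.
by rewrite size_take; case: ifP.
Qed.

(* A relation expressing a generator through the others may be replaced by its
   homogeneous part; the last generator occurring in it with nonzero, hence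
   scalar, coefficient then lies in the span of the preceding ones. *)
Lemma minimal_of_increasing Z :
  sorted (fun x y => vdeg D delta x <= vdeg D delta y) Z ->
  (forall x, x \in Z -> homogeneous D delta (vdeg D delta x) x) ->
  (forall i, (i < size Z)%N -> ~ rowspan (take i Z) (nth 0 Z i)) ->
  forall i, (i < size Z)%N -> ~ rowspan (take i Z ++ drop i.+1 Z) (nth 0 Z i).
Proof.
move=> Zsort Zh Zmin i iZ Zi; pose d l := vdeg D delta (nth 0 Z l).
have dle l l' : (l <= l')%N -> (l' < size Z)%N -> d l <= d l'.
  move=> ll' l'Z; have tr : transitive (fun x y => vdeg D delta x <= vdeg D delta y).
    by move=> y x z; apply: Order.POrderTheory.le_trans.
  have rf : reflexive (fun x y => vdeg D delta x <= vdeg D delta y).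
    by move=> x; apply: Order.POrderTheory.lexx.
  by apply: (sorted_leq_nth tr rf 0 Zsort) => //; rewrite inE ?(leq_ltn_trans ll').
have [a [ai aZ]] : exists a : 'rV[A]_(size Z), a 0 (Ordinal iZ) = 0 /\
    nth 0 Z i = a *m rowsmx (size Z) Z.
  move: Zi; apply: (rowspan_ind (S := fun v => exists a : 'rV[A]_(size Z),
    a 0 (Ordinal iZ) = 0 /\ v = a *m rowsmx (size Z) Z)).
  - by exists 0; rewrite mxE mul0mx.
  - move=> b _ _ [a [ai ->]] [a' [a'i ->]]; exists (a + b *: a').
    by rewrite !mxE ai a'i mulr0 addr0 mulmxDl scalemxAl.
  have unit_row l : (l < size Z)%N -> l != i -> exists a : 'rV[A]_(size Z),
      a 0 (Ordinal iZ) = 0 /\ nth 0 Z l = a *m rowsmx (size Z) Z.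
    move=> lZ li; exists (delta_mx 0 (Ordinal lZ)); rewrite -rowE row_rowsmx; split=> //.
    by rewrite mxE eqxx /= -val_eqE /= eq_sym (negPf li).
  move=> x; rewrite mem_cat => /orP [] /(nthP 0) [l].
    rewrite size_take iZ => li <-; rewrite nth_take //; apply: unit_row.
      exact: ltn_trans li iZ.
    by rewrite neq_ltn li.
  rewrite size_drop ltn_subRL => lZ <-; rewrite nth_drop; apply: unit_row => //.
  by rewrite neq_ltn orbC ltnS leq_addr.
pose a' : 'rV[A]_(size Z) := \row_l gproj (d i - d l) (a 0 l).
have a'Z : nth 0 Z i = a' *m rowsmx (size Z) Z.
  apply/rowP => c.
  have zc (l : 'I_(size Z)) : gradZ (d l - delta c) (nth 0 Z l 0 c) by apply: Zh; apply: mem_nth.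
  have := gproj_homogeneous (d i - delta c) (zc (Ordinal iZ)); rewrite eqxx => <- /=.
  rewrite {1}aZ !mxE gproj_sum; apply: eq_bigr => l _.
  rewrite !mxE (gprojM _ _ (zc l)); congr (gproj _ _ * _).
  by rewrite opprB addrA subrK.
have a'i : a' 0 (Ordinal iZ) = 0 by rewrite mxE ai gproj0.
have a'g (l : 'I_(size Z)) : gradZ (d i - d l) (a' 0 l) by rewrite mxE; apply: gproj_grad.
case: (pickP (fun l : 'I_(size Z) => (a' 0 l != 0) && (i < l)%N)) => [l0 l0P|none]; last first.
  apply: (Zmin i iZ); rewrite a'Z; apply: rowspan_take => j aj.
  rewrite ltnNge leq_eqVlt; apply/negP => /predU1P [ij|ij]; last first.
    by have := none j; rewrite /= aj ij.
  by case/eqP: aj; rewrite -a'i; congr (a' 0 _); apply: val_inj.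
case: (@arg_maxnP _ l0 (fun l : 'I_(size Z) => (a' 0 l != 0) && (i < l)%N)
  (fun l => l : nat) l0P) => l /andP [al il] lmax.
have [c [c0 ac]] : exists c, c != 0 /\ a' 0 l = c%:A.
  have := a'g l; have := dle _ _ (ltnW il) (ltn_ord l).
  case E: (d i - d l) => [e|e]; last by move=> _ /= a0; rewrite a0 eqxx in al.
  move=> ile; have -> : e = 0%N by lia.
  move=> /= /grad0_cst a0; exists (cst D (a' 0 l)); split=> //.
  by apply: contraNneq al => c0; rewrite a0 c0 scale0r.
apply: (Zmin l (ltn_ord l)).
pose b : 'rV[A]_(size Z) := delta_mx 0 (Ordinal iZ) - (a' - a' 0 l *: delta_mx 0 l).
have bZ : nth 0 Z l = (c^-1)%:A *: (b *m rowsmx (size Z) Z).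
  rewrite /b !mulmxBl -scalemxAl -!rowE !row_rowsmx -a'Z opprB addrC subrK.
  by rewrite ac scalerA mulr_algl scalerA mulVf // !scale1r.
rewrite bZ scalemxAl; apply: rowspan_take => j; rewrite /b !mxE eqxx /=.
apply: contraR; rewrite -leqNgt => lj.
have -> : (j == Ordinal iZ) = false by apply: contraTF lj => /eqP ->; rewrite -ltnNge.
rewrite sub0r; case: (j =P l) => [->|/eqP jl]; first by rewrite mulr1 subrr oppr0 mulr0.
rewrite mulr0 subr0.
suff -> : gproj (d i - d j) (a 0 j) = 0 by rewrite oppr0 mulr0.
apply/eqP/negPn/negP => aj; have ij : (i < j)%N by apply: leq_trans il lj.
have := lmax j; rewrite mxE aj ij => /(_ isT) jl'.
by case/negP: jl; rewrite -val_eqE eqn_leq lj andbT; apply: jl'.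
Qed.

Lemma MIN_spec X : (forall x, x \in X -> exists d, homogeneous D delta d x) ->
  exists Z, [/\ eventually (fun b => MIN D delta b X) Z,
    forall z, z \in Z -> z != 0,
    forall z, z \in Z -> homogeneous D delta (vdeg D delta z) z,
    forall v, rowspan X v <-> rowspan Z v &
    forall i, (i < size Z)%N -> ~ rowspan (take i Z ++ drop i.+1 Z) (nth 0 Z i)].
Proof.
move=> Xh; set le := fun x y => vdeg D delta x <= vdeg D delta y.
have le_total : total le by move=> x y; apply: Order.TotalTheory.le_total.
have le_trans : transitive le by move=> y x z; apply: Order.POrderTheory.le_trans.
have [||Z [ev ZX XZ Zmin]] := @MIN_loop_spec [::] (sort le X) (@groebner_nil r).
- by [].
- by move=> x; rewrite mem_sort; apply: Xh.
have Zn0 z : z \in Z -> z != 0.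
  move=> zZ; apply: contra_not_neq (Zmin (index z Z) _); rewrite ?index_mem // nth_index //.
  by move=> ->; apply: rowspan0.
have subZX : {subset Z <= X} by move=> z /(mem_subseq ZX); rewrite mem_sort.
have Zh z : z \in Z -> homogeneous D delta (vdeg D delta z) z.
  by move=> zZ; have [d zd] := Xh _ (subZX z zZ); rewrite (vdegE (Zn0 z zZ) zd).
exists Z; split=> //.
  move=> v; split; last exact: rowspan_subset subZX v.
  by apply: rowspan_sub => x xX; apply: XZ; rewrite mem_sort.
apply: minimal_of_increasing => //.
exact: subseq_sorted ZX (sort_sorted le_total X).
Qed.

End SyzygiesAndMinimization.

(** * Presentations and resolutions *)

(** Nonvanishing of the generators is part of the induction because completion starts from nonzero
    elements; [MIN_spec] supplies it at each stage. *)
Lemma RES_loop_spec s r (delta : 'I_r -> int) (X : seq 'rV[A]_r) (K : 'rV[A]_r -> Prop) :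
  (forall x, x \in X -> x != 0) ->
  (forall x, x \in X -> homogeneous D delta (vdeg D delta x) x) ->
  (forall v, K v <-> rowspan X v) ->
  (forall i, (i < size X)%N -> ~ rowspan (take i X ++ drop i.+1 X) (nth 0 X i)) ->
  exists C, eventually (fun b => RES_loop D b s delta X) C /\ resolves D C delta K.
Proof.
elim: s r delta X K => [|s IH] r delta X K Xn0 Xh XK Xmin.
  exists (Last X); split; first by exists 0%N.
  split=> //; split=> // i iX; exists (nth 0 X i); split; last exact: Xmin.
  by apply/XK; apply: rowspan_mem; apply: mem_nth.
have [Y [evY YK Yh]] := SYZ_spec Xn0 Xh.
have [Z [evZ Zn0 Zh YZ Zmin]] := MIN_spec Yh.
have [v|C [evC CK]] := IH _ _ Z (fun a => a *m rowsmx (size X) X = 0) Zn0 Zh _ Zmin.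
  by rewrite YK.
exists (Defs.Cons C); split.
  apply: eventually_obind evY _; apply: eventually_obind evZ _.
  exact: eventually_omap.
split=> //; split=> // i iX; exists (nth 0 X i); split; last exact: Xmin.
by apply/XK; apply: rowspan_mem; apply: mem_nth.
Qed.

Lemma uniq_unzip1_inj (S T : eqType) (s : seq (S * T)) : uniq (unzip1 s) ->
  {in s &, injective (fun x => x.1)}.
Proof.
elim: s => // z s IH /= /andP [zs /IH {}IH] x y.
rewrite !inE => /predU1P [->|xs] /predU1P [->|ys] // e.
- by case/negP: zs; rewrite e; apply: map_f.
- by case/negP: zs; rewrite -e; apply: map_f.
- exact: IH.
Qed.

Lemma cstB a b : cst D (a - b) = cst D a - cst D b.
Proof. by rewrite addrC -scaleN1r cst_linear mulN1r addrC. Qed.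

Lemma cst0 : cst D 0 = 0.
Proof. by rewrite -(subrr (1 : A)) cstB subrr. Qed.

Lemma cstD a b : cst D (a + b) = cst D a + cst D b.
Proof. by rewrite -{1}[a]scale1r cst_linear mul1r. Qed.

Lemma cst_sum (I : Type) (s : seq I) (Q : pred I) (f : I -> A) :
  cst D (\sum_(i <- s | Q i) f i) = \sum_(i <- s | Q i) cst D (f i).
Proof.
elim: s => [|i s IH]; first by rewrite !big_nil cst0.
by rewrite !big_cons; case: (Q i); rewrite ?cstD IH.
Qed.

(** * Minimal presentations: row reduction and substitution *)

Section Presentation.
Variables (r : nat) (delta : 'I_r -> int) (X : seq 'rV[A]_r).
Hypothesis X_homogeneous : forall x, x \in X -> exists d, homogeneous D delta d x.
Implicit Types (x y z v w : 'rV[A]_r).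
Local Notation pivots := (seq ('I_r * 'rV[A]_r)).

Lemma cst_homogeneous d x j : homogeneous D delta d x -> cst D (x 0 j) != 0 -> d = delta j.
Proof.
by move=> xd xj; have := @coef_homogeneous _ _ _ _ (0%MM, j) xd xj; rewrite /= wdeg0 addr0.
Qed.

Lemma cst_clear j p x i :
  cst D (clear D j p x 0 i) = cst D (x 0 i) - cst D (x 0 j) * cst D (p 0 i).
Proof. by rewrite /clear !mxE cstB mulr_algl -[_ *: _]addr0 cst_linear cst0 addr0. Qed.

(** A nonzero constant entry in column j forces x to have degree [delta j], the degree of p;
    otherwise nothing is subtracted. *)
Lemma clear_homogeneous d j p x : homogeneous D delta (delta j) p ->
  homogeneous D delta d x -> homogeneous D delta d (clear D j p x).
Proof.
move=> pj xd; rewrite /clear; case: (eqVneq (cst D (x 0 j)) 0) => [->|c0].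
  by rewrite !scale0r subr0.
have dj := cst_homogeneous xd c0; rewrite dj in xd *.
apply: homogeneousB => //; rewrite -[_ *: p]addr0; apply: homogeneous_linear => //.
exact: homogeneous0.
Qed.

(* The last clause says that every element of [X] is a k-linear combination of
   the rows of [piv] and [todo]. *)
Definition reduced_on (js : seq 'I_r) (piv : pivots) (todo : seq 'rV[A]_r) : Prop :=
  [/\ forall q, q \in piv -> [/\ rowspan X q.2, homogeneous D delta (delta q.1) q.2 & q.1 \in js],
      forall z, z \in todo -> [/\ rowspan X z, exists d, homogeneous D delta d z
        & forall j, j \in js -> cst D (z 0 j) = 0],
      uniq (unzip1 piv),
      forall q q', q \in piv -> q' \in piv -> cst D (q.2 0 q'.1) = (q.1 == q'.1)%:R
    & forall S : 'rV[A]_r -> Prop, S 0 -> (forall c x y, S x -> S y -> S (c%:A *: x + y)) ->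
        (forall q, q \in piv -> S q.2) -> (forall z, z \in todo -> S z) ->
        forall x, x \in X -> S x].

Lemma row_reduceP js js' piv todo : uniq (js ++ js') -> reduced_on js piv todo ->
  exists todo', reduced_on (js ++ js') (row_reduce D js' piv todo) todo'.
Proof.
elim: js' js piv todo => [|j js' IH] js piv todo; first by exists todo; rewrite cats0.
rewrite -cat_rcons => ujs [pivP todoP upiv pivI span] /=.
have jjs : j \notin js by move: ujs; rewrite cat_uniq rcons_uniq => /andP [/andP []].
case: ltnP => [lt|ge]; last first.
  apply: IH => //; split=> // [q /pivP [q1 q2 q3]|z zt].
    by split=> //; rewrite mem_rcons inE q3 orbT.
  have [z1 z2 z3] := todoP z zt; split=> // i; rewrite mem_rcons inE => /predU1P [->|/z3 //].
  apply/eqP; move: ge; rewrite leqNgt -has_find => /hasPn /(_ z zt).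
  by rewrite negbK.
set l := find _ _ in lt *; set x := nth 0 todo l; set p := _ *: x.
have xt : x \in todo by apply: mem_nth.
have c0 : cst D (x 0 j) != 0.
  by apply: (@nth_find _ 0 (fun x : 'rV[A]_r => cst D (x 0 j) != 0)); rewrite has_find.
have [xX [d xd] xjs] := todoP x xt.
have pE i : cst D (p 0 i) = (cst D (x 0 j))^-1 * cst D (x 0 i).
  by rewrite mxE mulr_algl -[_ *: _]addr0 cst_linear cst0 addr0.
have pjs i : i \in js -> cst D (p 0 i) = 0 by move=> /xjs xi; rewrite pE xi mulr0.
have pj : cst D (p 0 j) = 1 by rewrite pE mulVf.
have pX : rowspan X p by rewrite -[p]add0r; apply: rowspanD => //; apply: rowspan0.
have ph : homogeneous D delta (delta j) p.
  rewrite -(cst_homogeneous xd c0) -[p]addr0; apply: homogeneous_linear => //.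
  exact: homogeneous0.
have clearX z : rowspan X z -> rowspan X (clear D j p z).
  by move=> zX; rewrite /clear -scaleNr; apply: rowspanD.
have sub z : z \in take l todo ++ drop l.+1 todo -> z \in todo.
  by rewrite mem_cat => /orP [/mem_take|/mem_drop].
apply: IH => //; split.
- move=> q; rewrite inE => /predU1P [->|/mapP [q' /pivP [q1 q2 q3] ->]] /=.
    by split=> //; rewrite mem_rcons mem_head.
  split; [exact: clearX | exact: clear_homogeneous |].
  by rewrite mem_rcons inE q3 orbT.
- move=> z /mapP [z' /sub /todoP [z1 [e z2] z3] ->]; split.
  + exact: clearX.
  + by exists e; apply: clear_homogeneous.
  + move=> i; rewrite mem_rcons inE cst_clear => /predU1P [->|ijs].
      by rewrite pj mulr1 subrr.
    by rewrite (pjs i ijs) mulr0 subr0 z3.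
- rewrite /unzip1 /= -map_comp; apply/andP; split=> //.
  by apply: contra jjs => /mapP [q /pivP [_ _ q3] ->].
- move=> q q'; rewrite !inE => /predU1P [->|/mapP [q1 q1P ->]] /predU1P [->|/mapP [q2 q2P ->]] /=.
  + by rewrite pj eqxx.
  + have [_ _ q2js] := pivP _ q2P; rewrite pjs //.
    by case: eqP => // jq; rewrite jq q2js in jjs.
  + have [_ _ q1js] := pivP _ q1P; rewrite cst_clear pj mulr1 subrr.
    by case: eqP => // jq; rewrite -jq q1js in jjs.
  + have [_ _ q2js] := pivP _ q2P.
    by rewrite cst_clear (pjs _ q2js) mulr0 subr0 pivI.
- move=> S S0 SD Spiv Stodo; apply: span => //.
    move=> q qP; have -> : q.2 = (cst D (q.2 0 j))%:A *: p + clear D j p q.2.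
      by rewrite /clear addrC subrK.
    apply: SD; first by apply: (Spiv (j, p)); rewrite mem_head.
    by apply: (Spiv (q.1, clear D j p q.2)); rewrite inE; apply/orP; right; apply/mapP; exists q.
  move=> z zt; have Sp : S p by apply: (Spiv (j, p)); rewrite mem_head.
  have := zt; rewrite -[todo](cat_take_drop l) (drop_nth 0 lt) mem_cat inE => zP.
  have -> : z = (cst D (z 0 j))%:A *: p + clear D j p z by rewrite /clear addrC subrK.
  apply: SD => //.
  (* [x] leaves the list when it becomes the pivot row, but clearing sends it to 0, so the span
     loses nothing. *)
  case: (eqVneq z x) => [->|zx].
    have -> : clear D j p x = 0.
      rewrite /clear.
      by rewrite /p scalerA mulr_algl scalerA mulfV // !scale1r subrr.
    exact: S0.
  apply: Stodo; apply/mapP; exists z => //; rewrite mem_cat.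
  by move: zP; rewrite -/x (negPf zx).
Qed.

Let piv := row_reduce D (enum 'I_r) [::] X.

Lemma row_reduce_spec : exists todo, reduced_on (enum 'I_r) piv todo.
Proof.
apply: (@row_reduceP [::]); first exact: enum_uniq.
by split=> // z zX; split=> //; [apply: rowspan_mem | apply: X_homogeneous].
Qed.

Definition subst_step v := v - \sum_(q <- piv) v 0 q.1 *: q.2.

Lemma subst_step_linear a x y :
  subst_step (x + a *: y) = subst_step x + a *: subst_step y.
Proof.
rewrite /subst_step scalerBr scaler_sumr addrACA -opprD -big_split /=; congr (_ - _).
by apply: eq_bigr => q _; rewrite !mxE scalerDl scalerA.
Qed.

Lemma subst_step_rowspan v : rowspan X (v - subst_step v).
Proof.
have [todo [pivP _ _ _ _]] := row_reduce_spec.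
rewrite /subst_step opprB addrC subrK big_seq; elim/big_ind: _ => [|x y xX yX|q /pivP [qX _ _]].
- exact: rowspan0.
- by rewrite -[y]scale1r; apply: rowspanD.
- by rewrite -[_ *: _]add0r; apply: rowspanD => //; apply: rowspan0.
Qed.

Lemma subst_step_homogeneous d v :
  homogeneous D delta d v -> homogeneous D delta d (subst_step v).
Proof.
have [todo [pivP _ _ _ _]] := row_reduce_spec => vd.
apply: homogeneousB => //; rewrite big_seq; elim/big_ind: _ => [||q /pivP [_ qh _]].
- exact: homogeneous0.
- exact: homogeneousD.
- by apply: homogeneousZ (vd q.1) qh; rewrite subrK.
Qed.

Lemma subst_step_cst v j : cst D (subst_step v 0 j) =
  cst D (v 0 j) - \sum_(q <- piv) cst D (v 0 q.1) * cst D (q.2 0 j).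
Proof.
rewrite /subst_step !mxE cstB summxE cst_sum; congr (_ - _).
by apply: eq_bigr => q _; rewrite !mxE cstM.
Qed.

(** The rows left over have no constant entries, so the constant part of x is a combination of those
    of the pivot rows; these being reduced, its coefficients are the pivot entries of x, exactly
    what the step subtracts. *)
Lemma cst_subst_step x j : x \in X -> cst D (subst_step x 0 j) = 0.
Proof.
move=> xX; rewrite subst_step_cst; apply/eqP; rewrite subr_eq0; apply/eqP.
have [todo [pivP todoP upiv pivI span]] := row_reduce_spec.
have upiv' : uniq piv by apply: map_uniq upiv.
move: j; pose S v := forall j,
  cst D (v 0 j) = \sum_(q <- piv) cst D (v 0 q.1) * cst D (q.2 0 j).
apply: (span S) xX => [j|c v w v0 w0 j|q qP j|z zt j].
- by rewrite mxE cst0 big1 // => q _; rewrite mxE cst0 mul0r.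
- have cstP i : cst D ((c%:A *: v + w) 0 i) = c * cst D (v 0 i) + cst D (w 0 i).
    by rewrite !mxE mulr_algl cst_linear.
  rewrite cstP v0 w0 mulr_sumr -big_split; apply: eq_bigr => q _.
  by rewrite cstP mulrDl mulrA.
- rewrite (bigD1_seq q) //= pivI // eqxx mul1r big_seq_cond big1 ?addr0 // => q' /andP [q'P q'q].
  rewrite pivI //; case: eqP => [e|]; last by rewrite mul0r.
  by case/eqP: q'q; apply: (uniq_unzip1_inj upiv).
- have zj i : cst D (z 0 i) = 0 by have [_ _ -> //] := todoP z zt; rewrite mem_enum.
  by rewrite zj big1 // => q _; rewrite zj mul0r.
Qed.

Lemma subst_step_cst0 v : (forall j, cst D (v 0 j) = 0) ->
  forall j, cst D (subst_step v 0 j) = 0.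
Proof. by move=> v0 j; rewrite subst_step_cst v0 sub0r big1 ?oppr0 // => q _; rewrite v0 mul0r. Qed.

(* A pivot row for the column [j] has degree [delta j] and entry 1 there, so its
   entries in the columns of degree at most [delta j] are known: a substitution
   step moves the pivot entries to columns of strictly smaller degree. *)
Lemma subst_step_triangular v q : q \in piv ->
  (forall q', q' \in piv -> delta q.1 < delta q'.1 -> v 0 q'.1 = 0) ->
  subst_step v 0 q.1 = 0.
Proof.
have [todo [pivP todoP upiv pivI span]] := row_reduce_spec.
have upiv' : uniq piv by apply: map_uniq upiv.
move=> qP vq; rewrite /subst_step !mxE summxE (bigD1_seq q) //= !mxE.
have entry q' : q' \in piv -> ~~ (delta q.1 < delta q'.1) -> q'.2 0 q.1 = (q'.1 == q.1)%:R.
  move=> q'P; rewrite -Order.TotalTheory.leNgt => le; have [_ /(_ q.1) q'h _] := pivP q' q'P.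
  case E: (delta q'.1 - delta q.1) q'h => [e|e] q'h.
    have e0 : e = 0%N by lia.
    rewrite e0 in q'h; rewrite [LHS](grad0_cst q'h) pivI //.
    by case: eqP; rewrite ?scale1r ?scale0r.
  rewrite q'h; case: eqP => // e1; move: E; rewrite e1 subrr.
  by [].
rewrite entry ?eqxx ?mulr1 ?opprD ?addrA ?subrr ?sub0r //; last first.
  by rewrite Order.POrderTheory.ltxx.
rewrite big_seq_cond big1 ?oppr0 // => q' /andP [q'P q'q].
rewrite !mxE; case: (boolP (delta q.1 < delta q'.1)) => [lt|nlt].
  by rewrite vq ?mul0r.
rewrite entry //; case: eqP => [e|]; last by rewrite mulr0.
by case/eqP: q'q; apply: (uniq_unzip1_inj upiv).
Qed.

(** A nonzero pivot entry after a step stems from a nonzero entry, one step earlier, at a pivot of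
    strictly larger degree. Tracing back uses up the columns of larger degree. *)
Lemma iter_subst_step_pivot t v q : q \in piv -> iter t subst_step v 0 q.1 != 0 ->
  (t <= #|[set j | (delta q.1 < delta j)%R]|)%N.
Proof.
elim: t q => // t IH q qP /= nz.
case: (classic (exists2 q', q' \in piv &
    (delta q.1 < delta q'.1) && (iter t subst_step v 0 q'.1 != 0))) => [[q' q'P /andP [lt q'0]]|none].
  apply: leq_ltn_trans (IH q' q'P q'0) _; apply: proper_card; apply/properP; split.
    apply/subsetP => j; rewrite !inE; exact: Order.POrderTheory.lt_trans.
  by exists q'.1; rewrite !inE ?lt // Order.POrderTheory.ltxx.
case/eqP: nz; apply: subst_step_triangular => // q' q'P lt.
by apply/eqP/negPn/negP => q'0; apply: none; exists q' => //; rewrite lt.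
Qed.

(** [r] steps are enough: fewer than r columns can have degree larger than a given one. *)
Definition subst v := iter r subst_step v.

Lemma subst_pivot v q : q \in piv -> subst v 0 q.1 = 0.
Proof.
move=> qP; apply/eqP/negPn/negP => /(iter_subst_step_pivot qP).
rewrite leqNgt => /negP []; rewrite -[X in (_ < X)%N]card_ord -cardsT.
apply: proper_card; apply/properP; split; first exact: subsetT.
by exists q.1; rewrite !inE // Order.POrderTheory.ltxx.
Qed.

Lemma subst_step_id v : (forall q, q \in piv -> v 0 q.1 = 0) -> subst_step v = v.
Proof.
move=> v0; rewrite /subst_step big_seq big1 ?subr0 // => q qP.
by rewrite v0 // scale0r.
Qed.

Lemma subst_id v : (forall q, q \in piv -> v 0 q.1 = 0) -> subst v = v.
Proof. by move=> v0; apply: iter_fix; apply: subst_step_id. Qed.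

Lemma subst_linear a x y : subst (x + a *: y) = subst x + a *: subst y.
Proof.
have H t : iter t subst_step (x + a *: y) = iter t subst_step x + a *: iter t subst_step y.
  by elim: t => //= t ->; apply: subst_step_linear.
exact: H.
Qed.

Lemma subst_rowspan v : rowspan X (v - subst v).
Proof.
suff H t : rowspan X (v - iter t subst_step v) by apply: H.
elim: t => [|t IH] /=; first by rewrite subrr; apply: rowspan0.
have := rowspanD 1 IH (subst_step_rowspan (iter t subst_step v)).
by rewrite scale1r addrA subrK.
Qed.

Lemma subst_homogeneous d v : homogeneous D delta d v -> homogeneous D delta d (subst v).
Proof.
move=> vd; suff H t : homogeneous D delta d (iter t subst_step v) by apply: H.
by elim: t => //= t; apply: subst_step_homogeneous.
Qed.

Lemma cst_subst x j : x \in X -> cst D (subst x 0 j) = 0.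
Proof.
(* A column exists, so at least one substitution step is made; the first one already removes the
   constants. *)
move=> xX; have r0 : (0 < r)%N by apply: leq_trans (ltn_ord j).
have H t : forall j, cst D (iter t.+1 subst_step x 0 j) = 0.
  elim: t => [|t IH] i; first exact: cst_subst_step.
  by rewrite iterS; apply: subst_step_cst0.
by have := H r.-1; rewrite prednK.
Qed.

(** [substitute] may stop before r steps; from then on [subst_step] is the identity, so both results
    agree. *)
Lemma substituteP v : eventually (fun b => substitute b piv v) (subst v).
Proof.
have H t w : (forall q, q \in piv -> iter t subst_step w 0 q.1 = 0) ->
    forall b, (t <= b)%N -> substitute b piv w = Some (iter t subst_step w).
  elim: t w => [|t IH] w wz b tb.
    by case: b tb => [|b] _ /=; case: allP => // -[] q /wz /= ->.
  case: b tb => // b tb /=; case: allP => [w0|_].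
    have w0' q : q \in piv -> w 0 q.1 = 0 by move=> /w0 /eqP.
    by rewrite -iterS iter_fix // subst_step_id.
  rewrite -iterS iterSr; apply: IH => //.
  by move=> q qP; rewrite -iterSr; apply: wz.
by exists r => b rb; apply: H rb => q; apply: subst_pivot.
Qed.

Let B : seq 'I_r := [seq j <- enum 'I_r | j \notin unzip1 piv].
Local Notation sel := (tnth (in_tuple B)).

Lemma sel_notin_pivots j : sel j \notin unzip1 piv.
Proof. by have := mem_tnth j (in_tuple B); rewrite mem_filter => /andP []. Qed.

Lemma sel_inj : injective sel.
Proof. by apply/tuple_uniqP; rewrite filter_uniq // enum_uniq. Qed.

Definition restrict v : 'rV[A]_(size B) := \row_(j < size B) v 0 (sel j).
Definition embed : 'M[A]_(size B, r) := \matrix_(j < size B) delta_mx 0 (sel j).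

Lemma embedE (v : 'rV[A]_(size B)) i :
  (v *m embed) 0 i = \sum_(j < size B) v 0 j * (i == sel j)%:R.
Proof. by rewrite mxE; apply: eq_bigr => j _; rewrite !mxE eqxx. Qed.

Lemma embed_pivot (v : 'rV[A]_(size B)) q : q \in piv -> (v *m embed) 0 q.1 = 0.
Proof.
move=> qP; rewrite embedE big1 // => j _; case: eqP => [e|]; last by rewrite mulr0.
by have := sel_notin_pivots j; rewrite -e map_f.
Qed.

Lemma restrict_embed (v : 'rV[A]_(size B)) : restrict (v *m embed) = v.
Proof.
apply/rowP => j; rewrite mxE embedE (bigD1 j) //= eqxx mulr1 big1 ?addr0 // => i ij.
by rewrite (inj_eq sel_inj) eq_sym (negPf ij) mulr0.
Qed.

Lemma embed_restrict v : (forall q, q \in piv -> v 0 q.1 = 0) -> restrict v *m embed = v.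
Proof.
move=> v0; apply/rowP => i; case: (boolP (i \in unzip1 piv)) => [/mapP [q qP ->]|iB].
  by rewrite embed_pivot // v0.
have /tnthP [j ->] : i \in in_tuple B by rewrite mem_filter iB mem_enum.
rewrite embedE (bigD1 j) //= eqxx mulr1 big1 ?addr0 ?mxE // => j' jj'.
by rewrite (inj_eq sel_inj) eq_sym (negPf jj') mulr0.
Qed.

Let Y : seq 'rV[A]_(size B) := [seq restrict y | y <- [seq subst x | x <- X]].

Lemma PRES_spec : eventually (fun b => PRES D b X)
  (existT (fun B : seq 'I_r => seq 'rV[A]_(size B)) B Y).
Proof.
rewrite /PRES -/piv -/B; apply: (eventually_omap (fun Y : seq 'rV[A]_r =>
  existT (fun B : seq 'I_r => seq 'rV[A]_(size B)) B [seq restrict y | y <- Y])).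
elim: X => [|x s IH]; first by exists 0%N.
apply: eventually_obind (substituteP x) _.
exact: eventually_omap.
Qed.

(** Substitution changes a vector only by relations, and it is linear and fixes vectors without
    pivot entries; hence no relation among the kept basis vectors is lost or added. *)
Lemma PRES_rowspan (v : 'rV[A]_(size B)) : rowspan Y v <-> rowspan X (v *m embed).
Proof.
have restrictD (a : A) x y : restrict (x + a *: y) = restrict x + a *: restrict y.
  by apply/rowP => j; rewrite !mxE.
split.
  apply: (rowspan_ind (S := fun u => rowspan X (u *m embed))) => [|a x y xX yX|y].
  - by rewrite mul0mx; apply: rowspan0.
  - by rewrite mulmxDl -scalemxAl; apply: rowspanD.
  move=> /mapP [_ /mapP [x xX ->] ->]; rewrite embed_restrict; last by move=> q; apply: subst_pivot.
  have := rowspanD (-1) (rowspan_mem xX) (subst_rowspan x).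
  by rewrite scaleN1r opprB addrC subrK.
move=> H; suff : rowspan Y (restrict (subst (v *m embed))).
  by rewrite subst_id ?restrict_embed // => q; apply: embed_pivot.
move: H; apply: (rowspan_ind (S := fun w => rowspan Y (restrict (subst w)))) => [|a x y xX yX|x xX].
- rewrite subst_id; last by move=> q _; rewrite mxE.
  rewrite (_ : restrict 0 = 0); first exact: rowspan0.
  by apply/rowP => j; rewrite !mxE.
- by rewrite subst_linear restrictD; apply: rowspanD.
- by apply: rowspan_mem; apply: map_f; apply: map_f.
Qed.

Lemma PRES_homogeneous (u : 'rV[A]_(size B)) : u \in Y ->
  exists d, homogeneous D (fun j => delta (sel j)) d u.
Proof.
move=> /mapP [_ /mapP [x /X_homogeneous [d xd] ->] ->].
exists d => j; have := subst_homogeneous xd (sel j).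
by rewrite mxE.
Qed.

Lemma PRES_cst (v : 'rV[A]_(size B)) : rowspan Y v -> forall j, cst D (v 0 j) = 0.
Proof.
apply: (rowspan_ind (S := fun u => forall j, cst D (u 0 j) = 0)) => [j|a x y x0 y0 j|u].
- by rewrite mxE cst0.
- by rewrite !mxE cstD cstM x0 y0 mulr0 addr0.
- by move=> /mapP [_ /mapP [x xX ->] ->] j; rewrite mxE; apply: cst_subst.
Qed.

End Presentation.

(** Applied entrywise, the morphism [cst] kills K, so the identity matrix of size B over k factors
    through k^q. *)
Lemma generators_rank (B q : nat) (K : 'rV[A]_B -> Prop)
    (a : 'M[A]_(B, q)) (V : 'M[A]_(q, B)) :
  (forall v, K v -> forall j, cst D (v 0 j) = 0) ->
  (forall j, K (delta_mx 0 j - row j a *m V)) -> (B <= q)%N.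
Proof.
move=> K0 Ka; have aV : (map_mx (cst D) a *m map_mx (cst D) V : 'M[k]_B) = 1%:M.
  apply/matrixP => i j; have := K0 _ (Ka i) j; rewrite !mxE eqxx cstB cst_sum /=.
  move/eqP; rewrite subr_eq0 => /eqP e.
  have -> : (i == j)%:R = cst D (j == i)%:R.
    rewrite eq_sym; case: eqP => _; last by rewrite cst0.
    by have := cst_algebra 1; rewrite scale1r.
  rewrite e; apply: eq_bigr => l _.
  by rewrite !mxE cstM.
by rewrite -(mxrank1 k B) -aV; apply: mulmx_max_rank.
Qed.

Lemma RESOLUTION_spec (r : nat) (delta : 'I_r -> int) (xs : seq 'rV[A]_r)
  (xs_homogeneous : forall x, x \in xs -> exists d, homogeneous D delta d x)
  (N : lmodType A) (pi : {linear 'rV[A]_r -> N})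
  (pi_surjective : forall y : N, exists v, pi v = y)
  (pi_kernel : forall v, pi v = 0 <-> rowspan xs v)
  (s : nat) :
  exists (bound : nat) (o : output A r s),
    (forall b : nat, (bound <= b)%N -> RESOLUTION D s delta xs b = Some o) /\
    let eps (v : 'rV[A]_(rank0 o)) : N := pi (v *m basis0_mx o) in
    [/\ forall y : N, exists v, eps v = y,
        forall (q : nat) (w : 'I_q -> N),
          (forall y : N, exists a : 'I_q -> A, y = \sum_(i < q) a i *: w i) ->
          (rank0 o <= q)%N
      & resolves D (chain o) (fun j => delta (basis0 o j)) (fun v => eps v = 0)].
Proof.
set piv := row_reduce D (enum 'I_r) [::] xs.
set B := [seq j <- enum 'I_r | j \notin unzip1 piv].
pose eps (v : 'rV[A]_(size B)) : N := pi (v *m embed xs).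
have [Z [evZ Zn0 Zh YZ Zmin]] := MIN_spec (PRES_homogeneous xs_homogeneous).
have epsK v : eps v = 0 <-> rowspan Z v.
  by rewrite /eps pi_kernel -(PRES_rowspan xs_homogeneous) YZ.
have [C [evC CK]] := RES_loop_spec s Zn0 Zh epsK Zmin.
pose o : output A r s := @Output A r s _ (tnth (in_tuple B)) C.
have [b0 ev] : eventually (fun b => RESOLUTION D s delta xs b) o.
  apply: eventually_obind (PRES_spec xs_homogeneous) _.
  apply: eventually_obind evZ _.
  exact: eventually_omap.
exists b0, o; split=> //; have eps_surjective y : exists v, eps v = y.
  have [v <-] := pi_surjective y; exists (restrict xs (subst xs v)).
  rewrite /eps embed_restrict; last by move=> q; apply: (subst_pivot xs_homogeneous).
  apply/eqP; rewrite -subr_eq0 -linearB; apply/eqP/pi_kernel.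
  have := rowspanD (-1) (rowspan0 xs) (subst_rowspan xs_homogeneous v).
  by rewrite scaleN1r opprB add0r.
split=> // q w w_gen.
(* [V] lifts the proposed generators to the free module and [a] expresses the images of its basis
   vectors through them, so each basis vector is a row of a V modulo the kernel. *)
have [V VP] := functional_choice _ (fun i => eps_surjective (w i)).
have [a aP] := functional_choice _ (fun j : 'I_(size B) => w_gen (eps (delta_mx 0 j))).
apply: (@generators_rank _ q (fun v => eps v = 0) (\matrix_(j, i) a j i) (\matrix_i V i)).
  by move=> v /epsK /YZ; apply: (PRES_cst xs_homogeneous).
move=> j; rewrite /eps mulmxBl linearB /= -/(eps _) aP.
rewrite [row j _ *m _]mulmx_sum_row mulmx_suml linear_sum /=.
rewrite -sumrB big1 // => i _.
by rewrite !mxE rowK -scalemxAl linearZ /= -/(eps _) VP subrr.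
Qed.

End Algebra.

Theorem theorem1p2 (k : fieldType) (A : algType k) (D : setting A)
  (A_graded : connected_graded D) (A_filtered : filtered D)
  (F_homogeneous : homogeneous_filtration D)
  (gr_A : associated_graded D) (gr_presented : presents_gr D)
  (mle_order : degree_reversed_order D)
  (vle_order : forall r : nat, module_order D r)
  (G_groebner : groebner_basis D) (grc_coord : coordinates D)
  (r : nat) (delta : 'I_r -> int) (xs : seq 'rV[A]_r)
  (xs_homogeneous : forall x, x \in xs -> exists d, homogeneous D delta d x)
  (N : lmodType A) (pi : {linear 'rV[A]_r -> N})
  (pi_surjective : forall y : N, exists v, pi v = y)
  (pi_kernel : forall v, pi v = 0 <-> rowspan xs v)
  (s : nat) :
  exists (bound : nat) (o : output A r s),
    (forall b : nat, (bound <= b)%N -> RESOLUTION D s delta xs b = Some o) /\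
    let eps (v : 'rV[A]_(rank0 o)) : N := pi (v *m basis0_mx o) in
    [/\ forall y : N, exists v, eps v = y,
        forall (q : nat) (w : 'I_q -> N),
          (forall y : N, exists a : 'I_q -> A, y = \sum_(i < q) a i *: w i) ->
          (rank0 o <= q)%N
      & resolves D (chain o) (fun j => delta (basis0 o j)) (fun v => eps v = 0)].
Proof.
exact: RESOLUTION_spec.
Qed.
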